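(* Let $(R,\mathfrak m)$ be a Noetherian local ring with $\dim R>0$ and infinite residue field, let $I$ be a proper ideal of $R$, let $d$ be a positive integer and let $M$ be a finitely generated $R$-module with $\dim_R M\le d$. Then for general elements $a_1,\dots,a_{d-1},a_d$ of $I$ one has \[ \mathrm j_d(I,M)=\mathrm e_I\bigl(M/((a_1,\dots,a_{d-1})M:_M I^\infty)\bigr)=\mathrm{length}_R\Bigl(M\big/\bigl(((a_1,\dots,a_{d-1})M:_M I^\infty)+a_dM\bigr)\Bigr). \]
   Context: For a finitely generated $R$-module $M$ with $\dim_R M\le d$ ($d$ a positive integer), the j-multiplicity of $I$ with respect to $M$ is $\mathrm j_d(I,M)=\lim_{n\to\infty}\frac{(d-1)!}{n^{d-1}}\,\mathrm{length}_R\,\mathrm H^0_{\mathfrak m}(I^nM/I^{n+1}M)$, where $\mathrm H^0_{\mathfrak m}$ is the $0$-th local cohomology functor; the limit exists and is a nonnegative integer. For a submodule $K\subseteq M$, $K:_M I^\infty=\bigcup_{n\ge 0}(K:_M I^n)$. When $d=1$ the submodule $(a_1,\dots,a_{d-1})M$ is $0$. $\mathrm e_I(N)$ denotes the usual Hilbert–Samuel multiplicity of $N$ with respect to $I$ (for $N/IN$ of finite length), with $\mathrm e_I(0)=0$. General elements: an assertion holds for general elements $a_1,\dots,a_i$ of $I$ if it holds whenever they are chosen successively as follows: there is a nonempty Zariski open subset $U_1$ of the $R/\mathfrak m$-vector space $I/\mathfrak mI$ such that for each $a_1\in I$ with image in $U_1$ there is a nonempty Zariski open subset $U_2\subseteq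 I/\mathfrak m I$ (depending on $a_1$) such that for each $a_2\in I$ with image in $U_2$, and so on up to $a_i$. *)

(* Defs.v *)
From HB Require Import structures.
From mathcomp Require Import all_boot all_order all_algebra.
From mathcomp Require Import all_classical all_reals all_analysis.

Set Implicit Arguments.
Unset Strict Implicit.
Unset Printing Implicit Defensive.

Import Order.TTheory GRing.Theory Num.Theory.

Local Open Scope ring_scope.
Local Open Scope classical_set_scope.
Local Open Scope quotient_scope.

Section SubAndQuotientModules.
Variables (R : comNzRingType) (M : lmodType R).

Definition subm (N : submodClosed M) : Type := {x : M | x \in N}.
HB.instance Definition _ (N : submodClosed M) :=
  [isSub of subm N for @sval _ _].
HB.instance Definition _ (N : submodClosed M) := [Choice of subm N by <:].
HB.instance Definition _ (N : submodClosed M) :=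
  [SubChoice_isSubLmodule of subm N by <:].

Section Quotient.
Variable N : submodClosed M.

(* In MathComp, submodClosed does not inherit from zmodClosed, which is what
   the quotient construction of ring_quotient expects. *)
Definition zmodpred : {pred M} := N.

Lemma zmodpred_closed : zmod_closed zmodpred.
Proof.
split; first exact: rpred0.
by move=> x y xN yN; rewrite -scaleN1r; apply: rpredD => //; apply: rpredZ.
Qed.
HB.instance Definition _ := GRing.isZmodClosed.Build M zmodpred zmodpred_closed.

Definition quom : Type := Quotient.quot zmodpred.
HB.instance Definition _ := Choice.on quom.
HB.instance Definition _ := GRing.Zmodule.on quom.
HB.instance Definition _ := EqQuotient.on quom.
HB.instance Definition _ :=
  @isZmodQuotient.Build M (Quotient.equiv zmodpred) 0 -%R +%R quom
    (@pi_zeror _ _ _ _ _ (Quotient.quot zmodpred))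
    (@pi_oppr _ _ _ _ _ (Quotient.quot zmodpred))
    (@pi_addr _ _ _ _ _ (Quotient.quot zmodpred)).

Definition scaleq (a : R) (x : quom) : quom := \pi_quom (a *: repr x).

Lemma pi_scaleq a x : \pi_quom (a *: x) = scaleq a (\pi_quom x).
Proof.
have: x = repr (\pi_quom x) %[mod quom] by exact: esym (reprK (\pi_quom x)).
move=> /eqmodP xr; apply/eqmodP.
by rewrite /= /Quotient.equiv -scalerBr; apply: (@rpredZ _ _ N).
Qed.

Lemma scaleqA a b x : scaleq a (scaleq b x) = scaleq (a * b) x.
Proof.
elim/quotW: x => x.
by rewrite -(pi_scaleq b) -(pi_scaleq a) -(pi_scaleq (a * b)) scalerA.
Qed.

Lemma scale1q : left_id 1 scaleq.
Proof. by elim/quotW=> x; rewrite -pi_scaleq scale1r. Qed.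

Lemma scaleqDr : right_distributive scaleq +%R.
Proof.
move=> a; elim/quotW=> x; elim/quotW=> y.
rewrite -(pi_scaleq a x) -(pi_scaleq a y) -!pi_addr -pi_scaleq.
by rewrite scalerDr.
Qed.

Lemma scaleqDl x : {morph scaleq^~ x : a b / a + b}.
Proof.
elim/quotW: x => x a b /=.
by rewrite -(pi_scaleq a) -(pi_scaleq b) -(pi_scaleq (a + b)) -pi_addr scalerDl.
Qed.

HB.instance Definition _ := GRing.Zmodule_isLmodule.Build R quom
  scaleqA scale1q scaleqDr scaleqDl.
End Quotient.

End SubAndQuotientModules.

Section Submodules.
Variables (R : comNzRingType) (M : lmodType R).

Definition fullm : {pred M} := predT.
Lemma fullm_closed : submod_closed fullm. Proof. by []. Qed.
HB.instance Definition _ := GRing.isSubmodClosed.Build R M fullm fullm_closed.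

Definition zerom : {pred M} := pred1 0.
Lemma zerom_closed : submod_closed zerom.
Proof.
split; first exact: eqxx.
by move=> a x y /eqP-> /eqP->; rewrite scaler0 addr0; apply: eqxx.
Qed.
HB.instance Definition _ := GRing.isSubmodClosed.Build R M zerom zerom_closed.

Definition genm (S : set M) : {pred M} :=
  [pred x | `[< forall N : submodClosed M, S `<=` [set` N] -> x \in N >]].
Lemma genm_closed S : submod_closed (genm S).
Proof.
split; first by apply/asboolP => N _; apply: rpred0.
move=> a x y /asboolP xS /asboolP yS; apply/asboolP => N SN.
by rewrite rpredD ?rpredZ ?xS ?yS.
Qed.
HB.instance Definition _ S :=
  GRing.isSubmodClosed.Build R M (genm S) (genm_closed S).

Definition mulm (J : submodClosed R^o) (N : submodClosed M) : submodClosed M :=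
  genm [set y | exists a x, [/\ a \in J, x \in N & y = (a : R) *: x]].

Definition addm (N L : submodClosed M) : submodClosed M :=
  genm ([set` N] `|` [set` L]).

Definition annm : {pred R^o} :=
  [pred a : R | `[< forall x : M, a *: x = 0 >]].

Definition finitely_generated (N : submodClosed M) :=
  exists s : seq M, N =i genm [set` s].

(* the preimage in N of L, so that N / L is quom (restrm N L) when L <= N *)
Definition restrm (N L : submodClosed M) : {pred subm N} :=
  [pred x | val x \in L].
Lemma restrm_closed N L : submod_closed (@restrm N L).
Proof.
split; first exact: (rpred0 L).
move=> a x y; rewrite !inE /= => xL yL.
by apply: rpredD => //; apply: rpredZ.
Qed.
HB.instance Definition _ N L :=
  GRing.isSubmodClosed.Build R (subm N) (@restrm N L) (@restrm_closed N L).

End Submodules.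

Arguments fullm {R} M.
Arguments zerom {R} M.
Arguments annm {R} M.
Arguments restrm {R M} N L.

Section Ideals.
Variable R : comNzRingType.

(* an ideal as a submodule of R *)
Definition idl (I : idealr R) : {pred R^o} := I.
Lemma idl_closed I : submod_closed (idl I).
Proof.
split; first exact: (rpred0 I).
by move=> a x y xI yI; apply: (rpredD (idealMr a xI) yI).
Qed.
HB.instance Definition _ I :=
  GRing.isSubmodClosed.Build R R^o (idl I) (idl_closed I).

Definition idgen (s : seq R) : submodClosed R^o :=
  @genm R R^o [set` s].

Fixpoint idealX (J : submodClosed R^o) (n : nat) : submodClosed R^o :=
  if n is n'.+1 then mulm J (idealX J n') else fullm R^o.

Definition satm (M : lmodType R) (N : submodClosed M) (J : submodClosed R^o) :
    {pred M} :=
  [pred x | `[< exists n, forall a, a \in idealX J n -> (a : R) *: x \in N >]].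

Lemma idealX_decr J m n : {subset idealX J (m + n) <= idealX J n}.
Proof.
elim: m => // m IH x; rewrite addSn /= => /asboolP; apply=> _ [a [y [_ yJ ->]]].
by rewrite /= rpredZ ?IH.
Qed.

Lemma satm_closed M N J : submod_closed (@satm M N J).
Proof.
split; first by apply/asboolP; exists 0%N => a _; rewrite scaler0 rpred0.
move=> c x y /asboolP[m xN] /asboolP[n yN]; apply/asboolP.
exists (m + n)%N => a aJ; rewrite scalerDr rpredD ?yN ?(idealX_decr aJ)//.
rewrite scalerA mulrC -scalerA rpredZ ?xN//.
by move: aJ; rewrite addnC; apply: idealX_decr.
Qed.
HB.instance Definition _ M N J :=
  GRing.isSubmodClosed.Build R M (@satm M N J) (satm_closed N J).

(* H^0_J, the elements annihilated by a power of J *)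
Definition H0 (J : submodClosed R^o) (M : lmodType R) : submodClosed M :=
  satm (zerom M) J.

End Ideals.

Definition noetherian (R : comNzRingType) :=
  forall J : submodClosed R^o, finitely_generated J.

Section LocalRing.
Variable R : comNzRingType.

(* idealr R is the type of proper ideals of R *)
Definition maximal_ideal (m : idealr R) :=
  forall J : idealr R, {subset m <= J} -> J =i m.

Definition local_ring_with (m : idealr R) :=
  maximal_ideal m /\ forall J : idealr R, maximal_ideal J -> J =i m.

End LocalRing.

Section Invariants.
Variables (K : realType) (R : comNzRingType).

Definition submod_chain (M : lmodType R) (n : nat) :=
  exists N : nat -> submodClosed M, forall i, (i < n)%N ->
    {subset N i <= N i.+1} /\ ~ {subset N i.+1 <= N i}.

Definition length (M : lmodType R) : \bar K :=
  ereal_sup [set n%:R%:E | n in submod_chain M].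

Definition prime_chain (J : {pred R}) (n : nat) :=
  exists p : nat -> prime_idealr R,
    (forall i, (i <= n)%N -> {subset J <= p i}) /\
    forall i, (i < n)%N -> {subset p i <= p i.+1} /\ ~ {subset p i.+1 <= p i}.

(* dimension of R / J; it is -oo when J is the unit ideal *)
Definition krull_dim (J : {pred R}) : \bar K :=
  ereal_sup [set n%:R%:E | n in prime_chain J].

Definition dimm (M : lmodType R) : \bar K := krull_dim (annm M).

Definition grm (I : submodClosed R^o) (M : lmodType R) (n : nat) : lmodType R :=
  quom (restrm (mulm (idealX I n) (fullm M)) (mulm (idealX I n.+1) (fullm M))).

(* limn is a total function: jmult and hs_mult below are meaningful when the
   sequences jmult_seq and hs_seq converge. *)
Definition jmult_seq (m : submodClosed R^o) (d : nat) (I : submodClosed R^o)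
    (M : lmodType R) (n : nat) : \bar K :=
  (((d.-1)`!%:R / n%:R ^+ d.-1)%:E * length (subm (H0 m (grm I M n))))%E.

Definition jmult m d I M : \bar K := limn (jmult_seq m d I M).

(* For N = 0 the dimension is -oo and fine (-oo) = 0, so that the sequence is
   identically 0 and the multiplicity is 0. *)
Definition hs_seq (I : submodClosed R^o) (N : lmodType R) (n : nat) : \bar K :=
  let D := Num.truncn (fine (dimm N)) in
  ((D`!%:R / n%:R ^+ D)%:E * length (quom (mulm (idealX I n) (fullm N))))%E.

Definition hs_mult I N : \bar K := limn (hs_seq I N).

End Invariants.

Section GeneralElements.
Variables (R : comNzRingType) (m : idealr R).

Section Zariski.
Variable V : lmodType R.
Local Notation k := {ideal_quot m}.

(* Polynomial functions on V, to be used when m V = 0, i.e. when V is a vector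
   space over the residue field k: the subalgebra of k ^ V generated by the
   constants and the k-linear forms. *)
Inductive polyfun : (V -> k) -> Prop :=
| polyfun_cst c : polyfun (fun=> c)
| polyfun_lin (f : V -> k) :
    (forall x y, f (x + y) = f x + f y) ->
    (forall a x, f (a *: x) = \pi_k a * f x) -> polyfun f
| polyfun_add f g : polyfun f -> polyfun g -> polyfun (fun x => f x + g x)
| polyfun_mul f g : polyfun f -> polyfun g -> polyfun (fun x => f x * g x).

Definition zariski_closed (Z : set V) :=
  exists2 S : set (V -> k), S `<=` polyfun &
    Z = [set x | forall f, S f -> f x = 0].

Definition zariski_open (U : set V) := zariski_closed (~` U).

End Zariski.

(* I / m I *)
Definition cotm (I : idealr R) : lmodType R :=
  quom (mulm (idl m) (fullm (subm (idl I)))).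

(* P holds for general elements a_1, ..., a_i of I, given to P as a list *)
Fixpoint general (I : idealr R) (i : nat) (P : seq R -> Prop) : Prop :=
  if i is i'.+1 then
    exists U : set (cotm I), [/\ zariski_open U, U !=set0 &
      forall a : subm (idl I), U (\pi_(quom _) a) ->
        general I i' (fun s => P (val a :: s))]
  else P [::].

End GeneralElements.

(* Main.v *)
(* Everything is measured by lengths of subquotients of M. Replacing M by
   M / (0 : I^oo) changes neither side: by Artin-Rees the torsion meets I^n M
   trivially for large n. Now a general a in I is regular on M and superficial, and
   dim M / aM < dim M.

   If dim M <= 1, then I^(n+1) M = a I^n M for large n, and every length in sight
   equals that of M / aM.

   Otherwise let G = gr_I M and C = G / H^0_m(G). Multiplication by the initial form
   of a is injective in large degrees on G, C and C / mC, and
     length H^0_m(gr_I (M/aM))_n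
        = length H^0_m(G)_n - length H^0_m(G)_(n-1) + length H^0_m(C / aC)_n.
   The error term embeds in (C / aC)_n / m^j for some j independent of n, so it is at
   most a constant times g(n) - g(n-1), where g(n) is the length of (C / mC)_n. Since
   m contains a C-regular element, g grows one degree slower than the limit requires,
   the error terms telescope, and Stolz-Cesaro gives j_(d+1)(I, M) = j_d(I, M/aM).

   Genericity is handled without primary decomposition: an element of I is regular
   (up to I-torsion, or in large degrees) on a given filtered quotient as soon as it
   avoids finitely many proper subideals of I, the annihilators met in a Noetherian
   induction. Graded Noetherianity is Hilbert's basis theorem for families of
   submodules of M, with no polynomial ring. *)

From HB Require Import structures.
Require Import Defs.
From mathcomp Require Import all_boot all_order all_algebra.
From mathcomp Require Import all_classical all_reals all_analysis.
From mathcomp Require Import zify ring lra.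

Set Implicit Arguments.
Unset Strict Implicit.
Unset Printing Implicit Defensive.

Import Order.TTheory GRing.Theory Num.Theory.

Local Open Scope ring_scope.

(** * The lattice of submodules *)

(** The degree n part of gr_I M need not have finite length, so it is measured modulo m^j, with
    bounds uniform in n: its length is at most c (n+j+1)^(d-1) for large n when 0 < d and dim M <=
    d. An element of m regular on C forces the length of (C / m^j C)_n to grow at least linearly in
    j, with slope proportional to g(n). Taking j proportional to n leaves g(n) = O(n^(d-2)), against
    the normalisation n^(d-1). This requires Artin-Rees constants that do not depend on n, hence the
    families with two degrees.

    The quotient M/aM depends on a, and so a priori does the number that the induction attaches to
    it. But the limits found for different a are limits of one sequence, that of M, so the number is
    the same for all general a. For this reason the convergence and the length formula are proved
    together, with the value fixed before the elements are chosen.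

    The infinite residue field is used through a sequence [t] whose differences are units. *)

Section SubmoduleLattice.
Variables (R : comNzRingType) (M : lmodType R).

(* Prop-valued counterpart of submodClosed: mutual inclusion implies equality. *)
Record submod := Submod {
  submod_mem :> M -> Prop;
  submod0 : submod_mem 0;
  submod_lin : forall a x y,
    submod_mem x -> submod_mem y -> submod_mem (a *: x + y) }.

Implicit Types (A B C N L P : submod) (J : R -> Prop).
Arguments submod_mem : simpl never.

Lemma submodD A x y : A x -> A y -> A (x + y).
Proof. by move=> Ax Ay; rewrite -[x]scale1r; apply: submod_lin. Qed.

Lemma submodZ A a x : A x -> A (a *: x).
Proof. by move=> Ax; rewrite -[_ *: _]addr0; apply: submod_lin => //; apply: submod0. Qed.

Lemma submodN A x : A x -> A (- x).
Proof. by rewrite -scaleN1r; apply: submodZ. Qed.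

Lemma submodB A x y : A x -> A y -> A (x - y).
Proof. by move=> Ax Ay; apply: submodD => //; apply: submodN. Qed.

Definition sle A B := forall x, A x -> B x.

Lemma submod_ext A B : sle A B -> sle B A -> A = B.
Proof.
move=> AB BA; have : submod_mem A = submod_mem B.
  by apply/funext => x; apply/propext; split; [apply: AB|apply: BA].
case: A B {AB BA} => [A A0 Al] [B B0 Bl]; rewrite /submod_mem => E.
by move: A0 Al B0 Bl; rewrite E => A0 Al B0 Bl;
   rewrite (Prop_irrelevance A0 B0) (Prop_irrelevance Al Bl).
Qed.

Lemma sle_refl A : sle A A. Proof. by []. Qed.
Hint Resolve sle_refl : core.

Lemma sle_trans B A C : sle A B -> sle B C -> sle A C.
Proof. by move=> AB BC x /AB /BC. Qed.

Definition sfull : submod := @Submod (fun=> True) I (fun _ _ _ _ _ => I).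

Lemma sle_full A : sle A sfull. Proof. by []. Qed.

Definition szero : submod.
Proof.
exists (fun x => x = 0) => // a x y -> ->.
by rewrite scaler0 addr0.
Defined.

Lemma szero_le A : sle szero A. Proof. by move=> x ->; apply: submod0. Qed.

Definition sadd A B : submod.
Proof.
exists (fun x => exists2 y, A y & B (x - y)).
  by exists 0; [apply: submod0|rewrite subr0; apply: submod0].
move=> a x y [u Au Bu] [v Av Bv]; exists (a *: u + v); first exact: submod_lin.
have -> : a *: x + y - (a *: u + v) = a *: (x - u) + (y - v).
  by rewrite scalerBr opprD !addrA; congr (_ + _); rewrite addrAC.
exact: submod_lin.
Defined.

Definition scap A B : submod.
Proof.
exists (fun x => A x /\ B x); first by split; apply: submod0.
by move=> a x y [Ax Bx] [Ay By]; split; apply: submod_lin.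
Defined.

Local Infix "<=:" := sle (at level 70, no associativity).
Local Infix "+:" := sadd (at level 50, left associativity).
Local Infix "&:" := scap (at level 48, left associativity).

Lemma mem_sadd A B x y : A x -> B y -> (A +: B) (x + y).
Proof. by move=> Ax By; exists x; rewrite // addrC addKr. Qed.

Lemma saddl A B : A <=: A +: B.
Proof. by move=> x Ax; rewrite -[x]addr0; apply: mem_sadd => //; apply: submod0. Qed.

Lemma saddr A B : B <=: A +: B.
Proof. by move=> x Bx; rewrite -[x]add0r; apply: mem_sadd => //; apply: submod0. Qed.

Lemma sadd_le A B C : A <=: C -> B <=: C -> A +: B <=: C.
Proof. by move=> AC BC x [y /AC Cy /BC Cxy]; rewrite -(subrK y x); apply: submodD. Qed.

Lemma sadd_mono A A' B B' : A <=: A' -> B <=: B' -> A +: B <=: A' +: B'.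
Proof.
move=> AA BB; apply: sadd_le; [apply: sle_trans AA _; apply: saddl|].
by apply: sle_trans BB _; apply: saddr.
Qed.

Lemma saddC A B : A +: B = B +: A.
Proof.
have H C D : C +: D <=: D +: C by apply: sadd_le; [apply: saddr|apply: saddl].
by apply: submod_ext; apply: H.
Qed.

Lemma saddA A B C : A +: (B +: C) = A +: B +: C.
Proof.
apply: submod_ext.
  apply: sadd_le; first exact: sle_trans (@saddl A B) (@saddl _ _).
  apply: sadd_le; last exact: saddr.
  exact: sle_trans (@saddr A B) (@saddl _ _).
apply: sadd_le; last exact: sle_trans (@saddr B C) (@saddr _ _).
apply: sadd_le; first exact: saddl.
exact: sle_trans (@saddl B C) (@saddr _ _).
Qed.

Lemma sadd_idl A B : A <=: B -> A +: B = B.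
Proof.
by move=> AB; apply: submod_ext; [apply: sadd_le|apply: saddr].
Qed.

Lemma sadd_idr A B : A <=: B -> B +: A = B.
Proof. by rewrite saddC; apply: sadd_idl. Qed.

Lemma scapl A B : A &: B <=: A. Proof. by move=> x []. Qed.
Lemma scapr A B : A &: B <=: B. Proof. by move=> x []. Qed.

Lemma scap_le A B C : C <=: A -> C <=: B -> C <=: A &: B.
Proof. by move=> CA CB x Cx; split; [apply: CA|apply: CB]. Qed.

Lemma scap_mono A A' B B' : A <=: A' -> B <=: B' -> A &: B <=: A' &: B'.
Proof. by move=> AA BB x [/AA ? /BB ?]. Qed.

Lemma scapC A B : A &: B = B &: A.
Proof. by apply: submod_ext => x []. Qed.

Lemma scap_idl A B : A <=: B -> A &: B = A.
Proof. by move=> AB; apply: submod_ext => [x []//|x Ax]; split=> //; apply: AB. Qed.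

Lemma smodular A B C : A <=: C -> (A +: B) &: C = A +: B &: C.
Proof.
move=> AC; apply: submod_ext; last first.
  apply: sadd_le; first by apply: scap_le => //; apply: saddl.
  by apply: scap_mono => //; apply: saddr.
move=> x [[y Ay Bxy] Cx]; exists y => //; split=> //.
by apply: submodB => //; apply: AC.
Qed.

(** [J] is an arbitrary set, so that the same product serves an ideal and a finite list of its
    generators. Quantifying over submodules avoids finite sums. *)
Definition imul J A : submod.
Proof.
exists (fun x => forall N : submod, (forall a y, J a -> A y -> N (a *: y)) -> N x).
  by move=> N _; apply: submod0.
by move=> a x y Hx Hy N HN; apply: submod_lin; [apply: Hx|apply: Hy].
Defined.

Lemma imul_leP J A B :
  imul J A <=: B <-> (forall a y, J a -> A y -> B (a *: y)).
Proof.
split=> [H a y Ja Ay|H x]; last by apply.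
by apply: H => N; apply.
Qed.

Lemma mem_imul J A a y : J a -> A y -> imul J A (a *: y).
Proof. by move: a y; apply/imul_leP. Qed.

Lemma imul_mono J A B : A <=: B -> imul J A <=: imul J B.
Proof. by move=> AB; apply/imul_leP => a y Ja /AB; apply: mem_imul. Qed.

Lemma imul_monol J J' A : (forall a, J a -> J' a) -> imul J A <=: imul J' A.
Proof. by move=> JJ; apply/imul_leP => a y /JJ; apply: mem_imul. Qed.

Lemma imul_le J A : imul J A <=: A.
Proof. by apply/imul_leP => a y _; apply: submodZ. Qed.

Definition colon J A : submod.
Proof.
exists (fun x => forall a, J a -> A (a *: x)).
  by move=> a _; rewrite scaler0; apply: submod0.
move=> c x y Hx Hy a Ja; rewrite scalerDr scalerA mulrC -scalerA.
by apply: submod_lin; [apply: Hx|apply: Hy].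
Defined.

Lemma imul_colon J A B : imul J A <=: B <-> A <=: colon J B.
Proof.
split=> [/imul_leP H y Ay a Ja|H]; first exact: H.
by apply/imul_leP => a y Ja /H; apply.
Qed.

Lemma colon_mono J A B : A <=: B -> colon J A <=: colon J B.
Proof. by move=> AB x Ax a /Ax /AB. Qed.

Lemma colon_ge J A : A <=: colon J A.
Proof. by move=> x Ax a _; apply: submodZ. Qed.

Lemma imulD J A B : imul J (A +: B) = imul J A +: imul J B.
Proof.
apply: submod_ext; last first.
  by apply: sadd_le; apply: imul_mono; [apply: saddl|apply: saddr].
apply/imul_colon; apply: sadd_le; apply/imul_colon; [exact: saddl|exact: saddr].
Qed.

Lemma imulC J J' A : imul J (imul J' A) = imul J' (imul J A).
Proof.
have H K K' : imul K (imul K' A) <=: imul K' (imul K A).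
  apply/imul_colon/imul_leP => b y K'b Ay a Ka.
  by rewrite scalerA mulrC -scalerA; do 2?apply: mem_imul.
by apply: submod_ext; apply: H.
Qed.

Lemma imul0 J : imul J szero = szero.
Proof.
by apply: submod_ext; [apply: imul_le|apply: szero_le].
Qed.

Definition amul (a : R) A : submod.
Proof.
exists (fun x => exists2 y, A y & x = a *: y).
  by exists 0; rewrite ?scaler0 //; apply: submod0.
move=> c _ _ [x Ax ->] [y Ay ->]; exists (c *: x + y); first exact: submod_lin.
by rewrite scalerDr !scalerA mulrC.
Defined.

Definition ainv (a : R) A : submod.
Proof.
exists (fun x => A (a *: x)); first by rewrite scaler0; apply: submod0.
move=> c x y Hx Hy; rewrite scalerDr scalerA mulrC -scalerA.
exact: submod_lin.
Defined.

Lemma mem_amul a A x : A x -> amul a A (a *: x).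
Proof. by move=> Ax; exists x. Qed.

Lemma amul_le a A : amul a A <=: A.
Proof. by move=> _ [x Ax ->]; apply: submodZ. Qed.

Lemma amul_mono a A B : A <=: B -> amul a A <=: amul a B.
Proof. by move=> AB _ [x /AB Bx ->]; exists x. Qed.

Lemma amul_imul_le J a A : J a -> amul a A <=: imul J A.
Proof. by move=> Ja _ [x Ax ->]; apply: mem_imul. Qed.

Lemma amulD a A B : amul a (A +: B) = amul a A +: amul a B.
Proof.
apply: submod_ext; last first.
  by apply: sadd_le; apply: amul_mono; [apply: saddl|apply: saddr].
move=> _ [x [y Ay Bxy] ->]; rewrite -(subrK y x) scalerDr addrC.
by apply: mem_sadd; apply: mem_amul.
Qed.

Lemma imul_amul J a A : imul J (amul a A) = amul a (imul J A).
Proof.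
apply: submod_ext.
  apply/imul_leP => b _ Jb [y Ay ->].
  by rewrite scalerA mulrC -scalerA; apply/mem_amul/mem_imul.
move=> _ [x + ->].
apply: (_ : imul J A <=: ainv a (imul J (amul a A))) => {x}.
apply/imul_leP => b y Jb Ay.
change (imul J (amul a A) (a *: (b *: y))).
rewrite scalerA mulrC -scalerA; by apply: mem_imul => //; apply: mem_amul.
Qed.

Definition cyc (x : M) : submod.
Proof.
exists (fun y => exists r, y = r *: x); first by exists 0; rewrite scale0r.
by move=> a _ _ [r ->] [s ->]; exists (a * r + s); rewrite scalerDl scalerA.
Defined.

Lemma mem_cyc x : cyc x x. Proof. by exists 1; rewrite scale1r. Qed.

Lemma cyc_le x A : A x -> cyc x <=: A.
Proof. by move=> Ax _ [r ->]; apply: submodZ. Qed.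

Definition ipow J n A := iter n (imul J) A.
Definition cpow J n A := iter n (colon J) A.

Lemma ipowSr J n A : ipow J n.+1 A = ipow J n (imul J A).
Proof. exact: iterSr. Qed.

Lemma ipowD J m n A : ipow J (m + n) A = ipow J m (ipow J n A).
Proof. exact: iterD. Qed.

Lemma cpowD J m n A : cpow J (m + n) A = cpow J m (cpow J n A).
Proof. exact: iterD. Qed.

Lemma ipow_mono J n A B : A <=: B -> ipow J n A <=: ipow J n B.
Proof. by move=> AB; elim: n => //= n; apply: imul_mono. Qed.

Lemma cpow_mono J n A B : A <=: B -> cpow J n A <=: cpow J n B.
Proof. by move=> AB; elim: n => //= n; apply: colon_mono. Qed.

Lemma ipow_le J n A : ipow J n A <=: A.
Proof. by elim: n => //= n IH; apply: sle_trans IH; apply: imul_le. Qed.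

Lemma ipow_anti J m n A : (m <= n)%N -> ipow J n A <=: ipow J m A.
Proof. by move=> /subnK <-; rewrite ipowD; apply: ipow_le. Qed.

Lemma cpow_ge J n A : A <=: cpow J n A.
Proof. by elim: n => //= n IH; apply: sle_trans IH _; apply: colon_ge. Qed.

Lemma cpow_incr J m n A : (m <= n)%N -> cpow J m A <=: cpow J n A.
Proof. by move=> /subnK <-; rewrite cpowD; apply: cpow_ge. Qed.

Lemma ipow_cpow J n A B : ipow J n A <=: B <-> A <=: cpow J n B.
Proof.
elim: n A B => // n IH A B; rewrite ipowSr IH.
by rewrite imul_colon.
Qed.

Lemma ipowDr J n A B : ipow J n (A +: B) = ipow J n A +: ipow J n B.
Proof. by elim: n => //= n ->; rewrite imulD. Qed.

Lemma imul_ipow J J' n A : imul J (ipow J' n A) = ipow J' n (imul J A).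
Proof. by elim: n => //= n IH; rewrite imulC IH. Qed.

Lemma ipow_amul J n a A : ipow J n (amul a A) = amul a (ipow J n A).
Proof. by elim: n => //= n ->; rewrite imul_amul. Qed.

Lemma ipow_szero J n : ipow J n szero = szero.
Proof. by elim: n => //= n ->; apply: imul0. Qed.

Lemma cpow_mem J n A x : cpow J n A x <-> ipow J n (cyc x) <=: A.
Proof.
rewrite ipow_cpow; split=> [H|]; first exact: cyc_le.
by apply; apply: mem_cyc.
Qed.

Definition sat J A : submod.
Proof.
exists (fun x => exists n, cpow J n A x); first by exists 0%N; apply: submod0.
move=> a x y [n Hx] [m Hy]; exists (n + m)%N; apply: submod_lin.
  by apply: cpow_incr Hx; apply: leq_addr.
by apply: cpow_incr Hy; apply: leq_addl.
Defined.

Lemma sat_ge J A : A <=: sat J A.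
Proof. by move=> x Ax; exists 0%N. Qed.

Lemma sat_mono J A B : A <=: B -> sat J A <=: sat J B.
Proof. by move=> AB x [n H]; exists n; apply: cpow_mono H. Qed.

End SubmoduleLattice.

Arguments submod_mem : simpl never.
Arguments saddl {R M A B}.
Arguments saddr {R M A B}.
Arguments scapl {R M A B}.
Arguments scapr {R M A B}.
Arguments szero {R} M.
Arguments sfull {R} M.
#[export] Hint Resolve sle_refl sle_full szero_le saddl saddr scapl scapr : core.

Infix "<=:" := sle (at level 70, no associativity).
Infix "+:" := sadd (at level 50, left associativity).
Infix "&:" := scap (at level 48, left associativity).

(** * Length *)

Section Length.
Variables (R : comNzRingType) (M : lmodType R).
Implicit Types (A B K L N P Q V : submod M).

(* N / L has length at least n *)
Fixpoint length_ge L N n :=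
  if n is n'.+1 then exists P, [/\ P <=: N, ~ N <=: P & length_ge L P n']
  else L <=: N.

Lemma length_ge_sle L N n : length_ge L N n -> L <=: N.
Proof.
elim: n N => // n IH N [P [PN _ /IH LP]]; exact: sle_trans PN.
Qed.

Lemma length_ge_monor L N N' n :
  N <=: N' -> length_ge L N n -> length_ge L N' n.
Proof.
case: n => [|n] NN'; first by move=> LN; apply: sle_trans NN'.
move=> [P [PN NP LP]]; exists P; split=> //; first exact: sle_trans NN'.
by move=> N'P; apply: NP; apply: sle_trans N'P.
Qed.

Lemma length_ge_monol L L' N n :
  L' <=: L -> length_ge L N n -> length_ge L' N n.
Proof.
elim: n N => [|n IH] N LL /=; first by move=> LN; apply: sle_trans LN.
by move=> [P [PN NP /(IH _ LL) LP]]; exists P.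
Qed.

Lemma length_geD L P N m n :
  length_ge L P m -> length_ge P N n -> length_ge L N (n + m).
Proof.
move=> LP; elim: n N => [|n IH] N; first by move=> PN; apply: length_ge_monor LP.
by move=> [Q [QN NQ /IH H]]; exists Q.
Qed.

(** Meeting and joining a chain with [P] loses no length in total: a step that becomes an equality
    on both sides is an equality, by modularity. Additivity of length rests on this. *)
Lemma length_ge_split L N P n : length_ge L N n -> exists m k,
  [/\ length_ge (L &: P) (N &: P) m, length_ge (L +: P) (N +: P) k & (n <= m + k)%N].
Proof.
elim: n N => [|n IH] N /=.
  by move=> LN; exists 0%N, 0%N; split=> //; [apply: scap_mono|apply: sadd_mono].
move=> [Q [QN NQ /IH [m [k [Hm Hk nmk]]]]].
have H1 : Q &: P <=: N &: P by apply: scap_mono.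
have H2 : Q +: P <=: N +: P by apply: sadd_mono.
have [H|H] := EM (N &: P <=: Q &: P); last first.
  by exists m.+1, k; split=> //; [exists (Q &: P)|apply: length_ge_monor Hk].
have [H'|H'] := EM (N +: P <=: Q +: P); last first.
  exists m, k.+1; split; [exact: length_ge_monor Hm|by exists (Q +: P)|].
  by rewrite addnS.
case: NQ => x Nx; have [|y Qy Py] := H' x; first by exists x; rewrite ?subrr //; apply: submod0.
have [] : (Q &: P) (x - y) by apply: H; split=> //; apply: submodB => //; apply: QN.
by move=> Qxy _; rewrite -(subrK y x); apply: submodD.
Qed.

Definition fin_length L N := exists b, forall n, length_ge L N n -> (n <= b)%N.

(* 0 when the length is infinite or L is not contained in N *)
Definition len L N : nat :=
  xget 0%N [set n | length_ge L N n /\ forall k, length_ge L N k -> (k <= n)%N].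

Lemma lenP L N : L <=: N -> fin_length L N ->
  length_ge L N (len L N) /\ forall k, length_ge L N k -> (k <= len L N)%N.
Proof.
move=> LN [b Hb]; rewrite /len; case: xgetP => [n _ [] //|H].
have ex : exists n, `[< length_ge L N n >] by exists 0%N; apply/asboolP.
have bd n : `[< length_ge L N n >] -> (n <= b)%N by move=> /asboolP /Hb.
case: (ex_maxnP ex bd) => n /asboolP Hn mx.
by case: (H n); split=> // k Hk; apply: mx; apply/asboolP.
Qed.

Lemma len_ge L N n : fin_length L N -> length_ge L N n -> (n <= len L N)%N.
Proof. by move=> fLN H; have [_] := lenP (length_ge_sle H) fLN; apply. Qed.

Lemma len_eq L N n : length_ge L N n ->
  (forall k, length_ge L N k -> (k <= n)%N) -> fin_length L N /\ len L N = n.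
Proof.
move=> H1 H2; have f : fin_length L N by exists n.
split=> //; have [G1 G2] := lenP (length_ge_sle H1) f.
by apply/eqP; rewrite eqn_leq H2 ?G2.
Qed.

Lemma fin_length_refl L : fin_length L L.
Proof. by exists 0%N => -[//|n] [P [PL LP /length_ge_sle]]. Qed.
Hint Resolve fin_length_refl : core.

Lemma len_refl L : len L L = 0%N.
Proof.
have := @len_eq L L 0; case=> // -[//|n] [P [PL LP /length_ge_sle]] //.
Qed.

Lemma lenD L P N : L <=: P -> P <=: N -> fin_length L P -> fin_length P N ->
  fin_length L N /\ len L N = (len L P + len P N)%N.
Proof.
move=> LP PN fLP fPN; have [H1 H2] := lenP LP fLP; have [G1 G2] := lenP PN fPN.
apply: len_eq; first by rewrite addnC; apply: length_geD H1 G1.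
move=> n /(@length_ge_split _ _ P) [m [k [Hm Hk /leq_trans]]]; apply.
move: Hm Hk; rewrite (scap_idl LP) scapC (scap_idl PN) (sadd_idl LP).
by rewrite (sadd_idr PN) => Hm Hk; apply: leq_add; [apply: H2|apply: G2].
Qed.

Lemma fin_lengthD L P N :
  L <=: P -> P <=: N -> fin_length L P -> fin_length P N -> fin_length L N.
Proof. by move=> LP PN f g; have [] := lenD LP PN f g. Qed.

Lemma fin_length_sub L L' N N' :
  L <=: L' -> N' <=: N -> fin_length L N -> fin_length L' N'.
Proof.
move=> LL NN [b Hb]; exists b => n H; apply: Hb.
by apply: length_ge_monol LL _; apply: length_ge_monor NN _.
Qed.

Lemma len_add L P N : L <=: P -> P <=: N -> fin_length L N ->
  len L N = (len L P + len P N)%N.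
Proof.
move=> LP PN f; have [] // := lenD LP PN.
  exact: fin_length_sub f.
exact: fin_length_sub f.
Qed.

End Length.

Section LengthComparison.
Variables (R : comNzRingType) (M M' : lmodType R).
Implicit Types (L N P Q : submod M).

Lemma len_le L N (L' N' : submod M') : L <=: N ->
  (forall n, length_ge L N n -> length_ge L' N' n) -> fin_length L' N' ->
  fin_length L N /\ (len L N <= len L' N')%N.
Proof.
move=> LN H f; have fLN : fin_length L N.
  by case: f => b Hb; exists b => n /H /Hb.
split=> //; apply: len_ge => //; apply: H.
by case: (lenP LN fLN).
Qed.

Lemma len_iso L N (L' N' : submod M') : L <=: N -> L' <=: N' ->
  (forall n, length_ge L N n <-> length_ge L' N' n) ->
  (fin_length L N <-> fin_length L' N') /\ len L N = len L' N'.
Proof.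
move=> LN L'N' H; split.
  by split=> -[b Hb]; exists b => n /H /Hb.
by rewrite /len; congr xget; apply/seteqP; split=> n [/H H1 H2]; split=> // k /H /H2.
Qed.

(** Order reflection is asked only for nested pairs inside the interval. This is enough to keep the
    steps of a chain strict, and it covers images and preimages alike. *)
Lemma length_ge_map (phi : submod M -> submod M') L N n :
  (forall P Q, L <=: P -> P <=: Q -> Q <=: N ->
     phi P <=: phi Q /\ (phi Q <=: phi P -> Q <=: P)) ->
  length_ge L N n -> length_ge (phi L) (phi N) n.
Proof.
elim: n N => [|n IH] N H; first by move=> LN; case: (H L N).
move=> [P [PN NP LP]]; have LleP := length_ge_sle LP.
have [H1 H2] := H P N LleP PN (@sle_refl _ _ _).
exists (phi P); split=> //; first by move=> /H2.
apply: IH LP => A B LA AB BP; apply: H => //.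
exact: sle_trans PN.
Qed.

End LengthComparison.

#[export] Hint Resolve fin_length_refl : core.

Section LengthLemmas.
Variables (R : comNzRingType) (M : lmodType R).
Implicit Types (K L N P Q V : submod M).

Lemma len_sub L L' N N' : L <=: L' -> N' <=: N -> L' <=: N' ->
  fin_length L N -> (len L' N' <= len L N)%N.
Proof.
move=> LL NN LN f; have [] // := @len_le _ _ _ L' N' L N LN _ f.
by move=> n H; apply: length_ge_monol LL _; apply: length_ge_monor NN _.
Qed.

Lemma length_ge_diamond K N n :
  length_ge K (N +: K) n <-> length_ge (N &: K) N n.
Proof.
split.
  move=> H; have := @length_ge_map _ _ _ (fun P => P &: N) K (N +: K) n.
  rewrite scapC; rewrite (scapC (N +: K)) (scap_idl (@saddl _ _ N K)); apply=> //.
  move=> P Q KP PQ QNK; split; first exact: scap_mono.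
  move=> H' x Qx; have [y Ny Kxy] := QNK x Qx.
  have : (Q &: N) y.
    split=> //; rewrite -[y](subKr x); apply: submodB => //.
    by apply: PQ; apply: KP.
  case/H' => Py _; rewrite -(subrK y x); apply: submodD => //; exact: KP.
move=> H; have := @length_ge_map _ _ _ (fun P => P +: K) (N &: K) N n.
rewrite (sadd_idl (@scapr _ _ N K)); apply=> //.
move=> P Q NKP PQ QN; split; first exact: sadd_mono.
move=> H' x Qx; have [y Py Kxy] := H' x (saddl _ Qx).
rewrite -(subrK y x); apply: submodD => //; apply: NKP; split=> //.
by apply: submodB; apply: QN => //; apply: PQ.
Qed.

Lemma len_diamond K N : (fin_length K (N +: K) <-> fin_length (N &: K) N) /\
  len K (N +: K) = len (N &: K) N.
Proof. by apply: len_iso => // n; apply: length_ge_diamond. Qed.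

(* the second isomorphism theorem for N and L +: K *)
Lemma len_addK L N K : L <=: N ->
  (fin_length (L +: K) (N +: K) <-> fin_length (N &: (L +: K)) N) /\
  len (L +: K) (N +: K) = len (N &: (L +: K)) N.
Proof.
move=> LN; have <- : N +: (L +: K) = N +: K by rewrite saddA (sadd_idr LN).
exact: len_diamond.
Qed.

(* Multiplication by a maps N / L onto (L' + aN) / L'. *)
Lemma len_amul_le a L N L' : L <=: N -> amul a L <=: L' -> fin_length L N ->
  fin_length L' (L' +: amul a N) /\ (len L' (L' +: amul a N) <= len L N)%N.
Proof.
move=> LN aL f; apply: len_le => // n H.
pose phi (P : submod M) := N &: ainv a P.
have G : length_ge (phi L') (phi (L' +: amul a N)) n.
  apply: length_ge_map H => P Q LP PQ QN; split.
    by move=> x [Nx Px]; split=> //; apply: PQ.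
  move=> H' x Qx; have [y Ly [z Nz E]] := QN x Qx.
  have [_ Paz] : phi P z.
    apply: H'; split=> //; change (Q (a *: z)); rewrite -E.
    by apply: submodB => //; apply/PQ/LP.
  by rewrite -(subrK y x) E; apply: submodD => //; apply: LP.
apply: length_ge_monor (_ : phi (L' +: amul a N) <=: N) _; first by move=> x [].
apply: length_ge_monol G => x Lx; split; first exact: LN.
by apply: aL; exists x.
Qed.

Lemma len_amul_eq a L N L' : L <=: N -> amul a L <=: L' ->
  (forall x, N x -> L' (a *: x) -> L x) -> fin_length L N ->
  fin_length L' (L' +: amul a N) /\ len L' (L' +: amul a N) = len L N.
Proof.
move=> LN aL inj f; have [f' le] := len_amul_le LN aL f; split=> //.
apply/eqP; rewrite eqn_leq le /=.
have [] // := @len_le _ _ _ L N L' (L' +: amul a N) LN _ f'.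
move=> n H; have := @length_ge_map _ _ _ (fun P => L' +: amul a P) L N n.
rewrite (sadd_idr aL); apply=> // P Q LP PQ QN; split.
  by apply: sadd_mono => //; apply: amul_mono.
move=> H' x Qx; have [y Ly [z Pz E]] := H' (a *: x) (saddr _ (mem_amul a Qx)).
rewrite -(subrK z x); apply: submodD => //; apply/LP/inj.
  by apply: submodB; apply: QN => //; apply: PQ.
by rewrite scalerBr -E opprB addrC subrK.
Qed.

(** By the modular law [N] meets [L +: V] in [L], so N/L embeds in B/(L+V). It will be applied with
    V = m^j B. *)
Lemma len_addV L N V B : L <=: N -> N <=: B -> V <=: B -> N &: V <=: L ->
  fin_length (L +: V) B -> fin_length L N /\ (len L N <= len (L +: V) B)%N.
Proof.
move=> LN NB VB NVL f.
have E : N &: (L +: V) = L.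
  rewrite scapC smodular //; apply: sadd_idr; by rewrite scapC.
have [[_ H1] H2] := len_addK V LN; rewrite E in H1 H2.
have NVB : N +: V <=: B by apply: sadd_le.
have f' : fin_length (L +: V) (N +: V) by apply: fin_length_sub f.
split; first by have [[]] := len_addK V LN; rewrite E; auto.
by rewrite -H2; apply: len_sub => //; apply: sadd_mono.
Qed.

End LengthLemmas.

(** * Ascending chains *)

(** The relation and the class [C] are parameters because chains of graded families of submodules
    are needed besides chains of submodules. *)
Definition acc_on (X : Type) (le : X -> X -> Prop) (C : X -> Prop) :=
  forall S : nat -> X, (forall t, C (S t)) -> (forall t, le (S t) (S t.+1)) ->
    exists t0, forall t, (t0 <= t)%N -> le (S t) (S t0).

Section NoetherianInduction.
Variables (X : Type) (le : X -> X -> Prop) (C : X -> Prop).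
Hypothesis accC : acc_on le C.

(** A counterexample has a strictly larger one above it, so dependent choice produces a chain that
    never stabilises. *)
Lemma noetherian_ind (P : X -> Prop) :
  (forall x, C x -> (forall y, C y -> le x y -> ~ le y x -> P y) -> P x) ->
  forall x, C x -> P x.
Proof.
move=> step x0 Cx0; apply: contrapT => nPx0.
pose T := {x | C x /\ ~ P x}.
have next (u : T) : exists v : T, le (sval u) (sval v) /\ ~ le (sval v) (sval u).
  case: u => x [Cx nPx]; apply: contrapT => H; apply: (nPx); apply: step => // y Cy xy nyx.
  apply: contrapT => nPy; apply: H.
  by exists (exist _ y (conj Cy nPy)).
pose nxt u := sval (cid (next u)).
pose S t := iter t nxt (exist _ x0 (conj Cx0 nPx0) : T).
have HS t : le (sval (S t)) (sval (S t.+1)) /\ ~ le (sval (S t.+1)) (sval (S t)).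
  by rewrite /S iterS /nxt; case: cid.
have [t0 Ht] := @accC (fun t => sval (S t)) (fun t => (svalP (S t)).1)
  (fun t => (HS t).1).
by have [_] := HS t0; apply; apply: Ht.
Qed.

Lemma acc_maximal (P : X -> Prop) x : C x -> P x ->
  exists y, [/\ C y, P y & forall z, C z -> P z -> le y z -> le z y].
Proof.
move=> Cx; move: x Cx.
apply: (noetherian_ind (P := fun x => P x -> _)) => x Cx IH Px.
have [H|H] := EM (forall z, C z -> P z -> le x z -> le z x); first by exists x.
have [y [Cy Py xy yx]] : exists y, [/\ C y, P y, le x y & ~ le y x].
  apply: contrapT => H'; apply: H => z Cz Pz xz; apply: contrapT => zx.
  by apply: H'; exists z.
exact: IH Py.
Qed.

End NoetherianInduction.

Lemma nat_bound (T : eqType) (s : seq T) (P : T -> nat -> Prop) :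
  (forall x m n, (m <= n)%N -> P x m -> P x n) ->
  (forall x, x \in s -> exists n, P x n) -> exists n, forall x, x \in s -> P x n.
Proof.
move=> mono; elim: s => [|x s IH] H; first by exists 0%N.
have [n Hn] : exists n, forall y, y \in s -> P y n.
  by apply: IH => y ys; apply: H; rewrite in_cons ys orbT.
have [m Hm] : exists n, P x n by apply: H; rewrite mem_head.
exists (m + n)%N => y; rewrite in_cons => /orP[/eqP->|ys].
  by apply: mono Hm; apply: leq_addr.
by apply: mono (Hn y ys); apply: leq_addl.
Qed.

Section Noetherian.
Variables (R : comNzRingType).

Section Span.
Variable M : lmodType R.
Implicit Types (A B L N P : submod M) (S : nat -> submod M).

Fixpoint span (s : seq M) : submod M :=
  if s is x :: s' then cyc x +: span s' else szero M.

Lemma span_le s A : span s <=: A <-> (forall x, x \in s -> A x).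
Proof.
elim: s => [|x s IH] /=; first by split=> // _; apply: szero_le.
split=> [H y|H].
  rewrite in_cons => /orP[/eqP->|ys].
    by apply: H; apply: saddl; apply: mem_cyc.
  by have [H' _] := IH; apply: H' ys; apply: sle_trans H; apply: saddr.
apply: sadd_le; first by apply: cyc_le; apply: H; rewrite mem_head.
by apply/IH => y ys; apply: H; rewrite in_cons ys orbT.
Qed.

Lemma mem_span s x : x \in s -> span s x.
Proof. by move: x; apply/span_le. Qed.

Definition sunion S (S_mono : forall m n, (m <= n)%N -> S m <=: S n) : submod M.
Proof.
exists (fun x => exists t, S t x); first by exists 0%N; apply: submod0.
move=> a x y [m Hx] [n Hy]; exists (m + n)%N; apply: submod_lin.
  by apply: S_mono Hx; apply: leq_addr.
by apply: S_mono Hy; apply: leq_addl.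
Defined.

Lemma mono_of_succ S : (forall t, S t <=: S t.+1) ->
  forall m n, (m <= n)%N -> S m <=: S n.
Proof.
move=> H m n /subnK <-; elim: (n - m)%N => // k IH.
exact: sle_trans IH (H _).
Qed.

Definition noetherian_mod := acc_on (@sle R M) (fun=> True).

Lemma noetherian_of_fg :
  (forall A, exists s, A = span s) -> noetherian_mod.
Proof.
move=> fg S _ /mono_of_succ mono.
have [s Es] := fg (sunion mono).
have [t Ht] : exists t, forall x, x \in s -> S t x.
  apply: nat_bound => [x m n mn|x xs]; first exact: (mono).
  by have /span_le : span s <=: sunion mono; [rewrite Es|apply].
exists t => u tu x Sx; apply: (_ : sunion mono <=: S t); last by exists u.
by rewrite Es; apply/span_le.
Qed.

Definition acc_in L N := acc_on (@sle R M) (fun P => L <=: P /\ P <=: N).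

(** A chain is stationary once its traces on [P] and its sums with [P] are, by the modular law. *)
Lemma acc_in_trans L P N : L <=: P -> P <=: N ->
  acc_in L P -> acc_in P N -> acc_in L N.
Proof.
move=> LP PN aLP aPN S HS S_mono.
have [t1 H1] : exists t0, forall t, (t0 <= t)%N -> S t &: P <=: S t0 &: P.
  apply: (aLP (fun t => S t &: P)) => t; last exact: scap_mono.
  by split=> //; apply: scap_le => //; case: (HS t).
have [t2 H2] : exists t0, forall t, (t0 <= t)%N -> S t +: P <=: S t0 +: P.
  apply: (aPN (fun t => S t +: P)) => t; last exact: sadd_mono.
  by split=> //; apply: sadd_le => //; case: (HS t).
exists (t1 + t2)%N => t tt x Sx.
have mono := mono_of_succ S_mono.
have [|y Sy Pxy] := H2 t _ x (saddl _ Sx).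
  by apply: leq_trans tt; apply: leq_addl.
have {}Sy : S (t1 + t2)%N y by apply: mono Sy; apply: leq_addl.
have [||Sxy _] := H1 t _ (x - y).
- by apply: leq_trans tt; apply: leq_addr.
- by split=> //; apply: submodB => //; apply: mono Sy.
rewrite -(subrK y x); apply: submodD => //.
by apply: mono Sxy; apply: leq_addr.
Qed.

Definition ideal_at A (x : M) : submod R^o.
Proof.
exists (fun r : R => A (r *: x)); first by rewrite scale0r; apply: submod0.
move=> a r s Hr Hs; rewrite scalerDl; apply: submodD => //.
by rewrite -[a *: r]/(a * r) -scalerA; apply: submodZ.
Defined.

End Span.

Variable M : lmodType R.

Lemma noetherian_fg_mod (s : seq M) : noetherian_mod R^o ->
  sfull M <=: span s -> noetherian_mod M.
Proof.
move=> accR Ms S _ S_mono.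
suff H : acc_in (szero M) (span s).
  by apply: H => // t; split=> //; apply: sle_trans Ms.
elim: s {Ms S S_mono} => [|x s IH].
  move=> S HS S_mono; exists 0%N => t _; apply: sle_trans (szero_le _).
  by case: (HS t).
rewrite /= saddC; apply: acc_in_trans IH _ => // S HS S_mono.
(* A submodule between [span s] and [span s +: cyc x] is determined by its ideal of coefficients of
   [x], so the chain condition of the ring applies. *)
have [|t0 H] := accR (fun t => ideal_at (S t) x) (fun=> I).
  by move=> t r; apply: S_mono.
exists t0 => t tt y Sy; have [LS SN] := HS t.
have [l sl [r E]] := SN _ Sy.
rewrite -(subrK l y) E; apply: submodD; last by case: (HS t0) => H0 _; apply: H0.
apply: (H t tt r); change (S t (r *: x)); rewrite -E.
by apply: submodB => //; apply: LS.
Qed.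

End Noetherian.

(** * A graded basis theorem *)

Section GradedBasis.
Variables (R : comNzRingType) (M : lmodType R) (accM : noetherian_mod M).
Variable G : zmodType.
Implicit Types (W E : G -> submod M) (ops : seq (R * G)).

Definition fle (T : Type) (V W : T -> submod M) := forall g, V g <=: W g.

Definition op_stable (p : R * G) W := forall g, amul p.1 (W g) <=: W (g + p.2).

(** Polynomials in the operator [p] of degree less than [j], with coefficients in the family [E];
    the shift of the index keeps the total degree equal to [g]. *)
Fixpoint psum (p : R * G) E j g : submod M :=
  if j is j'.+1 then psum p E j' g +: amul (p.1 ^+ j') (E (g - p.2 *+ j'))
  else szero M.

Lemma psum_mono p E g m n : (m <= n)%N -> psum p E m g <=: psum p E n g.
Proof. by move: m n; apply: mono_of_succ => t; apply: saddl. Qed.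

Lemma amul1 (A : submod M) : amul 1 A = A.
Proof.
apply: submod_ext; first exact: amul_le.
by move=> x Ax; exists x; rewrite ?scale1r.
Qed.

Lemma amulA a b (A : submod M) : amul a (amul b A) = amul (a * b) A.
Proof.
apply: submod_ext.
  by move=> _ [_ [x Ax ->] ->]; exists x; rewrite ?scalerA.
by move=> _ [x Ax ->]; rewrite -scalerA; do 2!apply: mem_amul.
Qed.

Lemma psum_head p E j g : amul p.1 (psum p E j g) <=: psum p E j.+1 (g + p.2).
Proof.
elim: j => [|j IH]; first by move=> _ [x -> ->]; rewrite scaler0; apply: submod0.
rewrite [psum _ _ j.+1 g]/= amulD; apply: sadd_le.
  exact: sle_trans IH (@saddl _ _ _ _).
rewrite amulA -exprS; apply: sle_trans (@saddr _ _ _ _).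
by rewrite mulrS opprD addrA addrK.
Qed.

Lemma psum_tail p q E j g : op_stable q E ->
  amul q.1 (psum p E j g) <=: psum p E j (g + q.2).
Proof.
move=> stE; elim: j => [|j IH]; first by move=> _ [x -> ->]; rewrite scaler0.
rewrite /= amulD; apply: sadd_mono => //.
rewrite amulA mulrC -amulA; apply: amul_mono.
by rewrite addrAC; apply: stE.
Qed.

(* The graded pieces of the algebra generated by ops, applied to M in degree 0. *)
Fixpoint gfam ops : G -> submod M :=
  if ops is p :: ops' then fun g => sunion (@psum_mono p (gfam ops') g)
  else fun g => if g == 0 then sfull M else szero M.

Lemma gfam_stable ops p : p \in ops -> op_stable p (gfam ops).
Proof.
elim: ops => // q ops IH; rewrite in_cons => /orP[/eqP->|/IH st] g _ [x [j Hx] ->].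
  by exists j.+1; apply: psum_head; apply: mem_amul.
by exists j; apply: psum_tail => //; apply: mem_amul.
Qed.

Lemma gfam0 ops : sfull M <=: gfam ops 0.
Proof.
elim: ops => [|p ops IH]; first by rewrite /= eqxx.
move=> x _; exists 1%N; apply: saddr; rewrite mulr0n subr0 expr0 amul1.
exact: IH.
Qed.

(* e is the leading coefficient of an element e p^j + ... of W. *)
Definition lead_coefs (p : R * G) E W (j : nat) (g : G) : submod M.
Proof.
exists (fun e => E g e /\ (W (g + p.2 *+ j) +: psum p E j (g + p.2 *+ j)) (p.1 ^+ j *: e)).
  by rewrite scaler0; split; apply: submod0.
move=> a x y [Ex Hx] [Ey Hy]; split; first exact: submod_lin.
by rewrite scalerDr scalerA mulrC -scalerA; apply: submod_lin.
Defined.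

Definition graded_sub ops W :=
  (forall p, p \in ops -> op_stable p W) /\ fle W (gfam ops).

Lemma lead_coefs_incr p E W j g : op_stable p W ->
  lead_coefs p E W j g <=: lead_coefs p E W j.+1 g.
Proof.
move=> st e [Ee [w Ww He]]; split=> //.
have -> : p.1 ^+ j.+1 *: e = p.1 *: w + p.1 *: (p.1 ^+ j *: e - w).
  by rewrite exprS -scalerA -scalerDr addrC subrK.
have -> : g + p.2 *+ j.+1 = g + p.2 *+ j + p.2 by rewrite mulrSr addrA.
apply: mem_sadd; first by apply: st; apply: mem_amul.
by apply: psum_head; apply: mem_amul.
Qed.

Lemma lead_coefs_graded p ops W j : graded_sub (p :: ops) W ->
  graded_sub ops (lead_coefs p (gfam ops) W j).
Proof.
move=> [st WE]; split; last by move=> g e [].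
move=> q qops g _ [e [Ee [w Ww He]] ->]; split.
  by apply: gfam_stable => //; apply: mem_amul.
have -> : p.1 ^+ j *: (q.1 *: e) = q.1 *: w + q.1 *: (p.1 ^+ j *: e - w).
  by rewrite -scalerDr addrC subrK !scalerA mulrC.
rewrite addrAC.
apply: mem_sadd; last by apply: psum_tail; [apply: gfam_stable|apply: mem_amul].
by apply: st; [rewrite in_cons qops orbT|apply: mem_amul].
Qed.

(** Hilbert's argument: nested families with the same leading coefficients for every exponent are
    equal, and the leading coefficients form families for one operator fewer. *)
Lemma gfam_acc ops : acc_on (@fle G) (graded_sub ops).
Proof.
elim: ops => [|p ops IH] W gW W_mono.
  have [t0 H] := accM (fun=> I) (fun t => W_mono t 0).
  exists t0 => t /H Ht g; have [->//|g0] := eqVneq g 0.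
  apply: sle_trans (_ : szero M <=: _) => //.
  by case: (gW t) => _ /(_ g) /=; rewrite (negPf g0).
set E := gfam ops.
have Wm g m n : (m <= n)%N -> W m g <=: W n g.
  by move: m n; apply: mono_of_succ => t; apply: W_mono.
pose V t j := lead_coefs p E (W t) j.
have Vt j m n : (m <= n)%N -> fle (V m j) (V n j).
  move=> mn g e [Ee [w Ww He]]; split=> //; exists w => //; exact: Wm Ww.
have Vj t j k : (j <= k)%N -> fle (V t j) (V t k).
  move=> jk g; move: j k jk; apply: mono_of_succ => j.
  by apply: lead_coefs_incr; case: (gW t) => st _; apply: st; rewrite mem_head.
(* [V t j] increases in both indices, so the diagonal is a chain. Once it is stationary at [t0], all
   exponents [j >= t0] are settled; the finitely many smaller ones are treated one at a time. *)
have [t0 Ht0] := IH (fun t => V t t) (fun t => lead_coefs_graded t (gW t))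
   (fun t g => sle_trans (@Vt t t t.+1 (leqnSn _) g) (@Vj t.+1 t t.+1 (leqnSn _) g)).
have [t1 Ht1] : exists t1, forall j, j \in iota 0 t0 ->
    forall t, (t1 <= t)%N -> fle (V t j) (V t1 j).
  apply: nat_bound => [j m n mn H t nt g|j _].
    by apply: sle_trans (Vt j m n mn g); apply: H; apply: leq_trans nt.
  exact: IH (fun t => V t j) (fun t => lead_coefs_graded j (gW t))
   (fun t => Vt j t t.+1 (leqnSn _)).
pose u := (t0 + t1)%N.
have Hu j t : (u <= t)%N -> fle (V t j) (V u j).
  move=> ut g; have [jt0|t0j] := ltnP j t0.
    apply: sle_trans (Vt j t1 u (leq_addl _ _) g).
    by apply: Ht1; rewrite ?mem_iota //; apply: leq_trans ut; apply: leq_addl.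
  apply: sle_trans (Vt j t0 u (leq_addr _ _) g).
  apply: sle_trans (Vj t0 t0 j t0j g).
  apply: sle_trans (Ht0 (t + j)%N _ g); last first.
    by apply: leq_trans (leq_addr _ _); apply: leq_trans ut; apply: leq_addr.
  apply: sle_trans (Vt j t (t + j)%N (leq_addr _ _) g) (Vj _ _ _ (leq_addl _ _) g).
exists u => t ut g x Wx.
suff H j y : psum p E j g y -> W t g y -> W u g y.
  by case: (gW t) => _ /(_ g x Wx) [j /H]; apply.
(* Subtracting an element [w] of [W u] with the same leading coefficient lowers the degree of [y] in
   [p]. *)
elim: j y => [|j IHj] y; first by move=> -> _; apply: submod0.
move=> [z Hz [e Ee Eyz]] Wy.
have : V t j (g - p.2 *+ j) e.
  split=> //; rewrite subrK -Eyz; exists y => //.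
  by rewrite addrAC subrr add0r; apply: submodN.
move=> /(Hu j t ut) [_ []]; rewrite subrK -Eyz => w Ww Hw.
rewrite -(subrK w y); apply: submodD => //; apply: IHj.
  have -> : y - w = z + (y - z - w) by rewrite addrA addrCA subrr addr0.
  exact: submodD.
by apply: submodB => //; apply: Wm Ww.
Qed.

End GradedBasis.

Lemma pair_succl (n j : nat) :
  (Posz n.+1, Posz j) = (Posz n, Posz j) + (1, 0) :> (int * int)%type.
Proof. by rewrite -[RHS]/(Posz n + 1, Posz j + 0) addr0 -PoszD addn1. Qed.

Lemma pair_succr (n j : nat) :
  (Posz n, Posz j.+1) = (Posz n, Posz j) + (0, 1) :> (int * int)%type.
Proof. by rewrite -[RHS]/(Posz n + 0, Posz j + 1) addr0 -PoszD addn1. Qed.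

(** * Artin-Rees for families with two degrees *)

Section ArtinRees.
Variables (R : comNzRingType) (M : lmodType R) (accM : noetherian_mod M).
Implicit Types (I m : R -> Prop).

Definition bigraded I m (W : nat -> nat -> submod M) :=
  [/\ forall n j, W n j <=: ipow m j (ipow I n (sfull M)),
      forall n j, imul I (W n j) <=: W n.+1 j &
      forall n j, imul m (W n j) <=: W n j.+1].

Definition graded I (F : nat -> submod M) :=
  (forall n, F n <=: ipow I n (sfull M)) /\ (forall n, imul I (F n) <=: F n.+1).

(** Degrees in the basis theorem lie in a group, so families indexed by pairs of naturals are
    extended by zero to pairs of integers. Elements of [sI] have degree (1, 0), those of [sm] degree
    (0, 1). *)
Lemma bigraded_acc_seq (sI sm : seq R) :
  acc_on (fun V W => forall n j, V n j <=: W n j)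
    (bigraded (fun a => a \in sI) (fun a => a \in sm)).
Proof.
move=> S HS S_mono.
pose ops : seq (R * (int * int)%type) :=
  [seq (a, (1, 0)) | a <- sI] ++ [seq (a, (0, 1)) | a <- sm].
pose ext (W : nat -> nat -> submod M) (g : (int * int)%type) :=
  match g with (Posz n, Posz j) => W n j | _ => szero M end.
have opsI a : a \in sI -> (a, (1, 0)) \in ops.
  by move=> aI; rewrite mem_cat map_f.
have opsm a : a \in sm -> (a, (0, 1)) \in ops.
  by move=> am; rewrite mem_cat orbC map_f.
have base n j : ipow (fun a => a \in sm) j (ipow (fun a => a \in sI) n (sfull M))
    <=: gfam M ops (Posz n, Posz j).
  elim: j => [|j IHj].
    elim: n => [|n IHn]; first exact: gfam0.
    apply/imul_leP => a y aI Hy.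
    rewrite pair_succl; apply: (gfam_stable (opsI _ aI)).
    by apply: mem_amul; apply: IHn.
  apply/imul_leP => a y am Hy.
  rewrite pair_succr; apply: (gfam_stable (opsm _ am)).
  by apply: mem_amul; apply: IHj.
have extP W : bigraded (fun a => a \in sI) (fun a => a \in sm) W -> graded_sub ops (ext W).
  move=> [WE WI Wm]; split; last first.
    move=> [[n|n] [j|j]] //=; by apply: sle_trans (base n j).
  move=> p; rewrite mem_cat => /orP[] /mapP[a aJ ->] [[n|n] [j|j]];
    try by [move=> _ [x -> ->]; rewrite scaler0; apply: submod0].
  - rewrite -[_.2]/(1, 0) -pair_succl.
    apply: sle_trans (WI n j); exact: amul_imul_le.
  - rewrite -[_.2]/(0, 1) -pair_succr.
    apply: sle_trans (Wm n j); exact: amul_imul_le.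
have [|t0 H] := gfam_acc accM (fun t => extP _ (HS t)).
  by move=> t [[n|n] [j|j]] //=; apply: S_mono.
by exists t0 => t /H Ht n j; apply: (Ht (Posz n, Posz j)).
Qed.

Definition fg_set I := exists s : seq R,
  forall A : submod M, imul I A = imul (fun a => a \in s) A.

Lemma fg_set_seq (s : seq R) : fg_set (fun a => a \in s).
Proof. by exists s. Qed.

Variables (I m : R -> Prop) (fgI : fg_set I) (fgm : fg_set m).

Lemma bigraded_acc :
  acc_on (fun V W => forall n j, V n j <=: W n j) (bigraded I m).
Proof.
have [sI /funext EI] := fgI; have [sm /funext Em] := fgm.
have -> : bigraded I m = bigraded (fun a => a \in sI) (fun a => a \in sm).
  by rewrite /bigraded /ipow EI Em.
exact: bigraded_acc_seq.
Qed.

(** Let [S t] agree with [W] up to second degree [t] and be generated by the [W n t] beyond it.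
    These families increase to [W], and the index where they become stationary is a constant valid
    for every [n] at once. *)
Lemma bigraded_artin_rees W : bigraded I m W ->
  exists c, forall n i, W n (c + i)%N <=: ipow m i (W n c).
Proof.
move=> [WE WI Wm].
have Wi n j i : ipow m i (W n j) <=: W n (i + j)%N.
  elim: i => // i IH; apply: sle_trans (Wm n (i + j)%N); exact: imul_mono.
pose S t n j := if (j <= t)%N then W n j else ipow m (j - t) (W n t).
have [||t0 H] := bigraded_acc (S := S).
- move=> t; split=> n j; rewrite /S.
  + case: leqP => // tj; rewrite -{2}(subnK (ltnW tj)) ipowD.
    exact: ipow_mono.
  + by case: leqP => // tj; rewrite imul_ipow; apply: ipow_mono.
  + case: ltnP => [jt|tj]; first by rewrite (ltnW jt).
    case: leqP => [jt|tj']; last by rewrite subSn // ltnW.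
    by have -> : j = t; [lia|rewrite subSnn].
- move=> t n j; rewrite /S; case: leqP => [jt|tj].
    by rewrite (leq_trans jt).
  case: leqP => [jt|tj'].
    by have -> : j = t.+1 by [lia]; rewrite subSnn; apply: Wm.
  have -> : (j - t = (j - t.+1) + 1)%N by lia.
  by rewrite ipowD; apply: ipow_mono; apply: Wm.
exists t0 => n i; have := H (t0 + i)%N (leq_addr _ _) n (t0 + i)%N.
rewrite /S leqnn; case: leqP => [|_]; last by rewrite addKn.
by case: i => [|i]; [rewrite addn0|lia].
Qed.

Lemma graded_ipow F : graded I F -> bigraded I m (fun n j => ipow m j (F n)).
Proof.
move=> [FE FI]; split=> // n j; first exact: ipow_mono.
by rewrite imul_ipow; apply: ipow_mono.
Qed.

End ArtinRees.

Section GradedArtinRees.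
Variables (R : comNzRingType) (M : lmodType R) (accM : noetherian_mod M).
Variables (I : R -> Prop) (fgI : fg_set M I).

Lemma graded_acc : acc_on (@fle R M nat) (graded I).
Proof.
move=> S HS S_mono.
have [|t0 H] := bigraded_acc accM fgI fgI (fun t => graded_ipow _ (HS t)).
  by move=> t n j; apply: ipow_mono; apply: S_mono.
by exists t0 => t /H Ht n; apply: (Ht n 0%N).
Qed.

Lemma artin_rees (F : nat -> submod M) : graded I F ->
  exists c, forall i, F (c + i)%N <=: ipow I i (F c).
Proof.
move=> [FE FI].
(* The filtration is placed in first degree 0, with no operators in that direction and [I] in the
   role of [m]. *)
have [|c Hc] := bigraded_artin_rees accM (fg_set_seq M [::]) fgI
    (W := fun n j => if n is 0%N then F j else szero M).
  split=> [[|n] j|n j|[|n] j] //=.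
  - by apply/imul_leP.
  - by rewrite imul0.
by exists c => i; apply: (Hc 0%N).
Qed.

Lemma graded_ipow_le (F : nat -> submod M) i n : graded I F -> ipow I i (F n) <=: F (i + n)%N.
Proof.
move=> [_ FI]; elim: i => // i IH; apply: sle_trans (FI _); exact: imul_mono.
Qed.

End GradedArtinRees.

Definition ideal (R : comNzRingType) := submod (R^o : lmodType R).

Definition ideal_mem (R : comNzRingType) (J : ideal R) : R -> Prop := submod_mem J.
Coercion ideal_mem : ideal >-> Funclass.

Lemma noetherian_span (R : comNzRingType) (M : lmodType R) :
  noetherian_mod M -> forall A : submod M, exists s, A = span s.
Proof.
move=> accM A.
pose P (B : submod M) := B <=: A /\ exists s, B = span s.
have P0 : P (szero M) by split=> //; exists [::].
have [B [_ [BA [s Es]] mx]] := acc_maximal accM (P := P) I P0.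
exists s; rewrite -Es; apply: submod_ext => // x Ax.
suff : cyc x +: B <=: B by apply; apply: saddl; apply: mem_cyc.
apply: mx => //; split; last by exists (x :: s); rewrite Es.
by apply: sadd_le => //; apply: cyc_le.
Qed.

Lemma imul_span (R : comNzRingType) (M : lmodType R) (s : seq R^o) (A : submod M) :
  imul (span s : ideal R) A = imul (fun a : R => a \in s) A.
Proof.
apply: submod_ext; last by apply: imul_monol => a; apply: mem_span.
apply/imul_leP => a y sa Ay.
apply: (_ : span s <=: ideal_at (imul (fun a : R => a \in s) A) y) => //.
by apply/span_le => b bs; apply: mem_imul.
Qed.

Lemma fg_ideal (R : comNzRingType) (M : lmodType R) (I : ideal R) :
  noetherian_mod R^o -> fg_set M I.
Proof.
by move=> accR; have [s ->] := noetherian_span accR I; exists s => A; apply: imul_span.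
Qed.

Lemma sat_cpow (R : comNzRingType) (M : lmodType R) (J : R -> Prop) (A : submod M) :
  noetherian_mod M -> exists k, sat J A <=: cpow J k A.
Proof.
move=> accM; have [|k Hk] := accM (fun k => cpow J k A) (fun=> I).
  by move=> t; apply: cpow_incr.
exists k => x [n Hn]; apply: (Hk (k + n)%N (leq_addr _ _)).
by apply: cpow_incr Hn; apply: leq_addl.
Qed.

Lemma sat_idem (R : comNzRingType) (M : lmodType R) (J : R -> Prop) (A : submod M) :
  noetherian_mod M -> sat J (sat J A) <=: sat J A.
Proof.
move=> accM x [n Hn]; have [k Hk] := sat_cpow J A accM.
by exists (n + k)%N; rewrite cpowD; apply: cpow_mono Hn.
Qed.

(** * General elements avoid finitely many proper subideals *)

Section Avoidance.
Variable R : comNzRingType.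
Implicit Types (J H : ideal R) (P Q : R -> Prop).

(* This makes P hold on a nonempty Zariski open subset of J / m J: see general_step. *)
Definition avoidable J P := exists Hs : seq (ideal R),
  (forall H, List.In H Hs -> ~ J <=: H) /\
  forall a, J a -> (forall H, List.In H Hs -> ~ H a) -> P a.

Lemma avoidable_imp J P Q : (forall a, J a -> P a -> Q a) ->
  avoidable J P -> avoidable J Q.
Proof. by move=> PQ [Hs [H1 H2]]; exists Hs; split=> // a Ja /H2 - /(_ Ja) /PQ; apply. Qed.

Lemma avoidable_and J P Q : avoidable J P -> avoidable J Q ->
  avoidable J (fun a => P a /\ Q a).
Proof.
move=> [Hs [H1 H2]] [Ks [K1 K2]]; exists (Hs ++ Ks); split.
  by move=> H /(List.in_app_or Hs) [/H1|/K1].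
move=> a Ja Ha; split; [apply: H2|apply: K2] => // H HH; apply: Ha;
  apply: List.in_or_app; by [left|right].
Qed.

Lemma avoidable_true J P : (forall a, J a -> P a) -> avoidable J P.
Proof. by move=> H; exists [::]; split=> // a Ja _; apply: H. Qed.

Lemma avoidable_notin J H : ~ J <=: H -> avoidable J (fun a => ~ H a).
Proof.
move=> JH; exists [:: H]; split; first by move=> K [<-|//].
by move=> a _; apply; left.
Qed.

Variables (M : lmodType R) (accR : noetherian_mod R^o) (accM : noetherian_mod M).

Section Filtration.
Variables (G : R -> Prop) (fgG : fg_set M G) (J : ideal R) (delta : nat).
Hypothesis J_delta : forall F : nat -> submod M, graded G F ->
  forall n, imul J (F n) <=: F (n + delta)%N.
Implicit Types (F : nat -> submod M).

Let gen F n x j := if (n <= j)%N then F j +: ipow G (j - n) (cyc x) else F j.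

Let gen_graded F n x : graded G F -> ipow G n (sfull M) x -> graded G (gen F n x).
Proof.
move=> [FE FG] Gx; split=> j; rewrite /gen.
  case: leqP => // nj; apply: sadd_le => //.
  rewrite -{2}(subnK nj) ipowD; apply: ipow_mono; exact: cyc_le.
case: leqP => [nj|jn].
  rewrite (leq_trans nj) // imulD; apply: sadd_mono => //.
  by rewrite subSn.
apply: sle_trans (FG j) _; case: leqP => // _; exact: saddl.
Qed.

Let gen_incr F n x : fle F (gen F n x).
Proof. by move=> j; rewrite /gen; case: leqP => // _; apply: saddl. Qed.

Let mul_gen F n x b i y : graded G F -> F (n + delta)%N (b *: x) ->
  ipow G i (cyc x) y -> F (i + n + delta)%N (b *: y).
Proof.
move=> gF Fbx Hy; rewrite -addnA.
apply: (graded_ipow_le gF).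
apply: (ipow_mono (A := cyc (b *: x))); first exact: cyc_le.
have -> : cyc (b *: x) = amul b (cyc x).
  apply: submod_ext => [_ [r ->]|_ [_ [r ->] ->]].
    by exists (r *: x); [exists r|rewrite !scalerA mulrC].
  by exists r; rewrite !scalerA mulrC.
by rewrite ipow_amul; apply: mem_amul.
Qed.

Lemma avoidance F : graded G F -> avoidable J (fun a => forall n z,
  ipow G n (sfull M) z -> F (n + delta)%N (a *: z) ->
  exists k, ipow J k (cyc z) <=: F (n + k * delta)%N).
Proof.
(* Choose x outside F with {b in J | b x in F} maximal. Then an element of J not
   killing x modulo F is injective on (G x + F) / F, and induction applies to
   G x + F; if all of J kills x, multiplication by J maps G x + F into F. *)
move: F; apply: (noetherian_ind (graded_acc accM fgG)) => F gF IH.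
pose P (A : ideal R) := exists n x,
  [/\ ipow G n (sfull M) x, ~ F n x & A = J &: ideal_at (F (n + delta)%N) x].
have [[A PA]|noP] := EM (exists A, P A); last first.
  apply: avoidable_true => a _ n z Gz _; exists 0%N.
  apply: cyc_le; rewrite mul0n addn0; apply: contrapT => nFz.
  by apply: noP; exists (J &: ideal_at (F (n + delta)%N) z); exists n, z.
have {A PA} [A [_ [n [x [Gx nFx EA]]] mx]] := acc_maximal accR (P := P) I PA.
have /IH {}IH := gen_graded gF Gx.
have {}IH := IH (@gen_incr F n x).
have {}IH : avoidable J (fun a => forall j z, ipow G j (sfull M) z ->
    gen F n x (j + delta)%N (a *: z) ->
    exists k, ipow J k (cyc z) <=: gen F n x (j + k * delta)%N).
  apply: IH => /(_ n); rewrite /gen leqnn subnn => H.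
  by apply: nFx; apply: H; apply: saddr; apply: mem_cyc.
have [Jx|nJx] := EM (J <=: A).
  apply: avoidable_imp IH => a Ja H j z Gz Faz.
  have [|k Hk] := H j z Gz; first exact: gen_incr.
  exists k.+1; apply: sle_trans (imul_mono Hk) _.
  have -> : (j + k.+1 * delta = j + k * delta + delta)%N by rewrite mulSn addnCA addnC.
  rewrite /gen; case: leqP => [nj|_]; last exact: J_delta.
  rewrite imulD; apply: sadd_le; first exact: J_delta.
  apply/imul_leP => b y Jb Gy.
  have := @mul_gen F n x b _ y gF _ Gy; rewrite subnK //; apply.
  by have := Jx _ Jb; rewrite EA => -[].
apply: avoidable_imp (avoidable_and (avoidable_notin nJx) IH).
move=> a Ja [nAa H] j z Gz Faz.
have [|k Hk] := H j z Gz; first exact: gen_incr.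
exists k => w Hw; have := Hk w Hw; rewrite /gen; case: leqP => // nj [f Ff Gwf].
rewrite -(subrK f w); apply: submodD => //; apply: contrapT => nF.
apply: nAa; rewrite EA; split=> //; set i := (j + k * delta - n)%N in Gwf.
have Ei : (i + n = j + k * delta)%N by rewrite subnK.
(* With [w - f] outside [F], its annihilator in [J] modulo [F] contains that of [x], hence equals it
   by maximality. But [a] kills [w - f] modulo [F] and does not kill [x]. *)
have le1 : A <=: J &: ideal_at (F (i + n + delta)%N) (w - f).
  rewrite EA => b [Jb Fbx]; split=> //; exact: mul_gen Gwf.
have le2 : J &: ideal_at (F (i + n + delta)%N) (w - f) <=: A.
  apply: mx => //; exists (i + n)%N, (w - f); split=> //; last by rewrite Ei.
  by rewrite ipowD; apply: ipow_mono Gwf; apply: cyc_le.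
suff : A a by rewrite EA => -[].
apply: le2; split=> //; change (F (i + n + delta)%N (a *: (w - f))); rewrite scalerBr.
have Fj : F (i + n + delta)%N (a *: f).
  by rewrite Ei; apply: (J_delta gF); apply: mem_imul.
apply: submodB => //.
have Fk : forall l, graded G F -> ipow J l (F (j + delta)%N) <=: F (j + l * delta + delta)%N.
  move=> l gF'; elim: l => [|l IHl]; first by rewrite mul0n addn0.
  apply: sle_trans (imul_mono IHl) _; have -> :
    (j + l.+1 * delta + delta = j + l * delta + delta + delta)%N by rewrite mulSn; lia.
  exact: J_delta.
rewrite Ei; apply: (Fk k gF); apply: (ipow_mono (A := amul a (cyc z))).
  by move=> _ [_ [r ->] ->]; rewrite scalerA mulrC -scalerA; apply: submodZ.
by rewrite ipow_amul; apply: mem_amul.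
Qed.

End Filtration.

(** The case [delta = 0] for a filtration concentrated in degree 0, without operators. Saturation
    turns the inclusion of J^k x in [L] into membership of [x]. *)
Lemma avoidable_regular (J : ideal R) (L : submod M) : sat J L <=: L ->
  avoidable J (fun a => forall x, L (a *: x) -> L x).
Proof.
move=> satL; pose F n := if n is 0%N then L else szero M.
have gF : graded (fun a : R => a \in [::]) F.
  by split=> -[|n] //; apply/imul_leP.
have Jd (F' : nat -> submod M) n : graded (fun a : R => a \in [::]) F' -> imul J (F' n) <=: F' (n + 0)%N.
  by move=> _; rewrite addn0; apply: imul_le.
apply: avoidable_imp (avoidance (fg_set_seq M [::]) (fun F' g n => Jd F' n g) gF).
move=> a Ja H x Lax; have [k] := H 0%N x I Lax.
by rewrite add0n muln0 => Hk; apply: satL; exists k; apply/cpow_mem.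
Qed.

(** Again [delta = 0]. One element serves all degrees, because the Noetherian induction runs over
    whole graded families. *)
Lemma avoidable_graded_regular (G J : ideal R) (F : nat -> submod M) : graded G F ->
  (forall n, ipow G n (sfull M) &: sat J (F n) <=: F n) ->
  avoidable J (fun a => forall n x, ipow G n (sfull M) x -> F n (a *: x) -> F n x).
Proof.
move=> gF satF.
have Jd (F' : nat -> submod M) n : graded G F' -> imul J (F' n) <=: F' (n + 0)%N.
  by move=> _; rewrite addn0; apply: imul_le.
apply: avoidable_imp (avoidance (fg_ideal M G accR) (fun F' g n => Jd F' n g) gF).
move=> a Ja H n x Gx Fax; have [|k] := H n x Gx; first by rewrite addn0.
by rewrite muln0 addn0 => Hk; apply: satF; split=> //; exists k; apply/cpow_mem.
Qed.

(** The case [delta = 1] gives only J^k x inside F (n + k), with [k] depending on [x]. The families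
    [S k] of such [x] become stationary at some [k0], and by Artin-Rees an element of [S k0] in
    large degree n lies in J^k0 times the part of [S k0] in degree n - k0, hence in [F n]. *)
Lemma avoidable_filter_regular (J : ideal R) (F : nat -> submod M) : graded J F ->
  avoidable J (fun a => exists n0, forall n, (n0 <= n)%N -> forall x,
    ipow J n (sfull M) x -> F n.+1 (a *: x) -> F n x).
Proof.
move=> gF; have fgJ := fg_ideal M J accR.
have Jd (F' : nat -> submod M) n : graded J F' -> imul J (F' n) <=: F' (n + 1)%N.
  by move=> [_ H]; rewrite addn1.
pose S k n := ipow J n (sfull M) &: cpow J k (F (n + k)%N).
have gS k : graded J (S k).
  split=> n; first exact: scapl.
  apply: scap_le; first by apply: imul_mono; apply: scapl.
  apply/ipow_cpow; rewrite -imul_ipow addSn; case: gF => _ FJ.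
  apply: sle_trans (FJ _); apply: imul_mono; apply/ipow_cpow; exact: scapr.
have S_mono k : fle (S k) (S k.+1).
  move=> n; apply: scap_le; first exact: scapl.
  apply/ipow_cpow; rewrite /= addnS; case: gF => _ FJ.
  apply: sle_trans (FJ _); apply: imul_mono; apply/ipow_cpow; exact: scapr.
have [k0 Hk0] := graded_acc accM fgJ gS S_mono.
have [c Hc] := artin_rees accM fgJ (gS k0).
apply: avoidable_imp (avoidance fgJ (fun F' g n => Jd F' n g) gF).
move=> a Ja H; exists (c + k0)%N => n cn x Jx Fax.
have [|k Hk] := H n x Jx; first by rewrite addn1.
have Sx : S k0 n x.
  apply: (Hk0 (k0 + k)%N (leq_addr _ _)).
  have mono j : S k n <=: S (j + k)%N n.
    by elim: j => // j IH; apply: sle_trans IH (S_mono _ _).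
  apply: mono; split=> //; apply/cpow_mem.
  by rewrite muln1 in Hk.
have := Hc (n - c)%N x; rewrite subnKC; last lia.
have -> : (n - c = k0 + (n - c - k0))%N by lia.
move=> /(_ Sx); rewrite ipowD => Hx.
have -> : F n = F (n - k0 + k0)%N by congr F; lia.
apply: (_ : ipow J k0 (S k0 (n - k0)%N) <=: F (n - k0 + k0)%N); last first.
  apply: ipow_mono Hx.
  have -> : (n - k0 = (n - c - k0) + c)%N by lia.
  exact: graded_ipow_le.
by apply/ipow_cpow; apply: scapr.
Qed.
End Avoidance.

(** * Modules over a Noetherian local ring *)

Definition local_at (R : comNzRingType) (m : ideal R) :=
  ~ m 1 /\ forall r : R, ~ m r -> exists s, s * r = 1.

Section Local.
Variables (R : comNzRingType) (m : ideal R) (locR : local_at m).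
Hypothesis accR : noetherian_mod (R^o : lmodType R).

Lemma unit_sub1 (z : R) : m z -> exists s, s * (1 - z) = 1.
Proof.
move=> mz; case: locR => m1; apply => H; apply: m1.
by rewrite -(subrK z 1); apply: (submodD (A := m)).
Qed.

(** Let [v] avoid all ideals of the list but perhaps the first, and let [u] avoid the first. An
    ideal that does not contain both contains at most one v + t_i u, because the difference of two
    of them is a unit times [u]. So every large i works. *)
Lemma avoidable_exists (t : nat -> R) (J : ideal R) (P : R -> Prop) :
  (forall i j : nat, i != j -> ~ m (t i - t j)) ->
  avoidable J P -> exists2 a, J a & P a.
Proof.
move=> Ht [Hs [H1 H2]].
suff [a Ja Ha] : exists2 a, J a & forall H, List.In H Hs -> ~ H a.
  by exists a => //; apply: H2.
elim: Hs {H2} H1 => [|H Hs IH] H1.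
  by exists 0 => //; apply: (submod0 J).
have [|v Jv Hv] := IH; first by move=> K HK; apply: H1; right.
have [Hvv|nHv] := EM (H v); last by exists v => // K [<-|/Hv].
have [u Ju nHu] : exists2 u, J u & ~ H u.
  apply: contrapT => nu; apply: (H1 H); first by left.
  by move=> u Ju; apply: contrapT => nHu; apply: nu; exists u.
have one (K : ideal R) : ~ (K v /\ K u) ->
    exists n0, forall i, (n0 <= i)%N -> ~ K (v + t i * u).
  move=> nvu; have [[i0 Ki0]|no] := EM (exists i, K (v + t i * u)); last first.
    by exists 0%N => i _ Ki; apply: no; exists i.
  exists i0.+1 => i i0i Ki; apply: nvu.
  have Ktu : K ((t i - t i0) * u).
    have -> : (t i - t i0) * u = (v + t i * u) - (v + t i0 * u).
      by rewrite mulrBl opprD addrACA subrr add0r.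
    exact: (submodB (A := K)).
  have [s Es] := locR.2 _ (Ht i i0 (negbT (gtn_eqF i0i))).
  have Ku : K u by rewrite -[u]mul1r -Es -mulrA; apply: (submodZ (A := K)).
  split=> //; rewrite -(addrK (t i0 * u) v); apply: (submodB (A := K)) => //.
  exact: (submodZ (A := K)).
have [n0 Hn0] : exists n0, forall i, (n0 <= i)%N -> forall K, List.In K (H :: Hs) ->
    ~ K (v + t i * u).
  have : forall K, List.In K (H :: Hs) -> ~ (K v /\ K u).
    by move=> K [<- []//|/Hv nKv []].
  elim: (H :: Hs) => [|K Ks IHK] HK; first by exists 0%N.
  have [|n1 Hn1] := IHK; first by move=> L HL; apply: HK; right.
  have [|n2 Hn2] := one K; first by apply: HK; left.
  exists (n1 + n2)%N => i ni L [<-|HL].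
    by apply: Hn2; apply: leq_trans ni; apply: leq_addl.
  by apply: Hn1 => //; apply: leq_trans ni; apply: leq_addr.
exists (v + t n0 * u); last exact: Hn0.
by apply: (submodD (A := J)) => //; apply: (submodZ (A := J)).
Qed.

Variables (M : lmodType R) (accM : noetherian_mod M).
Implicit Types (A B L N P Q : submod M).

(** In place of generators, take [Q] maximal among the proper submodules of T = P + N containing
    [P]. If z x is outside [Q] for some z in m and x in T, then x = q + r z x, and since 1 - r z is
    a unit, x lies in [Q]. Hence mT is inside [Q]. *)
Lemma nakayama P N : N <=: P +: imul m N -> N <=: P.
Proof.
move=> NPm; apply: contrapT => nNP; set T := P +: N.
pose C Q := [/\ P <=: Q, Q <=: T & ~ T <=: Q].
have CP : C P.
  split=> //; first exact: saddl.
  by move=> TP; apply: nNP; apply: sle_trans TP; apply: saddr.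
have [Q [_ [PQ QT nTQ] mx]] := acc_maximal accM (P := C) I CP.
apply: nTQ; apply: sle_trans (_ : P +: imul m T <=: Q).
  apply: sadd_le; first exact: saddl.
  by apply: sle_trans NPm _; apply: sadd_mono => //; apply: imul_mono; apply: saddr.
apply: sadd_le => //; apply/imul_leP => z x mz Tx.
apply: contrapT => nQzx; have TQ' : T <=: Q +: cyc (z *: x).
  apply: contrapT => nT; apply: nQzx.
  have QQ : Q +: cyc (z *: x) <=: Q.
    apply: mx => //; split=> //; first exact: sle_trans (@saddl _ _ _ _).
    by apply: sadd_le => //; apply: cyc_le; apply: submodZ.
  by apply: QQ; apply: saddr; apply: mem_cyc.
have [q Qq [r Er]] := TQ' x Tx.
have [s Es] := unit_sub1 (submodZ r mz : m (r * z)).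
apply: nQzx; apply: submodZ; rewrite -[x]scale1r -Es -scalerA; apply: submodZ.
by rewrite scalerBl scale1r -scalerA -Er opprB addrC subrK.
Qed.

Lemma len_simple L x : (forall z, m z -> L (z *: x)) ->
  fin_length L (L +: cyc x) /\ (len L (L +: cyc x) <= 1)%N.
Proof.
move=> mx; have H n : length_ge L (L +: cyc x) n -> (n <= 1)%N.
  case: n => [|[|n]] // [P [PN nNP [Q [QP nPQ /length_ge_sle LQ]]]].
  exfalso; apply: nNP; have [y Py nQy] : exists2 y, P y & ~ Q y.
    apply: contrapT => no; apply: nPQ => y Py; apply: contrapT => nQy.
    by apply: no; exists y.
  have [l Ll [r Er]] := PN y Py.
  have Lr : ~ m r.
    move=> mr; apply: nQy; rewrite -(subrK l y) Er; apply: submodD; apply: LQ => //.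
    exact: mx.
  have [s Es] := locR.2 _ Lr.
  have LP : L <=: P by apply: sle_trans QP.
  apply: sadd_le => //; apply: cyc_le; rewrite -[x]scale1r -Es -scalerA.
  by apply: submodZ; rewrite -Er; apply: submodB => //; apply: LP.
have f : fin_length L (L +: cyc x) by exists 1%N.
by split=> //; apply: H; case: (lenP (@saddl _ _ _ _) f).
Qed.

Lemma fin_length_imul L N : imul m N <=: L -> fin_length L (L +: N).
Proof.
have [s ->] := noetherian_span accM N; elim: s => [|x s IH] mN.
  by rewrite (sadd_idr (szero_le _)).
have H1 : imul m (span s) <=: L by apply: sle_trans mN; apply: imul_mono; apply: saddr.
rewrite /= (saddC (cyc x)) saddA.
apply: (fin_lengthD (P := L +: span s)) => //; first exact: IH.
apply: (len_simple _).1 => z mz; apply: saddl; apply: mN.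
by apply: mem_imul => //; apply: saddl; apply: mem_cyc.
Qed.

Lemma fin_length_ipow L N k : ipow m k N <=: L -> L <=: N -> fin_length L N.
Proof.
move=> mN LN; rewrite -(sadd_idl LN) => {LN}.
elim: k N mN => [|k IH] N mN; first by rewrite (sadd_idr mN).
apply: (fin_lengthD (P := L +: imul m N)) => //.
- by apply: sadd_mono => //; apply: imul_le.
- by apply: IH; rewrite -ipowSr.
have -> : L +: N = L +: imul m N +: N.
  by rewrite -saddA; congr (_ +: _); symmetry; apply: sadd_idl; apply: imul_le.
by apply: fin_length_imul; apply: saddr.
Qed.

Lemma fin_length_sat L N : L <=: N -> N <=: sat m L -> fin_length L N.
Proof.
move=> LN Nsat; have [k Hk] := sat_cpow m L accM.
by apply: (@fin_length_ipow L N k) => //; apply/ipow_cpow; apply: sle_trans Hk.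
Qed.

(* m has q generators, and each of them maps P / P' onto a piece of
   (B + mP) / (B + mP'). *)
Lemma len_imul_le : exists q, forall B P' P, P' <=: P -> fin_length P' P ->
  fin_length (B +: imul m P') (B +: imul m P) /\
  (len (B +: imul m P') (B +: imul m P) <= q * len P' P)%N.
Proof.
have [s Es] := fg_ideal M m accR; exists (size s) => B P' P PP f.
rewrite !Es.
have stP z : z \in s -> amul z P' <=: imul (fun a => a \in s) P'.
  by move=> zs; apply: amul_imul_le.
move: stP (imul_mono (J := fun a => a \in s) PP); move: (imul _ P') => mP' stP mPP.
suff H s' : {subset s' <= s} ->
    fin_length (B +: mP') (B +: mP' +: imul (fun a => a \in s') P) /\
    (len (B +: mP') (B +: mP' +: imul (fun a => a \in s') P) <= size s' * len P' P)%N.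
  by have := H s (fun _ => id); rewrite -saddA (sadd_idl mPP).
elim: s' => [|z s' IH] ss.
  rewrite (sadd_idr (B := B +: mP')); last by apply/imul_leP.
  by rewrite len_refl.
have {}ss : z \in s /\ {subset s' <= s}.
  by split=> [|w ws]; apply: ss; rewrite in_cons ?eqxx ?ws ?orbT.
have [f1 l1] := IH ss.2.
have -> : imul (fun a => a \in z :: s') P = imul (fun a => a \in s') P +: amul z P.
  apply: submod_ext; last first.
    apply: sadd_le; first by apply: imul_monol => a; rewrite in_cons orbC => ->.
    by apply: amul_imul_le; apply: mem_head.
  apply/imul_leP => a y; rewrite in_cons => /orP[/eqP->|as'] Py.
    by apply: saddr; apply: mem_amul.
  by apply: saddl; apply: mem_imul.
rewrite (saddA (B +: mP')); set L' := B +: mP' +: imul _ P in f1 l1 *.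
have [f2 l2] := len_amul_le (L' := L') PP
  (sle_trans (stP _ ss.1) (sle_trans (@saddr _ _ B _) (@saddl _ _ _ _))) f.
have [] := lenD (L := B +: mP') (P := L') (N := L' +: amul z P)
  (@saddl _ _ _ _) (@saddl _ _ _ _) f1 f2.
move=> f3 ->; split=> //; rewrite mulSn addnC; exact: leq_add.
Qed.

(** The successive layers given by the powers of m have lengths bounded by powers of [q] times that
    of the first, with [q] independent of [B] and [E]. So [c] can be used in all degrees of a graded
    module at once. *)
Lemma len_ipow_le j : exists c, forall B E, B <=: E ->
  fin_length (B +: imul m E) E ->
  fin_length (B +: ipow m j E) E /\
  (len (B +: ipow m j E) E <= c * len (B +: imul m E) E)%N.
Proof.
have [q Hq] := len_imul_le.
have Hj i : exists c, forall B E, B <=: E -> fin_length (B +: imul m E) E ->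
    fin_length (B +: ipow m i.+1 E) (B +: ipow m i E) /\
    (len (B +: ipow m i.+1 E) (B +: ipow m i E) <= c * len (B +: imul m E) E)%N.
  elim: i => [|i [c IH]].
    by exists 1%N => B E BE f; rewrite /= (sadd_idl BE) mul1n.
  exists (q * c)%N => B E BE f; have [f1 l1] := IH B E BE f.
  have [|f2 l2] := Hq B _ _ _ f1.
    by apply: sadd_mono => //; apply: ipow_anti.
  have E1 k : B +: imul m (B +: ipow m k E) = B +: ipow m k.+1 E.
    by rewrite imulD saddA (sadd_idr (@imul_le _ _ _ _)).
  rewrite !E1 in f2 l2; split=> //; apply: leq_trans l2 _.
  by rewrite -mulnA leq_mul2l l1 orbT.
elim: j => [|j [c IH]].
  by exists 0%N => B E BE f; rewrite /= (sadd_idl BE) len_refl.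
have [c' Hc'] := Hj j; exists (c' + c)%N => B E BE f.
have [f1 l1] := IH B E BE f; have [f2 l2] := Hc' B E BE f.
have [||f3 ->] := lenD (L := B +: ipow m j.+1 E) (P := B +: ipow m j E) (N := E) _ _ f2 f1.
- by apply: sadd_mono => //; apply: ipow_anti.
- by apply: sadd_le => //; apply: ipow_le.
by split=> //; rewrite mulnDl leq_add.
Qed.

End Local.

Lemma expn_monol m n e : (m <= n)%N -> (m ^ e <= n ^ e)%N.
Proof. by case: e => // e mn; rewrite leq_exp2r. Qed.

(** * Dimension *)

Section IdealProducts.
Variables (R : comNzRingType) (M : lmodType R).
Implicit Types (J : R -> Prop) (A : ideal R) (N L : submod M).

Lemma imul_imul J A N : imul (imul J A : ideal R) N = imul J (imul A N).
Proof.
apply: submod_ext.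
  apply/imul_leP => a y JAa Ny.
  apply: (_ : imul J A <=: ideal_at (imul J (imul A N)) y) => //.
  apply/imul_leP => b c Jb Ac; change (imul J (imul A N) ((b * c) *: y)).
  by rewrite -scalerA; do 2!apply: mem_imul => //.
apply/imul_colon/imul_leP => b y Ab Ny a Ja.
by rewrite scalerA; apply: mem_imul => //; apply: (mem_imul (M := R^o)).
Qed.

Lemma imul_full N : imul (sfull R^o : ideal R) N = N.
Proof.
apply: submod_ext; first exact: imul_le.
by move=> x Nx; rewrite -[x]scale1r; apply: mem_imul.
Qed.

Lemma imul_ipow_full J k N : imul (ipow J k (sfull R^o) : ideal R) N = ipow J k N.
Proof. by elim: k => [|k IH]; [apply: imul_full|rewrite /= imul_imul IH]. Qed.

Definition annq L : ideal R.
Proof.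
exists (fun r : R => forall x, L (r *: x)).
  by move=> x; rewrite scale0r; apply: submod0.
move=> a r s Hr Hs x; rewrite scalerDl; apply: submodD => //.
by rewrite -[a *: r]/(a * r) -scalerA; apply: submodZ.
Defined.

Lemma annq_le A L : A <=: annq L <-> imul A (sfull M) <=: L.
Proof.
split=> [H|/imul_leP H a Aa x]; last exact: H.
by apply/imul_leP => a y /H Aa _; apply: Aa.
Qed.

Lemma len_cyc (B : ideal R) L x : (forall b, B b -> L (b *: x)) ->
  fin_length B (sfull R^o) -> fin_length L (L +: cyc x) /\
  (len L (L +: cyc x) <= len B (sfull R^o))%N.
Proof.
move=> Bx f; apply: len_le => // n H.
have : length_ge (ideal_at L x) (ideal_at (L +: cyc x) x) n.
  apply: (length_ge_map (phi := fun P => ideal_at P x)) H => P Q LP PQ QL.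
  split=> [r|H y Qy]; first exact: PQ.
  have [l Ll [r Er]] := QL y Qy; have Pl : P l by apply: LP.
  rewrite -(subrK l y) Er; apply: submodD => //.
  apply: (H r); change (Q (r *: x)); rewrite -Er; apply: submodB => //.
  exact: PQ.
move=> G; apply: (length_ge_monor (N := ideal_at (L +: cyc x) x)) => //.
by apply: length_ge_monol G => b; apply: Bx.
Qed.

End IdealProducts.

Section Primes.
Variables (R : comNzRingType) (accR : noetherian_mod (R^o : lmodType R)).
Implicit Types (A B P Q : ideal R).

Definition prime_ideal P := ~ P 1 /\ forall a b : R, P (a * b) -> P a \/ P b.

Lemma ideal_mulr P (a b : R) : P b -> P (a * b).
Proof. exact: (submodZ (A := P)). Qed.

Lemma ideal_mull P (a b : R) : P a -> P (a * b).
Proof. by rewrite mulrC; apply: ideal_mulr. Qed.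

Lemma prime_disjoint (S : R -> Prop) A : S 1 ->
  (forall a b, S a -> S b -> S (a * b)) -> (forall a, S a -> ~ A a) ->
  exists P, [/\ prime_ideal P, A <=: P & forall a, S a -> ~ P a].
Proof.
move=> S1 SM SA; pose C Q := A <=: Q /\ forall a, S a -> ~ Q a.
have CA : C A by [].
have [Q [_ [AQ SQ] mx]] := acc_maximal accR (P := C) I CA.
exists Q; split=> //; split; first exact: SQ.
move=> a b Qab; apply: contrapT => /not_orP [nQa nQb].
have meet c : ~ Q c -> exists q r, Q q /\ S (q + r * c).
  move=> nQc; apply: contrapT => no; apply: nQc.
  apply: (mx (Q +: cyc (c : R^o))) => //; last first.
    by apply: saddr; apply: mem_cyc.
  split; first by apply: sle_trans AQ _.
  move=> s Ss [q Qq [r Er]]; apply: no; exists q, r; split=> //.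
  by rewrite -[r * c]/(r *: (c : R^o)) -Er addrC subrK.
have [q [r [Qq Sq]]] := meet a nQa; have [q' [r' [Qq' Sq']]] := meet b nQb.
apply: (SQ _ (SM _ _ Sq Sq')).
rewrite mulrDl mulrDr -addrA; apply: (submodD (A := Q)); first exact: ideal_mull.
apply: (submodD (A := Q)); first exact: ideal_mull.
rewrite mulrDr; apply: (submodD (A := Q)); first exact: ideal_mulr.
by rewrite mulrACA; apply: ideal_mulr.
Qed.

Lemma prime_expn P (x : R) k : prime_ideal P -> P (x ^+ k) -> P x.
Proof.
move=> [P1 PM]; elim: k => [|k IH]; first by rewrite expr0 => /P1.
by rewrite exprS => /PM [].
Qed.

(** Regularity of [x] keeps [A] away from the products of powers of [x] with elements outside [P]. A
    prime over [A] disjoint from them lies strictly inside [P]; this is why dimension drops modulo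
    [x]. *)
Lemma prime_below A P (x : R) : prime_ideal P -> A <=: P -> P x ->
  (forall r, A (x * r) -> A r) ->
  exists P', [/\ prime_ideal P', A <=: P', P' <=: P & ~ P <=: P'].
Proof.
move=> [P1 PM] AP Px reg.
pose S (y : R) := exists i s, ~ P s /\ y = x ^+ i * s.
have regX i r : A (x ^+ i * r) -> A r.
  by elim: i => [|i IH]; rewrite ?expr0 ?mul1r // exprS -mulrA => /reg.
have [|||P' [pP' AP' SP']] := @prime_disjoint S A.
- by exists 0%N, 1; rewrite expr0 mul1r.
- move=> _ _ [i [s [Ps ->]]] [j [t [Pt ->]]]; exists (i + j)%N, (s * t).
  by rewrite exprD mulrACA; split=> // /PM [].
- by move=> _ [i [s [Ps ->]]] /regX /AP.
exists P'; split=> //.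
  move=> y P'y; apply: contrapT => nPy; apply: (SP' y) => //.
  by exists 0%N, y; rewrite expr0 mul1r.
by move=> /(_ x Px); apply: SP'; exists 1%N, 1; rewrite expr1 mulr1.
Qed.

Definition primes_chain A n (p : nat -> ideal R) :=
  (forall i, (i <= n)%N -> prime_ideal (p i) /\ A <=: p i) /\
  (forall i, (i < n)%N -> p i <=: p i.+1 /\ ~ p i.+1 <=: p i).

Definition dim_le A d := forall n p, primes_chain A n p -> (n <= d)%N.

Lemma primes_chain_below A B P n p : primes_chain B n p -> A <=: B ->
  prime_ideal P -> A <=: P -> P <=: p 0%N -> ~ p 0%N <=: P ->
  primes_chain A n.+1 (fun i => if i is j.+1 then p j else P).
Proof.
move=> [H1 H2] AB pP AP PP nPP; split=> -[|i] // ilt; last exact: H2.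
by have [? Bp] := H1 i ilt; split=> //; apply: sle_trans Bp.
Qed.

Lemma dim_le_drop A B (x : R) d : A <=: B -> B x -> (forall r, A (x * r) -> A r) ->
  dim_le A d.+1 -> dim_le B d.
Proof.
move=> AB Bx reg dA n p ch; have [p0 Bp] := ch.1 0%N isT.
have [P' [pP' AP' P'p npP']] := prime_below p0 (sle_trans AB Bp) (Bp x Bx) reg.
by have /dA := primes_chain_below ch AB pP' AP' P'p npP'.
Qed.

Lemma dim_le_mono A B d : A <=: B -> dim_le A d -> dim_le B d.
Proof.
move=> AB dA n p [H1 H2]; apply: (dA n p); split=> // i /H1 [? ?].
by split=> //; apply: sle_trans AB _.
Qed.

Variables (m : ideal R) (locR : local_at m).

Lemma proper_le_max A : ~ A 1 -> A <=: m.
Proof.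
move=> A1 r Ar; apply: contrapT => /locR.2 [s Es].
by apply: A1; rewrite -Es; apply: ideal_mulr.
Qed.

Lemma max_prime : prime_ideal m.
Proof.
split=> [|a b mab]; first exact: locR.1.
apply: contrapT => /not_orP [/locR.2 [s Es] nb]; apply: nb.
by rewrite -[b]mul1r -Es -mulrA; apply: ideal_mulr.
Qed.

Lemma sat_prime A P : prime_ideal P -> A <=: P -> ~ m <=: P -> sat m A <=: P.
Proof.
move=> pP AP nmP r [k].
have [z mz nPz] : exists2 z, m z & ~ P z.
  apply: contrapT => no; apply: nmP => z mz; apply: contrapT => nPz.
  by apply: no; exists z.
have : ~ P (z ^+ k) by move=> /(prime_expn pP).
move=> nPzk /cpow_mem Hk.
have : P (z ^+ k * r); last by move=> /pP.2 [].
apply: AP; apply: Hk; elim: k {nPzk} => [|k IH].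
  by rewrite expr0 mul1r; apply: mem_cyc.
by rewrite exprS -mulrA; apply: (mem_imul (M := R^o)).
Qed.

Variable t : nat -> R.
Hypothesis t_distinct : forall i j : nat, i != j -> ~ m (t i - t j).

Lemma max_regular A : exists2 x, m x & forall r, sat m A (x * r) -> sat m A r.
Proof.
have [x mx Hx] := avoidable_exists locR t_distinct
  (avoidable_regular accR accR (sat_idem (J := m) (A := A) accR)).
by exists x.
Qed.

Lemma regular_prime A (x : R) : ~ A 1 -> (forall r, A (x * r) -> A r) ->
  exists P, [/\ prime_ideal P, A <=: P & ~ P x].
Proof.
move=> A1 reg; have [|||P [pP AP SP]] := @prime_disjoint (fun y => exists k, y = x ^+ k) A.
- by exists 0%N; rewrite expr0.
- by move=> _ _ [i ->] [j ->]; exists (i + j)%N; rewrite exprD.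
- move=> _ [k ->]; elim: k => [|k IH]; first by rewrite expr0.
  by rewrite exprS => /reg.
by exists P; split=> //; apply: SP; exists 1%N.
Qed.

Lemma chain1 A P : A <=: P -> prime_ideal P -> ~ m <=: P -> exists p, primes_chain A 1 p.
Proof.
move=> AP pP nmP; exists (fun i => if i is 0%N then P else m); split.
  move=> [|i] _; split=> //; first exact: max_prime.
  by apply: sle_trans AP (proper_le_max pP.1).
by move=> [|//] _; split=> //; apply: proper_le_max pP.1.
Qed.

(** If 1 were outside the m-saturation of [A], an element of m regular modulo it would be missed by
    some prime over [A], and that prime followed by [m] would be a chain of length 1. *)
Lemma dim0_ipow A : dim_le A 0 -> exists k, ipow m k (sfull R^o) <=: A.
Proof.
move=> dA; have [k Hk] := sat_cpow m A accR.
exists k; apply/ipow_cpow; apply: sle_trans Hk => r _.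
suff : sat m A 1 by move=> /(ideal_mulr (P := sat m A) r); rewrite mulr1.
apply: contrapT => nA1; have [x mx reg] := max_regular A.
have [P [pP AP nPx]] := regular_prime nA1 reg.
have [||p /dA //] := @chain1 A P _ pP; first exact: sle_trans (@sat_ge _ _ _ _) AP.
by move=> /(_ x mx).
Qed.

(* For x in m regular modulo A : m^oo, the sequence
   R / (A + m^j) --x--> R / (A + m^(j+1)) -> R / (A + xR + m^(j+1)) -> 0
   bounds the increments of the length. *)
Lemma samuel_bound A d : dim_le A d -> exists c, forall j,
  fin_length (A +: ipow m j (sfull R^o)) (sfull R^o) /\
  (len (A +: ipow m j (sfull R^o)) (sfull R^o) <= c * j.+1 ^ d)%N.
Proof.
have fin B k : ipow m k (sfull R^o) <=: B -> fin_length B (sfull R^o).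
  by move=> H; apply: (fin_length_ipow locR accR) H _.
have small B e k : ipow m k (sfull R^o) <=: B -> exists c, forall j,
    fin_length (B +: ipow m j (sfull R^o)) (sfull R^o) /\
    (len (B +: ipow m j (sfull R^o)) (sfull R^o) <= c * j.+1 ^ e)%N.
  move=> Hk; exists (len B (sfull R^o)) => j.
  split; first by apply: (fin _ j); apply: saddr.
  apply: (@leq_trans (len B (sfull R^o))); last by rewrite leq_pmulr ?expn_gt0.
  apply: len_sub => //; exact: fin Hk.
elim: d A => [|d IH] A dA.
  by have [k] := dim0_ipow dA; apply: small.
have [x mx reg] := max_regular A.
have dB : dim_le (A +: cyc (x : R^o)) d.
  move=> n p ch; have [p0 Ap] := ch.1 0%N isT.
  (* In a chain with at least one step the lowest prime does not contain [m], so it contains the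
     m-saturation of [A], modulo which [x] is regular. The chain can then be extended downwards. *)
  case: n => // n in ch *.
  have nmp : ~ m <=: p 0%N.
    move=> mp; have [_ np] := ch.2 0%N isT; apply: np; apply: sle_trans mp.
    by apply: proper_le_max; case: (ch.1 1%N isT) => -[].
  have sp : sat m A <=: p 0%N by apply: sat_prime => //; apply: sle_trans Ap.
  have px : p 0%N x by apply: Ap; apply: saddr; apply: mem_cyc.
  have [P' [pP' AP' P'p npP']] := prime_below p0 sp px reg.
  have AP : A <=: P' by apply: sle_trans AP'; apply: sat_ge.
  by have /dA := primes_chain_below ch (@saddl _ _ _ _) pP' AP P'p npP'.
have [c Hc] := IH _ dB; exists c => j.
split; first by apply: (fin _ j); apply: saddr.
elim: j => [|j IHj]; first by rewrite /= (sadd_idl (@sle_full _ _ _)) len_refl.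
set L := A +: ipow m j.+1 _; set L0 := A +: ipow m j _ in IHj.
have fL : fin_length L (sfull R^o) by apply: (fin _ j.+1); apply: saddr.
rewrite (len_add (P := L +: amul x (sfull R^o))) //.
have f0 : fin_length L0 (sfull R^o) by apply: (fin _ j); apply: saddr.
have [||_ l1] := len_amul_le (a := x) (L := L0) (L' := L) _ _ f0.
- exact: sle_full.
- rewrite amulD; apply: sadd_mono; [exact: amul_le|exact: amul_imul_le].
have l2 : (len (L +: amul x (sfull R^o)) (sfull R^o) <= c * j.+2 ^ d)%N.
  apply: leq_trans (Hc j.+1).2; rewrite /L -saddA (saddC (ipow _ _ _)) saddA.
  apply: len_sub => //; last by case: (Hc j.+1).
  apply: sadd_mono => //; apply: sadd_mono => //; apply: cyc_le.
  by exists (1 : R^o) => //; rewrite -[x *: _]/(x * 1) mulr1.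
(* What remains is (j+1)^(d+1) + (j+2)^d <= (j+2)^(d+1). *)
apply: leq_trans (leq_add (leq_trans l1 IHj) l2) _.
rewrite -mulnDr leq_mul2l; apply/orP; right.
by rewrite !expnS [X in (_ <= X)%N]mulSn addnC leq_add2l leq_mul2l expn_monol ?orbT.
Qed.

Variables (M : lmodType R) (accM : noetherian_mod M).

(** N/K is a module over R/A with [size s] generators, each contributing at most the length of R/(A
    + m^j). *)
Lemma samuel_bound_mod A d (K N : submod M) : dim_le A d -> imul A N <=: K -> K <=: N ->
  exists c, forall j, fin_length (K +: ipow m j N) N /\
    (len (K +: ipow m j N) N <= c * j.+1 ^ d)%N.
Proof.
move=> dA AN KN; have [c Hc] := samuel_bound dA.
have [s Es] := noetherian_span accM N; exists (size s * c)%N => j.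
rewrite -{2 4}(sadd_idl KN); rewrite Es in AN *; clear N Es KN.
elim: s K AN => [|x s IH] K AN.
  by rewrite mul0n /= ipow_szero !(sadd_idr (szero_le _)) len_refl.
set N := span (x :: s) in AN *; set K' := K +: ipow m j N.
have sN : span s <=: N by apply: saddr.
have [|f1 l1] := IH K'.
  apply: sle_trans (imul_mono sN) _; apply: sle_trans AN _; exact: saddl.
have E1 : K' +: ipow m j (span s) = K'.
  apply: sadd_idr; apply: sle_trans (@saddr _ _ _ _); exact: ipow_mono.
rewrite E1 in f1 l1; have [f3 l3] := Hc j.
have [|f2 l2] := len_cyc (B := A +: ipow m j (sfull R^o)) (L := K' +: span s) (x := x) _ f3.
  move=> b [a Aa mb]; rewrite -(subrK a b) scalerDl; apply: submodD.
    apply: saddl; apply: saddr.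
    apply: (_ : ipow m j (sfull R^o) <=: ideal_at (ipow m j N) x) => //.
    rewrite -(imul_ipow_full m j N) => r Hr; apply: mem_imul => //.
    by apply: saddl; apply: mem_cyc.
  apply: saddl; apply: saddl; apply: AN; apply: mem_imul => //.
  by apply: saddl; apply: mem_cyc.
have EN : K +: N = K' +: span s +: cyc x.
  rewrite -saddA (saddC (span s)) -saddA; congr (_ +: _); symmetry.
  by apply: sadd_idl; apply: ipow_le.
rewrite EN; have [f4 ->] := lenD (@saddl _ _ _ _) (@saddl _ _ _ _) f1 f2.
split=> //; rewrite /= mulSn mulnDl addnC; apply: leq_add => //.
exact: leq_trans l3.
Qed.

Lemma dim0_mod (L : submod M) : dim_le (annq L) 0 -> exists k, ipow m k (sfull M) <=: L.
Proof.
move=> /dim0_ipow [k Hk]; exists k; rewrite -imul_ipow_full.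
by apply: sle_trans (_ : imul (annq L) (sfull M) <=: L); [apply: imul_monol|apply/annq_le].
Qed.

End Primes.

(** * Quotient modules *)

Section Surjection.
Variables (R : comNzRingType) (M M' : lmodType R) (f : {linear M -> M'}).
Hypothesis f_surj : forall y, exists x, f x = y.
Implicit Types (A : submod M) (B C : submod M') (J : R -> Prop).

Definition spre B : submod M.
Proof.
exists (fun x => B (f x)); first by rewrite linear0; apply: submod0.
by move=> a x y Bx By; rewrite linearP; apply: submod_lin.
Defined.

Definition simg A : submod M'.
Proof.
exists (fun y => exists2 x, A x & y = f x).
  by exists 0; [apply: submod0|rewrite linear0].
move=> a _ _ [x Ax ->] [y Ay ->]; exists (a *: x + y); last by rewrite linearP.
exact: submod_lin.
Defined.

Definition sker := spre (szero M').

Lemma spre_sle B C : B <=: C <-> spre B <=: spre C.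
Proof.
split=> [BC x|BC y]; first exact: BC.
by have [x <-] := f_surj y; apply: BC.
Qed.

Lemma sker_le B : sker <=: spre B.
Proof. by apply/spre_sle. Qed.

Lemma spre_simg A : spre (simg A) = A +: sker.
Proof.
apply: submod_ext => [x [y Ay E]|].
  by exists y => //; change (f (x - y) = 0); rewrite linearB E subrr.
apply: sadd_le; first by move=> x Ax; exists x.
exact: sker_le.
Qed.

Lemma spre_ext B C : spre B = spre C -> B = C.
Proof. by move=> E; apply: submod_ext; apply/spre_sle; rewrite E. Qed.

Lemma simg_spre B : simg (spre B) = B.
Proof.
by apply: spre_ext; rewrite spre_simg; apply: sadd_idr; apply: sker_le.
Qed.

Lemma spre_full : spre (sfull M') = sfull M.
Proof. exact: submod_ext. Qed.

Lemma spre_add B C : spre (B +: C) = spre B +: spre C.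
Proof.
apply: submod_ext; last by apply: sadd_le; apply/spre_sle.
move=> x [y By Cxy]; have [z Ez] := f_surj y.
exists z; first by change (B (f z)); rewrite Ez.
by change (C (f (x - z))); rewrite linearB Ez.
Qed.

Lemma spre_cap B C : spre (B &: C) = spre B &: spre C.
Proof. exact: submod_ext. Qed.

Lemma spre_imul J B : spre (imul J B) = imul J (spre B) +: sker.
Proof.
rewrite -spre_simg; apply: submod_ext; apply/spre_sle.
  apply/imul_leP => a y Ja By; have [x Ex] := f_surj y.
  exists (a *: x); last by rewrite linearZ /= Ex.
  by apply: mem_imul => //; change (B (f x)); rewrite Ex.
move=> _ [x Hx ->]; apply: (_ : imul J (spre B) <=: spre (imul J B)) => //.
apply/imul_leP => a z Ja Bz; change (imul J B (f (a *: z))).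
by rewrite linearZ; apply: mem_imul.
Qed.

Lemma spre_ipow J n B : spre (ipow J n B) = ipow J n (spre B) +: sker.
Proof.
elim: n => [|n IH] /=; first by rewrite (sadd_idr (@sker_le B)).
by rewrite spre_imul IH imulD -saddA (sadd_idl (@imul_le _ _ _ _)).
Qed.

Lemma spre_colon J B : spre (colon J B) = colon J (spre B).
Proof.
apply: submod_ext => x Hx a Ja.
  by change (B (f (a *: x))); rewrite linearZ; apply: Hx.
by rewrite -linearZ; apply: Hx.
Qed.

Lemma spre_cpow J n B : spre (cpow J n B) = cpow J n (spre B).
Proof. by elim: n => //= n IH; rewrite spre_colon IH. Qed.

Lemma spre_sat J B : spre (sat J B) = sat J (spre B).
Proof.
apply: submod_ext => x [n Hn]; exists n; first by rewrite -spre_cpow.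
by move: Hn; rewrite -spre_cpow.
Qed.

Lemma annq_spre B : annq (spre B) = annq B.
Proof.
apply: submod_ext => a Ha x.
  by have [y <-] := f_surj x; rewrite -linearZ; apply: Ha.
by change (B (f (a *: x))); rewrite linearZ; apply: Ha.
Qed.

Lemma length_ge_spre B C n : length_ge B C n <-> length_ge (spre B) (spre C) n.
Proof.
split; first by apply: (length_ge_map (phi := spre)) => P Q _ PQ _;
  split=> [|/spre_sle //]; apply/spre_sle.
move=> H; rewrite -(simg_spre B) -(simg_spre C).
apply: (length_ge_map (phi := simg)) H => P Q BP PQ _.
have E A : spre B <=: A -> spre (simg A) = A.
  by move=> BA; rewrite spre_simg; apply: sadd_idr; apply: sle_trans BA; apply: sker_le.
have BQ := sle_trans BP PQ.
by split=> [|/spre_sle]; [apply/spre_sle|]; rewrite !E.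
Qed.

Lemma len_spre B C : B <=: C ->
  (fin_length B C <-> fin_length (spre B) (spre C)) /\ len B C = len (spre B) (spre C).
Proof.
move=> BC; apply: len_iso => //; first exact/spre_sle.
by move=> n; apply: length_ge_spre.
Qed.

Lemma noetherian_surj : noetherian_mod M -> noetherian_mod M'.
Proof.
move=> accM S _ S_mono; have [|t0 H] := accM (fun t => spre (S t)) (fun=> I).
  by move=> t; apply/spre_sle.
by exists t0 => t /H /spre_sle.
Qed.

End Surjection.

Section QuotientModule.
Variables (R : comNzRingType) (M : lmodType R).
Implicit Types (A : submod M).

Definition submod_pred (A : submod M) : {pred M} := fun x => `[< A x >].

Lemma submod_predP A x : reflect (A x) (x \in submod_pred A).
Proof. exact: asboolP. Qed.

Lemma submod_pred_closed A : submod_closed (submod_pred A).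
Proof.
split; first by apply/submod_predP; apply: submod0.
move=> a x y /submod_predP Ax /submod_predP Ay.
by apply/submod_predP; apply: submod_lin.
Qed.

HB.instance Definition _ A :=
  GRing.isSubmodClosed.Build R M (submod_pred A) (submod_pred_closed A).

Definition submod_of (N : submodClosed M) : submod M.
Proof.
exists (fun x => x \in N); first exact: rpred0.
by move=> a x y Nx Ny; apply: rpredD => //; apply: rpredZ.
Defined.

Section Projection.
Variable N : submodClosed M.

Definition quo_proj (x : M) : quom N := \pi_(quom N)%qT x.

Lemma quo_proj_linear : linear quo_proj.
Proof.
move=> a x y; rewrite /quo_proj pi_addr; congr (_ + _).
exact: pi_scaleq.
Qed.

HB.instance Definition _ :=
  GRing.isLinear.Build R M (quom N) *:%R quo_proj quo_proj_linear.

Lemma quo_proj_surj y : exists x, quo_proj x = y.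
Proof. by exists (repr y); apply: reprK. Qed.

Lemma quo_proj_ker : sker quo_proj = submod_of N.
Proof.
have E x : (quo_proj x = 0) <-> x \in N.
  have -> : 0 = quo_proj 0 by rewrite linear0.
  rewrite /quo_proj; split.
    by move/eqmodP; rewrite /= /Quotient.equiv subr0.
  by move=> Nx; apply/eqmodP; rewrite /= /Quotient.equiv subr0.
by apply: submod_ext => x /E.
Qed.

End Projection.

Lemma quotient_exists (K : submod M) : exists (M' : lmodType R) (f : {linear M -> M'}),
  (forall y, exists x, f x = y) /\ sker f = K.
Proof.
exists (quom (submod_pred K)), (quo_proj (submod_pred K)).
split; first exact: quo_proj_surj.
rewrite quo_proj_ker; apply: submod_ext => x Kx; first exact/submod_predP.
by apply/submod_predP.
Qed.

End QuotientModule.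

(** * The I-adic filtration *)

Section AdicFiltration.
Variables (R : comNzRingType) (m I : ideal R).

Section OneModule.
Variable M : lmodType R.

Definition adic n : submod M := ipow I n (sfull M).

(* H0gr n / adic n.+1 is the degree n part of H^0_m (gr_I M). *)
Definition H0gr n : submod M := adic n &: sat m (adic n.+1).

Definition torsion_free := sat I (szero M) <=: szero M.

Lemma adicS n : adic n.+1 <=: adic n. Proof. exact: imul_le. Qed.

Lemma adic_anti i n : (i <= n)%N -> adic n <=: adic i.
Proof. exact: ipow_anti. Qed.

Lemma adicS_le_H0gr n : adic n.+1 <=: H0gr n.
Proof. by apply: scap_le; [apply: adicS|apply: sat_ge]. Qed.

Lemma amul_adic a n : I a -> amul a (adic n) <=: adic n.+1.
Proof. exact: amul_imul_le. Qed.

Lemma graded_cap_adic (S : nat -> submod M) :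
  (forall n, imul I (S n) <=: S n.+1) -> graded I (fun n => adic n &: S n).
Proof.
move=> HS; split=> n; first exact: scapl.
apply: scap_le; first by apply: imul_mono; apply: scapl.
by apply: sle_trans (HS n); apply: imul_mono; apply: scapr.
Qed.

Lemma graded_adicS : graded I (fun n => adic n.+1).
Proof. by split=> n //; apply: adicS. Qed.

Lemma sat_imul J J' (A B : submod M) : imul J' A <=: B -> imul J' (sat J A) <=: sat J B.
Proof.
move=> AB; apply/imul_leP => a y J'a [k /cpow_mem Hk]; exists k; apply/cpow_mem.
have -> : cyc (a *: y) = amul a (cyc y).
  apply: submod_ext => [_ [r ->]|_ [_ [r ->] ->]].
    by exists (r *: y); [exists r|rewrite !scalerA mulrC].
  by exists r; rewrite !scalerA mulrC.
rewrite ipow_amul; apply: sle_trans (amul_mono Hk) _.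
by apply: sle_trans AB; apply: amul_imul_le.
Qed.

Lemma graded_H0gr : graded I H0gr.
Proof. by apply: graded_cap_adic => n; apply: sat_imul. Qed.

End OneModule.

Section AdicQuotient.
Variables (M M' : lmodType R) (f : {linear M -> M'}).
Hypothesis f_surj : forall y, exists x, f x = y.
Local Notation K := (sker f).

Lemma spre_adic n : spre f (adic M' n) = adic M n +: K.
Proof. by rewrite spre_ipow // spre_full. Qed.

(** The kernel enters only through its trace on [adic M n]. In both applications Artin-Rees computes
    this trace for large [n]: it is 0 for the torsion, and a I^(n-1)M for aM. *)
Lemma len_gr_quotient n j :
  len (adic M' n.+1 +: ipow m j (adic M' n)) (adic M' n) =
  len (adic M n.+1 +: ipow m j (adic M n) +: (adic M n &: K)) (adic M n).
Proof.
have [_ ->] := len_spre f_surj (B := adic M' n.+1 +: ipow m j (adic M' n))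
  (C := adic M' n) (sadd_le (@adicS _ _) (@ipow_le _ _ _ _ _)).
rewrite spre_add // spre_ipow // !spre_adic ipowDr.
set L := adic M n.+1 +: ipow m j (adic M n).
have LF : L <=: adic M n by apply: sadd_le; [apply: adicS|apply: ipow_le].
have -> : adic M n.+1 +: K +: (ipow m j (adic M n) +: ipow m j K +: K) = L +: K.
  rewrite -(saddA (ipow m j _)) (sadd_idl (@ipow_le _ _ _ _ _)).
  by rewrite (saddC (adic M n.+1)) -!saddA saddC -!saddA (sadd_idl (@sle_refl _ _ K)).
by have [_ ->] := len_addK K LF; rewrite scapC smodular // (scapC K).
Qed.

Lemma len_H0gr_quotient n :
  len (adic M' n.+1) (H0gr M' n) =
  len (adic M n.+1 +: (adic M n &: K)) (adic M n &: sat m (adic M n.+1 +: K)).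
Proof.
have [_ ->] := len_spre f_surj (@adicS_le_H0gr M' n).
rewrite /H0gr spre_cap spre_sat // !spre_adic; set S := sat m _.
have FS : adic M n.+1 +: K <=: S by apply: sat_ge.
have KS : K <=: S by apply: sle_trans FS.
rewrite (saddC (adic M n)) smodular // (saddC K).
set T := adic M n &: S.
have LT : adic M n.+1 <=: T.
  by apply: scap_le; [apply: adicS|apply: sle_trans FS].
have [_ ->] := len_addK K LT; congr len.
rewrite scapC smodular //; congr (_ +: _).
apply: submod_ext => x; first by move=> [Kx [Fx _]].
by move=> [Fx Kx]; do 2!split=> //; apply: KS.
Qed.

End AdicQuotient.

Variables (M : lmodType R) (accR : noetherian_mod (R^o : lmodType R)).
Variable accM : noetherian_mod M.

(** By Artin-Rees the trace of the torsion on I^n M lies in I^(n-c) times the torsion, which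
    vanishes once n - c reaches an exponent [k] with I^k killing the torsion. *)
Lemma adic_cap_torsion : exists n0, forall n, (n0 <= n)%N ->
  adic M n &: sat I (szero M) = szero M.
Proof.
have [k Hk] := sat_cpow I (szero M) accM.
have gF : graded I (fun n => adic M n &: sat I (szero M)).
  by apply: graded_cap_adic => n; apply: imul_le.
have [c Hc] := artin_rees accM (fg_ideal M I accR) gF.
exists (c + k)%N => n cn; apply: submod_ext => // x Hx.
have := Hc (n - c)%N x; rewrite subnKC; last lia.
move=> /(_ Hx) {}Hx; apply: (_ : ipow I k (sat I (szero M)) <=: szero M).
  exact/ipow_cpow.
apply: (ipow_anti (n := (n - c)%N)); first lia.
by apply: ipow_mono Hx; apply: scapr.
Qed.

Lemma torsion_free_quotient (M' : lmodType R) (f : {linear M -> M'}) :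
  (forall y, exists x, f x = y) -> sker f = sat I (szero M) -> torsion_free M'.
Proof.
move=> f_surj Ef; apply/(spre_sle f_surj); rewrite spre_sat //.
by change (sat I (sker f) <=: sker f); rewrite Ef; apply: sat_idem.
Qed.

(** Artin-Rees gives y = a x with x in I^(n+1-c)M, a defect of bounded size. The superficial
    hypothesis then raises the order of [x] one step at a time up to [n]. *)
Lemma superficial_cap a : I a ->
  (exists n0, forall n, (n0 <= n)%N -> forall x,
     adic M n x -> adic M n.+2 (a *: x) -> adic M n.+1 x) ->
  exists n0, forall n, (n0 <= n)%N -> adic M n.+1 &: amul a (sfull M) = amul a (adic M n).
Proof.
move=> Ia [n0 Hn0].
have gF : graded I (fun n => adic M n &: amul a (sfull M)).
  by apply: graded_cap_adic => n; apply: imul_le.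
have [c Hc] := artin_rees accM (fg_ideal M I accR) gF.
exists (c + n0)%N => n cn; apply: submod_ext; last first.
  by apply: scap_le; [apply: amul_adic|apply: amul_mono].
move=> y Hy; have := Hc (n.+1 - c)%N y; rewrite subnKC; last lia.
move=> /(_ Hy) Hy'.
have [x Fx Ey] : amul a (adic M (n.+1 - c)) y.
  by rewrite -ipow_amul; apply: ipow_mono Hy'; apply: scapr.
exists x => //; case: Hy => Fy _.
set l := (n.+1 - c)%N in Fx.
have H i : (l + i <= n)%N -> adic M (l + i) x.
  elim: i => [|i IH] li; first by rewrite addn0.
  rewrite addnS; apply: Hn0; [lia|apply: IH; lia|].
  by rewrite -Ey; apply: (adic_anti (n := n.+1)) Fy; lia.
have [ln|nl] := leqP l n; last by apply: (adic_anti (n := l)) => //; lia.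
by have := H (n - l)%N; rewrite subnKC //; apply.
Qed.

Lemma imulJ_amul (J : R -> Prop) (K N : submod M) a :
  amul a K <=: N -> amul a (imul J K) <=: imul J N.
Proof. by move=> aK; rewrite -imul_amul; apply: imul_mono. Qed.

Lemma ipow_amul_le (J : R -> Prop) k (K N : submod M) a :
  amul a K <=: N -> amul a (ipow J k K) <=: ipow J k N.
Proof. by move=> aK; rewrite -ipow_amul; apply: ipow_mono. Qed.

End AdicFiltration.

(** * Growth of the associated graded module *)

Section Growth.
Variables (R : comNzRingType) (m I : ideal R) (locR : local_at m) (Im : I <=: m).
Hypothesis accR : noetherian_mod (R^o : lmodType R).
Variable t : nat -> R.
Hypothesis t_distinct : forall i j : nat, i != j -> ~ m (t i - t j).

Lemma annq_regular (M : lmodType R) (a : R) :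
  (forall x : M, a *: x = 0 -> x = 0) ->
  forall r, annq (szero M) (a * r) -> annq (szero M) r.
Proof. by move=> reg r H x; apply: reg; rewrite scalerA; apply: H. Qed.

Lemma dim_le_quotient (M M' : lmodType R) (f : {linear M -> M'}) d :
  (forall y, exists x, f x = y) ->
  dim_le (annq (szero M)) d -> dim_le (annq (szero M')) d.
Proof.
move=> f_surj; apply: dim_le_mono; rewrite -(annq_spre f_surj) => r Hr x.
by rewrite Hr; apply: submod0.
Qed.

Lemma dim_le_regular_quotient (M M' : lmodType R) (f : {linear M -> M'}) (a : R) d :
  (forall y, exists x, f x = y) -> sker f = amul a (sfull M) ->
  (forall x : M, a *: x = 0 -> x = 0) ->
  dim_le (annq (szero M)) d.+1 -> dim_le (annq (szero M')) d.
Proof.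
move=> f_surj Ef reg.
apply: (dim_le_drop accR (A := annq (szero M)) (x := a)) (annq_regular reg).
- rewrite -(annq_spre f_surj) => r Hr x; rewrite Hr; exact: submod0.
- rewrite -(annq_spre f_surj) => x; change (sker f (a *: x)); rewrite Ef.
  exact: mem_amul.
Qed.

Lemma fin_gr (M : lmodType R) n j : noetherian_mod M ->
  fin_length (adic I M n.+1 +: ipow m j (adic I M n)) (adic I M n).
Proof.
move=> accM; apply: (fin_length_ipow locR accM (k := j)); first exact: saddr.
by apply: sadd_le; [apply: adicS|apply: ipow_le].
Qed.

(** In the inductive step dim M <= d + 1, and a regular superficial [a] bounds the increments in n
    by the same lengths for M/aM. Summation over n raises their exponent by one, to [d]. The initial
    value at n0 has exponent [d] in j, because [I] contains [a] and so the annihilator of M plus [I]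
    has dimension at most [d]. *)
Lemma gr_growth d (M : lmodType R) : noetherian_mod M -> dim_le (annq (szero M)) d ->
  exists c n0, forall n, (n0 <= n)%N -> forall j,
  (len (adic I M n.+1 +: ipow m j (adic I M n)) (adic I M n) <=
     if d is e.+1 then c * (n + j).+1 ^ e else 0)%N.
Proof.
elim: d M => [|d IH] M accM dM.
  have [k Hk] := dim0_mod accR locR t_distinct dM.
  exists 0%N, k => n kn j.
  have Z i : (k <= i)%N -> adic I M i = szero M.
    move=> ki; apply: submod_ext => //; apply: sle_trans Hk.
    apply: sle_trans (ipow_anti ki) _; rewrite /adic.
    elim: k {kn ki} => //= k IHk; apply: sle_trans (imul_mono IHk) _.
    exact: imul_monol.
  by rewrite !Z ?(sadd_idl (szero_le _)) ?ipow_szero ?len_refl // leqW.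
wlog tf : M accM dM / torsion_free I M.
  move=> H; have [M' [f [f_surj Ef]]] := quotient_exists (sat I (szero M)).
  have [|||c [n0 H0]] := H M'.
  - exact: noetherian_surj accM.
  - exact: dim_le_quotient dM.
  - exact: torsion_free_quotient Ef.
  have [n1 H1] := adic_cap_torsion I accR accM.
  exists c, (n0 + n1)%N => n nn j; have := H0 n (leq_trans (leq_addr _ _) nn) j.
  rewrite (len_gr_quotient _ _ f_surj) Ef H1; last exact: leq_trans (leq_addl _ _) nn.
  by rewrite (sadd_idr (szero_le _)).
have [a Ia [reg sup]] := avoidable_exists locR t_distinct
  (avoidable_and (avoidable_regular accR accM tf)
                 (avoidable_filter_regular accR accM (graded_adicS I M))).
have [n1 Hn1] := superficial_cap accR accM Ia sup.
have [M' [f [f_surj Ef]]] := quotient_exists (amul a (sfull M)).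
have dM' := dim_le_regular_quotient f_surj Ef reg dM.
have [c2 [n2 Hn2]] := IH M' (noetherian_surj f_surj accM) dM'.
pose n0 := (n1 + n2)%N; pose L n j := len (adic I M n.+1 +: ipow m j (adic I M n)) (adic I M n).
have [c0 Hc0] : exists c0, forall j, (L n0 j <= c0 * j.+1 ^ d)%N.
  have [|||c0 H] := samuel_bound_mod accR locR t_distinct accM
      (A := annq (szero M) +: I) (d := d) (K := adic I M n0.+1) (N := adic I M n0).
  - apply: (dim_le_drop accR (A := annq (szero M)) (x := a)) dM => //.
    + by apply: saddr.
    + exact: annq_regular.
  - apply/imul_leP => r x [s Hs Is] Fx; rewrite -(subrK s r) scalerDl.
    apply: submodD; first exact: mem_imul.
    by rewrite Hs; apply: submod0.
  - exact: adicS.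
  - by exists c0 => j; case: (H j).
(* Multiplication by [a] from degree n to degree n + 1 of gr / m^j gr has the piece of M/aM as
   cokernel, because aM meets I^(n+1)M in a I^n M. *)
have step n j : (n1 <= n)%N -> (L n.+1 j <= L n j +
   len (adic I M' n.+2 +: ipow m j (adic I M' n.+1)) (adic I M' n.+1))%N.
  move=> nn; rewrite (len_gr_quotient _ _ f_surj) Ef Hn1 // /L.
  set L1 := adic I M n.+2 +: _; set L0 := adic I M n.+1 +: _.
  rewrite (len_add (P := L1 +: amul a (adic I M n))) ?leq_add2r //; last 1 first.
  - exact: fin_gr.
  - have [] // := len_amul_le (a := a) (L := L0) (L' := L1) (N := adic I M n).
    + by apply: sadd_le; [apply: adicS|apply: ipow_le].
    + rewrite amulD; apply: sadd_mono; first exact: amul_adic.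
      by apply: ipow_amul_le; apply: amul_adic.
    + exact: fin_gr.
  - apply: sadd_le; last exact: amul_adic.
    by apply: sadd_le; [apply: adicS|apply: ipow_le].
case: d {IH dM dM'} => [|e] in Hn2 Hc0 *.
  exists c0, n0 => n nn j; rewrite expn0 muln1 -/(L n j).
  move: nn => /subnKC <-; elim: (n - n0)%N => [|i IHi]; first by rewrite addn0 -[c0]muln1.
  rewrite addnS; apply: leq_trans (step _ _ _) _; first by rewrite -addnA leq_addr.
  apply: leq_trans (leq_add IHi (Hn2 _ _ _)) _; last by rewrite addn0.
  by rewrite /n0; lia.
exists (c0 + c2)%N, n0 => n nn j; rewrite -/(L n j).
move: nn => /subnKC <-; set i := (n - n0)%N.
have H : (L (n0 + i)%N j <= c0 * j.+1 ^ e.+1 + i * (c2 * (n0 + i + j).+1 ^ e))%N.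
  elim: i => [|i IHi]; first by rewrite addn0 mul0n addn0.
  rewrite addnS; apply: leq_trans (step _ _ _) _; first by rewrite -addnA leq_addr.
  apply: leq_trans (leq_add IHi (Hn2 _ _ _)) _; first by rewrite /n0; lia.
  rewrite -addnA leq_add2l mulSn addnC leq_add2l leq_mul2l; apply/orP; right.
  by rewrite leq_mul2l; apply/orP; right; apply: expn_monol; lia.
apply: leq_trans H _; rewrite mulnDl; apply: leq_add.
  by rewrite leq_mul2l; apply/orP; right; apply: expn_monol; lia.
rewrite expnS mulnA (mulnC i) -mulnA leq_mul2l; apply/orP; right.
by rewrite leq_mul2r; apply/orP; right; lia.
Qed.

End Growth.

(** * The j-multiplicity modulo a general element *)

Section Recursion.
Variables (R : comNzRingType) (m I : ideal R) (locR : local_at m) (Im : I <=: m).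
Hypothesis accR : noetherian_mod (R^o : lmodType R).
Variable t : nat -> R.
Hypothesis t_distinct : forall i j : nat, i != j -> ~ m (t i - t j).
Variables (M : lmodType R) (accM : noetherian_mod M).

Local Notation F n := (adic I M n).
Local Notation Q n := (H0gr m I M n).
(** [F n] modulo [fiber n] is the degree n part of C / mC. *)
Local Notation fiber n := (Q n +: imul m (F n)).
Local Notation fiber_len n := (len (fiber n) (F n)).

Lemma fiber_le n : fiber n <=: F n.
Proof. by apply: sadd_le; [apply: scapl|apply: imul_le]. Qed.

Lemma fin_H0gr_ipow n j : fin_length (Q n +: ipow m j (F n)) (F n).
Proof.
apply: (fin_length_ipow locR accM (k := j)); first exact: saddr.
by apply: sadd_le; [apply: scapl|apply: ipow_le].
Qed.

Lemma fin_fiber n : fin_length (fiber n) (F n).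
Proof. exact: (fin_H0gr_ipow n 1). Qed.

Lemma fin_H0gr n : fin_length (F n.+1) (Q n).
Proof.
by apply: (fin_length_sat locR accM) (@adicS_le_H0gr _ _ _ _ _) (@scapr _ _ _ _).
Qed.

Lemma graded_fiber : graded I (fun n => fiber n).
Proof.
have [_ HQ] := graded_H0gr m I M.
split=> n; first exact: fiber_le.
by rewrite imulD; apply: sadd_mono; [apply: HQ|rewrite imulC].
Qed.

Lemma amul_H0gr a n : I a -> amul a (Q n) <=: Q n.+1.
Proof.
by move=> Ia; case: (graded_H0gr m I M) => _ H; apply: sle_trans (H n); apply: amul_imul_le.
Qed.

Lemma fiber_growth e : dim_le (annq (szero M)) e.+2 ->
  exists c n0, forall n, (n0 <= n)%N -> (fiber_len n <= c * n.+1 ^ e)%N.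
Proof.
move=> dM; have [c1 [n0 Hc1]] := gr_growth locR Im accR t_distinct accM dM.
have gQ := graded_H0gr m I M.
(* As [Q n] is m-saturated in [F n], a single element of m is regular on all quotients F n / Q n. *)
have satQ n : F n &: sat m (Q n) <=: Q n.
  apply: scap_mono => //; apply: sle_trans (@sat_idem _ _ _ _ accM).
  by apply: sat_mono; apply: scapr.
have [x mx reg] := avoidable_exists locR t_distinct
  (avoidable_graded_regular accR accM gQ satQ).
pose W n j := ipow m j (F n) &: (amul x (F n) +: Q n).
have gW : bigraded I m W.
  split=> n j; first exact: scapl.
  - apply: scap_le.
      apply: sle_trans (imul_mono (@scapl _ _ _ _)) _.
      by rewrite imul_ipow.
    apply: sle_trans (imul_mono (@scapr _ _ _ _)) _.
    by rewrite imulD imul_amul; apply: sadd_mono => //; case: gQ.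
  - apply: scap_le; first by apply: imul_mono; apply: scapl.
    by apply: sle_trans (@imul_le _ _ _ _) _; apply: scapr.
have [c Hc] := bigraded_artin_rees accM (fg_ideal M I accR) (fg_ideal M m accR) gW.
(* Let C n = F n / Q n. As x is regular on C n, the lengths of (C / m^j C) / x and
   of the kernel of x on C / m^j C agree; by Artin-Rees this kernel lies in
   m^(j-c) C / m^j C, so that j |-> h n j grows at least linearly with slope
   proportional to fiber_len n. *)
pose h n j := len (Q n +: ipow m j (F n)) (F n).
have step n i : (fiber_len n + h n i <= h n (i + c.+1))%N.
  set j := (i + c.+1)%N; set L := Q n +: ipow m j (F n).
  pose Z := F n &: ainv x L.
  have LF : L <=: F n by apply: sadd_le; [apply: scapl|apply: ipow_le].
  have LZ : L <=: Z.
    by apply: scap_le => // y Ly; apply: submodZ.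
  have fL : fin_length L (F n) by apply: fin_H0gr_ipow.
  have fZ : fin_length Z (F n) by apply: fin_length_sub fL.
  have aZ : amul x Z <=: L by move=> _ [y [_ Hy] ->].
  have inj y : F n y -> L (x *: y) -> Z y by [].
  have [f1 l1] := len_amul_eq (@scapl _ _ _ _) aZ inj fZ.
  have E : (len L Z = len (L +: amul x (F n)) (F n))%N.
    have LxF : L +: amul x (F n) <=: F n by apply: sadd_le => //; apply: amul_le.
    have := len_add LZ (@scapl _ _ _ _) fL.
    rewrite (len_add (@saddl _ _ L (amul x (F n))) LxF fL) l1 addnC.
    by move=> /addIn ->.
  have ZL : Z <=: Q n +: ipow m i.+1 (F n).
    move=> z [Fz [q Qq Hw]].
    have : W n (c + i.+1)%N (x *: z - q).
      split; first by have -> : (c + i.+1 = j)%N by rewrite /j; lia.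
      apply: submodB; [apply: saddl; exact: mem_amul|exact: saddr].
    move=> /Hc Hxz.
    have [w [v Hv ->] Qw] : (amul x (ipow m i.+1 (F n)) +: Q n) (x *: z - q).
      rewrite -ipow_amul; apply: (_ : ipow m i.+1 (W n c) <=: _) => //.
      apply: sle_trans (ipow_mono (@scapr _ _ _ _)) _; rewrite ipowDr.
      by apply: sadd_mono; [apply: sle_refl|apply: ipow_le].
    have Fv : F n v by apply: ipow_le Hv.
    rewrite -(subrK v z); apply: mem_sadd => //; apply: reg; first exact: submodB.
    have -> : x *: (z - v) = x *: z - q - x *: v + q.
      by rewrite scalerBr [RHS]addrAC subrK.
    exact: submodD.
  rewrite {2}/h -/L (len_add LZ (@scapl _ _ _ _) fL) E; apply: leq_add.
    apply: len_sub => //; first 1 last.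
    - exact: fiber_le.
    - by apply: fin_length_sub fL => //; apply: saddl.
    - apply: sadd_le; last by apply: sle_trans (@saddr _ _ _ _); apply: amul_imul_le.
      by apply: sadd_mono => //; rewrite /j addnS; apply: imul_mono; apply: ipow_le.
  apply: len_sub => //; last by apply: sadd_le; [apply: scapl|apply: ipow_le].
  by apply: sle_trans ZL _; apply: sadd_mono => //; apply: ipow_anti.
have steps n k : (k * fiber_len n <= h n (k * c.+1))%N.
  elim: k => // k IH; rewrite !mulSn (addnC c.+1); apply: leq_trans (step n _).
  by rewrite leq_add2l.
(* After n + 1 steps of width c + 1, the length at j = (n+1)(c+1) is at least (n+1) [fiber_len n]
   and at most c1 ((n+1)(c+2))^(e+1). Dividing by n + 1 leaves the exponent [e] and this
   constant. *)
exists (c1 * c.+2 ^ e.+1)%N, n0 => n nn.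
rewrite -(leq_pmul2l (m := n.+1)) //; apply: leq_trans (steps n n.+1) _.
apply: leq_trans (_ : len (F n.+1 +: ipow m (n.+1 * c.+1) (F n)) (F n) <= _)%N.
  apply: len_sub => //; last exact: fin_gr.
  - by apply: sadd_mono => //; apply: adicS_le_H0gr.
  - by apply: sadd_le; [apply: scapl|apply: ipow_le].
apply: leq_trans (Hc1 n nn _) _.
have -> : (n + n.+1 * c.+1).+1 = (n.+1 * c.+2)%N by rewrite [RHS]mulnS addSn.
rewrite expnMn (expnS n.+1 e) -!mulnA (mulnCA c1) (mulnC (n.+1 ^ e)%N).
exact: leqnn.
Qed.

Section GeneralElement.
Variables (a : R) (Ia : I a).

(** In degree n + 1, the preimage in [F n.+1] of the m-torsion of gr_I M modulo the initial form of
    [a], or of the part killed by m^k when [p] is [Some k]. The value 0 in degree 0 only fills the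
    index without a predecessor. *)
Definition colon_pieces (p : option nat) n : submod M :=
  if n is n'.+1 then
    F n'.+1 &: (if p is Some k then cpow m k else sat m) (F n'.+2 +: amul a (F n'))
  else szero M.

Lemma imul_cpow (J J' : R -> Prop) k (A B : submod M) :
  imul J' A <=: B -> imul J' (cpow J k A) <=: cpow J k B.
Proof.
move=> AB; apply/ipow_cpow; rewrite -imul_ipow; apply: sle_trans AB.
by apply: imul_mono; apply/ipow_cpow.
Qed.

Lemma graded_colon_pieces p : graded I (colon_pieces p).
Proof.
split=> [[|n]|[|n]] //=; first by rewrite imul0.
apply: scap_le; first by apply: imul_mono; apply: scapl.
apply: sle_trans (imul_mono (@scapr _ _ _ _)) _.
have IA : imul I (F n.+2 +: amul a (F n)) <=: F n.+3 +: amul a (F n.+1).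
  by rewrite imulD imul_amul.
by case: p => [k|]; [apply: imul_cpow|apply: sat_imul].
Qed.

(* The Artin-Rees property of a bigraded family makes j uniform in n. *)
Lemma colon_ipow_cap : exists j, forall n,
  ipow m j (F n.+1) &: colon_pieces None n.+1 <=: F n.+2 +: amul a (F n).
Proof.
have [|p Hp] := graded_acc accM (fg_ideal M I accR) (fun k => graded_colon_pieces (Some k)).
  by move=> k [|n] //=; apply: scap_mono => //; apply: (cpow_incr (n := k.+1)).
have T_le n : colon_pieces None n.+1 <=: cpow m p (F n.+2 +: amul a (F n)).
  move=> x [Fx [k Hk]].
  have : colon_pieces (Some (p + k)%N) n.+1 x.
    by split=> //; apply: cpow_incr Hk; apply: leq_addl.
  by move=> /(Hp _ (leq_addr _ _)) [].
pose W n j := ipow m j (F n) &: colon_pieces None n.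
have gT := graded_colon_pieces None.
have gW : bigraded I m W.
  split=> n j; first exact: scapl.
  - apply: scap_le; last first.
      by apply: sle_trans (gT.2 n); apply: imul_mono; apply: scapr.
    apply: sle_trans (imul_mono (@scapl _ _ _ _)) _.
    by rewrite imul_ipow.
  - apply: scap_le; first by apply: imul_mono; apply: scapl.
    by apply: sle_trans (@imul_le _ _ _ _) _; apply: scapr.
have [c Hc] := bigraded_artin_rees accM (fg_ideal M I accR) (fg_ideal M m accR) gW.
exists (c + p)%N => n; apply: sle_trans (Hc n.+1 p) _; apply/ipow_cpow.
by apply: sle_trans (@scapr _ _ _ _) (T_le n).
Qed.

Hypothesis sup : exists n0, forall n, (n0 <= n)%N -> forall x,
  F n x -> F n.+2 (a *: x) -> F n.+1 x.
Hypothesis regQ : exists n0, forall n, (n0 <= n)%N -> forall x,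
  F n x -> Q n.+1 (a *: x) -> Q n x.
Hypothesis reg_fiber : exists n0, forall n, (n0 <= n)%N -> forall x,
  F n x -> fiber n.+1 (a *: x) -> fiber n x.

Variables (M' : lmodType R) (f : {linear M -> M'}).
Hypothesis f_surj : forall y, exists x, f x = y.
Hypothesis f_ker : sker f = amul a (sfull M).

(** Consider A <= B <= T with A = F_(n+2) + a F_n, B = Q_(n+1) + a F_n and T the m-saturation of A
    in F_(n+1). The length of T/A belongs to M/aM, that of B/A is the increase for M, and [eps] is
    that of T/B. *)
Lemma H0gr_recursion : exists C n0 : nat, forall n, (n0 <= n)%N -> exists eps : nat,
  (len (F n.+2) (Q n.+1) + eps =
     len (F n.+1) (Q n) + len (adic I M' n.+2) (H0gr m I M' n.+1))%N /\
  (eps + C * fiber_len n <= C * fiber_len n.+1)%N.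
Proof.
have [n1 Hn1] := superficial_cap accR accM Ia sup.
have [n2 Hn2] := sup; have [n3 Hn3] := regQ; have [n4 Hn4] := reg_fiber.
have [j Hj] := colon_ipow_cap; have [C HC] := len_ipow_le m accR M j.
exists C, (n1 + n2 + n3 + n4)%N => n nn.
have {}Hn1 := Hn1 n ltac:(lia); have {}Hn2 := Hn2 n ltac:(lia).
have {}Hn3 := Hn3 n ltac:(lia); have {}Hn4 := Hn4 n ltac:(lia).
set A := F n.+2 +: amul a (F n); set B := Q n.+1 +: amul a (F n).
set T := colon_pieces None n.+1.
have aF : amul a (F n) <=: F n.+1 by apply: amul_adic.
have AF : A <=: F n.+1 by apply: sadd_le => //; apply: adicS.
have AB : A <=: B by apply: sadd_mono => //; apply: adicS_le_H0gr.
have AT : A <=: T by apply: scap_le => //; apply: sat_ge.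
have BT : B <=: T.
  apply: sadd_le; first by apply: scap_mono => //; apply: sat_mono; apply: saddl.
  by apply: sle_trans AT; apply: saddr.
have TF : T <=: F n.+1 by apply: scapl.
have BF : B <=: F n.+1 by apply: sle_trans TF.
have fAT : fin_length A T.
  by apply: (fin_length_sat locR accM) => //; apply: scapr.
have ET : len (adic I M' n.+2) (H0gr m I M' n.+1) = len A T.
  rewrite (len_H0gr_quotient _ _ f_surj) f_ker Hn1; congr len.
  apply: submod_ext; last first.
    by apply: scap_mono => //; apply: sat_mono; apply: sadd_mono => //; apply: amul_mono.
  move=> x [Fx [k /cpow_mem Hk]]; split=> //; exists k; apply/cpow_mem.
  have : ipow m k (cyc x) <=: (F n.+2 +: amul a (sfull M)) &: F n.+1.
    apply: scap_le => //; apply: sle_trans (@ipow_le _ _ _ _ _) _; exact: cyc_le.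
  by rewrite smodular; [rewrite (scapC (amul a _)) Hn1|apply: adicS].
exists (len B T); rewrite ET (len_add AB BT fAT).
have -> : (len (F n.+2) (Q n.+1) = len (F n.+1) (Q n) + len A B)%N.
  (* By regularity of [a] on C, the trace of a F_n on Q_(n+1) is a Q_n. *)
  have -> : len A B = len (F n.+2 +: amul a (Q n)) (Q n.+1).
    have -> : B = Q n.+1 +: A by rewrite saddA (sadd_idr (@adicS_le_H0gr _ _ _ _ _)).
    have [_ ->] := len_diamond A (Q n.+1); congr len.
    rewrite scapC smodular; last exact: adicS_le_H0gr.
    congr (_ +: _); apply: submod_ext => [y [[x Fx ->] Qx]|].
      by apply: mem_amul; apply: Hn3.
    apply: scap_le; last exact: amul_H0gr.
    by apply: amul_mono; apply: scapl.
  have [||f1 <-] := len_amul_eq (a := a) (L' := F n.+2) (@adicS_le_H0gr _ m I _ n) _ _ (fin_H0gr n).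
  - exact: amul_adic.
  - by move=> x [Fx _]; apply: Hn2.
  by apply: len_add (fin_H0gr n.+1) => //; apply: sadd_le;
    [apply: adicS_le_H0gr|apply: amul_H0gr].
split; first lia.
have E1 : B +: imul m (F n.+1) = fiber n.+1 +: amul a (F n).
  by rewrite -!saddA (saddC (amul a _)).
have BmF : B +: imul m (F n.+1) <=: F n.+1 by apply: sadd_le => //; apply: imul_le.
have fB : fin_length (B +: imul m (F n.+1)) (F n.+1).
  by apply: (fin_length_ipow locR accM (k := 1)) => //; apply: saddr.
have [fBj lBj] := HC B (F n.+1) BF fB.
(* T meets m^j F_(n+1) inside A, so T/B embeds in F_(n+1) / (B + m^j F_(n+1)). This is bounded
   through the cokernel of [a] on C / mC, whose length is the increment of [fiber_len] since [a] is
   injective there. *)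
have [|_ lBT] := len_addV (V := ipow m j (F n.+1)) BT TF (@ipow_le _ _ _ _ _) _ fBj.
  by rewrite scapC; apply: sle_trans (Hj n) AB.
have [||f2 l2] := len_amul_eq (a := a) (L' := fiber n.+1) (@fiber_le n) _ _ (fin_fiber n).
- by rewrite amulD; apply: sadd_mono; [apply: amul_H0gr|apply: imulJ_amul; apply: amul_adic].
- exact: Hn4.
rewrite E1 in lBj BmF.
have := len_add (@saddl _ _ (fiber n.+1) (amul a (F n))) BmF (fin_fiber n.+1).
rewrite l2 => ->; rewrite mulnDr addnC leq_add2l.
exact: leq_trans lBj.
Qed.

End GeneralElement.

(** For large n, I^(n+1)M lies in aM and hence equals a I^n M. Filter M / a I^n M through I^n M and
    through aM: since aM / a I^n M is isomorphic to M / I^n M, the lengths of I^n M / I^(n+1)M and M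
    / aM agree. The former is entirely m-torsion. *)
Lemma len_regular_step (a : R) k : I a -> (forall x : M, a *: x = 0 -> x = 0) ->
  ipow m k (sfull M) <=: amul a (sfull M) ->
  (exists n0, forall n, (n0 <= n)%N -> forall x, F n x -> F n.+2 (a *: x) -> F n.+1 x) ->
  fin_length (amul a (sfull M)) (sfull M) /\
  exists n0, forall n, (n0 <= n)%N -> let e := len (amul a (sfull M)) (sfull M) in
    [/\ len (F n.+1) (Q n) = e, fin_length (F n) (sfull M) &
        len (F n) (sfull M) = (len (F n0) (sfull M) + (n - n0) * e)%N].
Proof.
move=> Ia reg mk sup; set e := len _ _.
have fa : fin_length (amul a (sfull M)) (sfull M).
  by apply: (fin_length_ipow locR accM) mk _.
split=> //; have [n1 Hn1] := superficial_cap accR accM Ia sup.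
have EF n : (n1 + k <= n)%N -> F n.+1 = amul a (F n).
  move=> nn; rewrite -Hn1; last lia.
  symmetry; apply: scap_idl; apply: sle_trans mk.
  apply: sle_trans (ipow_anti (m := k) _) _; first lia.
  rewrite /adic; elim: (k) => //= i IH; apply: sle_trans (imul_mono IH) _.
  exact: imul_monol.
have mF n : ipow m (n * k) (sfull M) <=: F n.
  elim: n => // n IH; rewrite mulSn addnC ipowD.
  apply: sle_trans (ipow_mono mk) _; rewrite ipow_amul.
  by apply: sle_trans (amul_mono IH) _; apply: amul_adic.
have fF n : fin_length (F n) (sfull M) by apply: (fin_length_ipow locR accM) (mF n) _.
have step n : (n1 + k <= n)%N -> len (F n.+1) (F n) = e.
  move=> nn; have lt1 := len_add (@adicS _ _ _ n) (@sle_full _ _ _) (fF n.+1).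
  have FaM : F n.+1 <=: amul a (sfull M) by rewrite EF //; apply: amul_mono.
  have lt2 := len_add FaM (@sle_full _ _ _) (fF n.+1).
  have [||_ l3] := len_amul_eq (a := a) (L' := F n.+1) (@sle_full _ _ (F n)) _ _ (fF n).
  - exact: amul_adic.
  - move=> x _; rewrite EF // => -[y Fy E]; rewrite -(subrK y x).
    have /reg -> : a *: (x - y) = 0 by rewrite scalerBr E subrr.
    by rewrite add0r.
  rewrite (sadd_idl FaM) in l3; rewrite /e; lia.
exists (n1 + k)%N => n nn; split=> //.
  have -> : Q n = F n; last exact: step.
  apply: scap_idl => x Fx; exists (n.+1 * k)%N; apply/cpow_mem.
  by apply: sle_trans (ipow_mono (@sle_full _ _ _)) (mF _).
move: nn => /subnKC <-; rewrite addKn; elim: (n - _)%N => [|i IH].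
  by rewrite addn0 mul0n addn0.
rewrite addnS (len_add (@adicS _ _ _ (n1 + k + i)%N) (@sle_full _ _ _) (fF _)) IH.
by rewrite step ?leq_addr // mulSn; lia.
Qed.

End Recursion.

(** * General elements *)

Section Zariski.
Variables (R : comNzRingType) (mm II : idealr R).
Local Notation m := (submod_of (idl mm) : ideal R).
Local Notation I := (submod_of (idl II) : ideal R).
Local Notation k := {ideal_quot mm}.
Hypothesis locR : local_at m.
Hypothesis accR : noetherian_mod (R^o : lmodType R).
Variable t : nat -> R.
Hypothesis t_distinct : forall i j : nat, i != j -> ~ m (t i - t j).

Lemma cotm_ker (x : subm (idl II)) :
  \pi_(cotm mm II)%qT x = 0 -> imul m (I : submod R^o) (val x).
Proof.
move=> E; have : sker (quo_proj (mulm (idl mm) (fullm (subm (idl II))))) x by exact: E.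
rewrite quo_proj_ker => /asboolP Hx.
pose N := spre (val : {linear subm (idl II) -> R^o}) (imul m (I : submod R^o)).
have /submod_predP // : x \in submod_pred N.
apply: Hx => _ [a [y [am _ ->]]]; apply/submod_predP.
change (imul m (I : submod R^o) (val ((a : R) *: y))).
rewrite linearZ; apply: mem_imul => //.
exact: valP.
Qed.

Lemma pi_k_eq0 (s : R) : \pi_k%qT s = 0 <-> m s.
Proof.
have -> : 0 = \pi_k%qT (0 : R) by rewrite -(rmorph0 (\pi_k%qT : {rmorphism R -> k})).
split; last first.
  by move=> ms; apply/eqP; rewrite -Quotient.idealrBE subr0.
by move=> /eqP; rewrite -Quotient.idealrBE subr0.
Qed.

(** Preimages in I of the hyperplanes of I/mI: by the last clause any class outside H spans I/H. *)
Definition hyperplane (H : ideal R) :=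
  [/\ imul m (I : submod R^o) <=: H, H <=: I, ~ I <=: H &
      forall u, I u -> ~ H u -> forall r, I r -> exists s, H (r - s * u)].

(** By Nakayama, mI plus the trace of H on I is still proper in I; a maximal proper submodule above
    it is a hyperplane. *)
Lemma hyperplane_exists (H : ideal R) : ~ I <=: H -> exists H' : ideal R,
  hyperplane H' /\ forall r, I r -> H r -> H' r.
Proof.
move=> IH; pose C (B : ideal R) := [/\ H &: I <=: B,
  imul m (I : submod R^o) <=: B, B <=: I & ~ I <=: B].
have C0 : C (H &: I +: imul m (I : submod R^o)).
  split; [exact: saddl|exact: saddr| |].
    by apply: sadd_le; [apply: scapr|apply: imul_le].
  by move=> /(nakayama locR accR) H'; apply: IH; apply: sle_trans H' _; apply: scapl.
have [B [_ [HB mB BI nB] mx]] := acc_maximal accR (P := C) Logic.I C0.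
exists B; split; last by move=> r Ir Hr; apply: HB.
split=> // u Iu nBu r Ir.
have IBu : I <=: B +: cyc (u : R^o).
  apply: contrapT => nI; apply: nBu; apply: (mx (B +: cyc (u : R^o))) => //.
    split=> //.
    - by apply: sle_trans HB _.
    - by apply: sle_trans mB _.
    - by apply: sadd_le => //; apply: cyc_le.
  by apply: saddr; apply: mem_cyc.
have [b Bb [s Es]] := IBu r Ir; exists s.
by rewrite -[s * u]/(s *: (u : R^o)) -Es opprB addrC subrK.
Qed.

(** Fix [u] in I outside H. The form sends a class to the coefficient s, modulo m, such that a
    representative is s u modulo H. It is unique modulo m because no unit multiple of [u] lies in H,
    and independent of the representative because H contains mI. *)
Lemma hyperplane_form (H : ideal R) : hyperplane H -> exists f : cotm mm II -> k,
  [/\ forall x y, f (x + y) = f x + f y,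
      forall a x, f (a *: x) = \pi_k%qT a * f x &
      forall x : subm (idl II), f (\pi_(cotm mm II)%qT x) = 0 <-> H (val x)].
Proof.
move=> [mH HI nIH split_u].
have [u Iu nHu] : exists2 u, I u & ~ H u.
  apply: contrapT => no; apply: nIH => u Iu; apply: contrapT => nHu.
  by apply: no; exists u.
have coef (v : cotm mm II) : exists s : R, H (val (repr v) - s * u).
  by apply: split_u => //; apply: valP.
pose c v := sval (cid (coef v)).
have cP v : H (val (repr v) - c v * u) by rewrite /c; case: cid.
have uniq_c (s : R) : H (s * u) -> m s.
  move=> Hsu; apply: contrapT => /locR.2 [s' Es]; apply: nHu.
  by rewrite -[u]mul1r -Es -mulrA; apply: (submodZ (A := H)).
have reprH (v : cotm mm II) x : \pi_(cotm mm II)%qT x = v -> H (val (repr v) - val x).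
  move=> E; rewrite -raddfB; apply: mH; apply: cotm_ker.
  change (quo_proj (mulm (idl mm) (fullm (subm (idl II)))) (repr v - x) = 0).
  by rewrite raddfB /= /quo_proj E reprK subrr.
have cE v x s : \pi_(cotm mm II)%qT x = v -> H (val x - s * u) -> m (c v - s).
  move=> E Hx; apply: uniq_c; rewrite mulrBl.
  have aux (A B C D : R) : B - D = - (A - B) + (A - C) + (C - D) by ring.
  rewrite (aux (val (repr v)) _ (val x)).
  apply: (submodD (A := H)) => //; apply: (submodD (A := H)); last exact: reprH.
  exact: (submodN (A := H) (cP v)).
have piE (s s' : R) : m (s - s') -> \pi_k%qT s = \pi_k%qT s'.
  by move=> ms; apply/eqP; rewrite -Quotient.idealrBE.
exists (fun v => \pi_k%qT (c v)); split.
- move=> x y; rewrite -(rmorphD (\pi_k%qT : {rmorphism R -> k})); apply: piE.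
  apply: (cE _ (repr x + repr y)).
    by rewrite pi_addr !reprK.
  rewrite raddfD /= mulrDl opprD addrACA; apply: (submodD (A := H)); exact: cP.
- move=> a x; rewrite -(rmorphM (\pi_k%qT : {rmorphism R -> k})); apply: piE.
  apply: (cE _ (a *: repr x)).
    by rewrite pi_scaleq reprK.
  rewrite linearZ /= -mulrA -[a *: val _]/(a * val (repr x)) -mulrBr.
  by apply: (submodZ (A := H)); apply: cP.
- move=> x; split; last first.
    move=> Hx; apply/pi_k_eq0; rewrite -[c _]subr0; apply: (cE _ x) => //.
    by rewrite mul0r subr0.
  move=> /pi_k_eq0 mc.
  have := reprH _ x erefl; have := cP (\pi_(cotm mm II)%qT x).
  set v := \pi_(cotm mm II)%qT x in mc * => H1 H2.
  have aux (A B C : R) : C = (A - B) - (A - C) + B by ring.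
  rewrite (aux (val (repr v)) (c v * u) (val x)).
  apply: (submodD (A := H)); first exact: (submodB (A := H)).
  by apply: mH; apply: (mem_imul (M := R^o)).
Qed.

Lemma k_neq0_mul (x y : k) : x <> 0 -> y <> 0 -> x * y <> 0.
Proof.
rewrite -[x]reprK -[y]reprK -(rmorphM (\pi_k%qT : {rmorphism R -> k})).
move=> nx ny /pi_k_eq0 mxy.
have nmx : ~ m (repr x) by move=> /pi_k_eq0.
have [s Es] := locR.2 _ nmx; apply: ny; apply/pi_k_eq0.
by rewrite -[repr y]mul1r -Es -mulrA; apply: (submodZ (A := m)).
Qed.

(** [g] is the product of the linear forms of hyperplanes [Ks] containing the traces of [Hs] on I.
    As the residue ring has no zero divisors, [g] is nonzero exactly where all of [Ks] are
    avoided. *)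
Lemma avoiding_polyfun (Hs : seq (ideal R)) : (forall H, List.In H Hs -> ~ I <=: H) ->
  exists (g : cotm mm II -> k) (Ks : seq (ideal R)), [/\ polyfun g,
    forall K, List.In K Ks -> ~ I <=: K,
    forall x : subm (idl II), g (\pi_(cotm mm II)%qT x) <> 0 <->
      (forall K, List.In K Ks -> ~ K (val x)) &
    forall r, I r -> (forall K, List.In K Ks -> ~ K r) ->
      forall H, List.In H Hs -> ~ H r].
Proof.
elim: Hs => [|H Hs IH] H1.
  exists (fun=> 1), [::]; split=> //; first exact: polyfun_cst.
  by move=> x; split=> // _; apply/eqP; apply: oner_neq0.
have [|g [Ks [pg HKs gE KH]]] := IH; first by move=> L HL; apply: H1; right.
have [|H' [hypH' HH']] := @hyperplane_exists H; first by apply: H1; left.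
have [f [fD fZ f0]] := hyperplane_form hypH'.
exists (fun v => f v * g v), (H' :: Ks); split.
- by apply: polyfun_mul => //; apply: polyfun_lin.
- by move=> K [<-|/HKs //]; case: hypH'.
- move=> x; split.
    move=> fg K [<- Hx|KKs].
      by apply: fg; rewrite (f0 x).2 // mul0r.
    by apply: (gE x).1 => // g0; apply: fg; rewrite g0 mulr0.
  move=> HK; apply: k_neq0_mul.
    by move=> /f0; apply: HK; left.
  by apply/gE => K KKs; apply: HK; right.
- move=> r Ir HK L [<-|LHs]; last first.
    by apply: (KH r) => // K KKs; apply: HK; right.
  by move=> /(HH' _ Ir); apply: HK; left.
Qed.

Lemma general_step (P : R -> Prop) : avoidable I P ->
  exists U : set (cotm mm II), [/\ zariski_open mm U, (U !=set0)%classic &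
    forall a : subm (idl II), U (\pi_(quom _)%qT a) -> P (val a)].
Proof.
move=> [Hs [H1 H2]]; have [g [Ks [pg HKs gE KH]]] := avoiding_polyfun H1.
have [a Ia Ha] : exists2 a, I a & forall K, List.In K Ks -> ~ K a.
  by apply: (avoidable_exists locR t_distinct); exists Ks.
exists [set v | g v <> 0]%classic; split.
- exists [set g]%classic; first by move=> _ ->.
  apply/seteqP; split=> v /=.
    by move=> /contrapT E f ->.
  by move=> E; apply; apply: E.
- exists (\pi_(cotm mm II)%qT (Sub a Ia : subm (idl II))).
  by apply/gE; rewrite SubK.
- move=> x /gE Ux; apply: H2; first exact: valP.
  by apply: KH => //; apply: valP.
Qed.

End Zariski.

(** * Limits of integer sequences of polynomial growth *)

Section Limits.
Variable K : realType.
Import numFieldNormedType.Exports.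
Local Open Scope classical_set_scope.

Lemma stolz_cesaro (a b : nat -> K) (l : K) : 0 <= b 0%N -> (forall n, b n < b n.+1) ->
  b @ \oo --> +oo -> (a n.+1 - a n) / (b n.+1 - b n) @[n --> \oo] --> l ->
  a n / b n @[n --> \oo] --> l.
Proof.
move=> b0 b_incr b_oo ab; apply/cvgrPdist_le => e e0.
have b_mono i n : (i <= n)%N -> b i <= b n.
  move=> /subnK <-; elim: (n - i)%N => // j IH.
  by apply: le_trans IH _; apply: ltW.
have b_ge0 n : 0 <= b n by apply: le_trans b0 _; apply: b_mono.
have e20 : 0 < e / 2 by rewrite divr_gt0.
have /cvgrPdist_le /(_ _ e20) [N _ HN] := ab.
pose u n := a n - l * b n.
have step n : (N <= n)%N -> `|u n.+1 - u n| <= e / 2 * (b n.+1 - b n).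
  move=> Nn; have db : 0 < b n.+1 - b n by rewrite subr_gt0.
  have := HN n Nn; rewrite -(ler_pM2r db) /=; apply: le_trans.
  rewrite -{2}(gtr0_norm db) -normrM mulrBl divfK ?gt_eqF // distrC.
  by rewrite le_eqVlt; apply/orP; left; apply/eqP; congr `|_|; rewrite /u; ring.
have bound n : (N <= n)%N -> `|u n| <= `|u N| + e / 2 * (b n - b N).
  move=> /subnK <-; elim: (n - N)%N => [|j IH].
    by rewrite subrr mulr0 addr0.
  rewrite addSn; have := step (j + N)%N (leq_addl _ _).
  have := ler_normD (u (j + N).+1 - u (j + N)%N) (u (j + N)%N); rewrite subrK.
  set x := `|u (j + N).+1|; set y := `|_ - _|; set z := `|u (j + N)%N| in IH *.
  lra.
(* Beyond this threshold the initial error |u N| is at most (e/2) b n; the summand 1 makes [b n]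
   positive. *)
have /cvgryPge /(_ (2 * `|u N| / e + 1)) [N' _ HN'] := b_oo.
exists (N + N')%N => // n /= nn; have bn := HN' n (leq_trans (leq_addl _ _) nn).
have un : 0 <= 2 * `|u N| / e by rewrite divr_ge0 ?mulr_ge0 // ltW.
have bn0 : 0 < b n by apply: lt_le_trans bn; rewrite ltr_wpDl.
have -> : l - a n / b n = - (u n / b n).
  by rewrite /u mulrBl mulfK ?gt_eqF // opprB.
rewrite normrN normrM normfV (gtr0_norm bn0) ler_pdivrMr //.
apply: le_trans (bound n (leq_trans (leq_addr _ _) nn)) _.
have : 2 * `|u N| <= e * b n.
  have : 2 * `|u N| / e <= b n by apply: le_trans bn; rewrite lerDl.
  by rewrite ler_pdivrMr // (mulrC e).
have : e / 2 * b N >= 0 by rewrite mulr_ge0 // ltW.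
lra.
Qed.

Lemma cvg_succ_ratio : (n%:R / n.+1%:R : K) @[n --> \oo] --> (1 : K).
Proof.
have -> : (fun n => n%:R / n.+1%:R : K) = (fun n => 1 - harmonic n).
  apply/funext => n; rewrite /harmonic -[in LHS](addrK 1 n%:R) natr1 mulrBl.
  by rewrite divff ?pnatr_eq0 // mul1r.
rewrite -[X in _ --> X]subr0; apply: cvgB; [exact: cvg_cst|exact: cvg_harmonic].
Qed.

(** By the factorisation of a difference of powers, the quotient is the sum of the x^i for i <= p at
    x = n/(n+1), and this polynomial takes the value p + 1 at 1. *)
Lemma cvg_power_step p :
  ((n.+1%:R ^+ p.+1 - n%:R ^+ p.+1) / n.+1%:R ^+ p : K) @[n --> \oo] --> (p.+1%:R : K).
Proof.
pose P : {poly K} := \sum_(i < p.+1) 'X^i.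
have P1 : P.[1] = p.+1%:R.
  rewrite /P horner_sum (eq_bigr (fun=> 1)) ?sumr_const ?card_ord //.
  by move=> i _; rewrite hornerXn expr1n.
have E : (fun n => (n.+1%:R ^+ p.+1 - n%:R ^+ p.+1) / n.+1%:R ^+ p : K) =
         (fun n => P.[n%:R / n.+1%:R]).
  apply/funext => n; rewrite subrXX -natr1 addrAC subrr add0r mul1r.
  rewrite /P horner_sum mulr_suml; apply: eq_bigr => i _.
  have n0 : n%:R + 1 != 0 :> K by rewrite natr1 pnatr_eq0.
  have ip : (i <= p)%N by rewrite -ltnS.
  have -> : (n%:R + 1) ^+ p = (n%:R + 1) ^+ (p - i) * (n%:R + 1) ^+ i :> K.
    by rewrite -exprD subnK.
  rewrite hornerXn expr_div_n invfM mulrACA mulfV ?mul1r //.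
rewrite E -P1; apply: continuous_cvg; last exact: cvg_succ_ratio.
exact: continuous_horner.
Qed.

(** Adding the accumulated errors [s] to [u] makes the recursion exact, so Stolz-Cesaro applies to u
    + s. The errors telescope to s n <= C g n, of order n^p, and vanish against n^(p+1). *)
Lemma cvg_recursion p (u v g : nat -> nat) (C c n0 : nat) (l : K) :
  (forall n, (n0 <= n)%N -> exists eps : nat,
     (u n.+1 + eps = u n + v n.+1)%N /\ (eps + C * g n <= C * g n.+1)%N) ->
  (forall n, (n0 <= n)%N -> (g n <= c * n.+1 ^ p)%N) ->
  (p`!%:R * (v n)%:R / n%:R ^+ p : K) @[n --> \oo] --> l ->
  (p.+1`!%:R * (u n)%:R / n%:R ^+ p.+1 : K) @[n --> \oo] --> l.
Proof.
move=> rec gb vl.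
pose s n := (\sum_(n0 <= i < n) (u i + v i.+1 - u i.+1))%N.
have sS n : (n0 <= n)%N -> (u n.+1 + s n.+1 = u n + s n + v n.+1)%N.
  move=> nn; rewrite /s big_nat_recr //=.
  by have [eps [E _]] := rec n nn; rewrite -E addKn; lia.
have sb n : (n0 <= n)%N -> (s n <= C * g n)%N.
  move=> nn; suff : (s n + C * g n0 <= C * g n)%N by lia.
  move: nn => /subnKC <-; elim: (n - n0)%N => [|i IH].
    by rewrite addn0 /s big_geq.
  have [|eps [E H]] := rec (n0 + i)%N; first exact: leq_addr.
  by rewrite addnS /s big_nat_recr ?leq_addr //= -E addKn -/(s _); lia.
have pow_oo : (n%:R ^+ p.+1 : K) @[n --> \oo] --> +oo.
  apply/cvgryPge => A; have /cvgryPge /(_ (Num.max A 1)) [N _ HN] := @cvgr_idn K.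
  exists N => // n /= /HN; rewrite /= ge_max => /andP[An n1].
  by apply: le_trans An _; rewrite exprS ler_peMr ?ler0n // exprn_ege1.
have H1 : (p.+1`!%:R * (u n + s n)%:R / n%:R ^+ p.+1 : K) @[n --> \oo] --> l.
  apply: (@stolz_cesaro (fun n => p.+1`!%:R * (u n + s n)%:R) (fun n => n%:R ^+ p.+1)) => //.
    by move=> n; rewrite ltrXn2r // ltr_nat.
  have p0 : p.+1%:R != 0 :> K by rewrite pnatr_eq0.
  have -> : l = p.+1%:R * l / p.+1%:R by rewrite mulrAC divff // mul1r.
  have vl' : (p`!%:R * (v n.+1)%:R / n.+1%:R ^+ p : K) @[n --> \oo] --> l.
    by move: vl; rewrite -(@cvg_shiftS K (fun n => p`!%:R * (v n)%:R / n%:R ^+ p)).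
  apply: cvg_trans (cvgM (cvgM (cvg_cst (p.+1%:R : K)) vl') (cvgV p0 (@cvg_power_step p))).
  apply: near_eq_cvg; exists n0 => // n /= nn.
  have np : n.+1%:R ^+ p != 0 :> K by rewrite expf_neq0 // pnatr_eq0.
  have bp : n.+1%:R ^+ p.+1 - n%:R ^+ p.+1 != 0 :> K.
    by rewrite subr_eq0 gt_eqF // ltrXn2r // ltr_nat.
  rewrite -mulrBr sS // (natrD _ (u n + s n)%N) addrAC subrr add0r factS natrM.
  rewrite invf_div -!mulrA; congr (_ * (_ * (_ * _))).
  by rewrite mulrA mulVf // mul1r.
have H2 : (p.+1`!%:R * (s n)%:R / n%:R ^+ p.+1 : K) @[n --> \oo] --> (0 : K).
  (* The factor 2^p comes from (n+1)^p <= (2n)^p for n >= 1. *)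
  pose D : K := p.+1`!%:R * (C * (c * 2 ^ p))%:R.
  apply: (@squeeze_cvgr _ _ _ _ (fun=> 0) (fun n => D * (n%:R)^-1)).
  - exists (n0 + 1)%N => // n /= nn; have n_gt0 : (0 < n)%N by lia.
    have n0' : 0 < n%:R :> K by rewrite ltr0n.
    apply/andP; split; first by rewrite !mulr_ge0 ?invr_ge0 ?exprn_ge0.
    rewrite /D -!mulrA ler_pM2l ?ltr0n ?fact_gt0 //.
    rewrite ler_pdivrMr ?exprn_gt0 // exprS mulrA divfK ?gt_eqF // -natrX -natrM ler_nat.
    apply: leq_trans (sb n _) _; first lia.
    rewrite -!mulnA leq_mul2l; apply/orP; right.
    apply: leq_trans (gb n _) _; first lia.
    rewrite leq_mul2l -expnMn; apply/orP; right; apply: expn_monol; lia.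
  - exact: cvg_cst.
  - rewrite -[X in _ --> X](mulr0 D); apply: cvgM; first exact: cvg_cst.
    apply/gtr0_cvgV0; last exact: cvgr_idn.
    by exists 1%N => // n /=; rewrite ltr0n.
rewrite -[l]subr0; apply: cvg_trans (cvgB H1 H2); apply: near_eq_cvg.
near=> n; transitivity (p.+1`!%:R * (u n + s n)%:R / n%:R ^+ p.+1
  - p.+1`!%:R * (s n)%:R / n%:R ^+ p.+1 : K); first by [].
by rewrite -mulrBl -mulrBr natrD addrK.
Unshelve. all: by end_near.
Qed.

End Limits.

(** * The multiplicity formula *)

Lemma spre_amul (R : comNzRingType) (M M' : lmodType R) (f : {linear M -> M'}) (a : R)
    (B : submod M') : (forall y, exists x, f x = y) ->
  spre f (amul a B) = amul a (spre f B) +: sker f.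
Proof.
move=> f_surj; apply: submod_ext.
  move=> x [y By E]; have [z Ez] := f_surj y; exists (a *: z).
    by apply: mem_amul; change (B (f z)); rewrite Ez.
  by change (f (x - a *: z) = 0); rewrite linearB linearZ /= Ez E subrr.
apply: sadd_le; last exact: sker_le.
by move=> _ [x Bx ->]; exists (f x) => //; rewrite linearZ.
Qed.

Lemma general_mono (R : comNzRingType) (mm II : idealr R) d (P Q : seq R -> Prop) :
  (forall s, P s -> Q s) -> general mm II d P -> general mm II d Q.
Proof.
elim: d P Q => [|d IH] P Q PQ /=; first exact: PQ.
move=> [U [oU nU HU]]; exists U; split=> // a /HU.
by apply: IH => s; apply: PQ.
Qed.

Section Main.
Variables (K : realType) (R : comNzRingType) (mm II : idealr R).
Local Notation m := (submod_of (idl mm) : ideal R).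
Local Notation I := (submod_of (idl II) : ideal R).
Hypotheses (locR : local_at m) (Im : I <=: m).
Hypothesis accR : noetherian_mod (R^o : lmodType R).
Variable t : nat -> R.
Hypothesis t_distinct : forall i j : nat, i != j -> ~ m (t i - t j).
Import numFieldNormedType.Exports.
Local Open Scope classical_set_scope.

Definition gen_sat (M : lmodType R) (s : seq R) : submod M :=
  sat I (imul (fun r => r \in s) (sfull M)).

Definition len_H0gr (M : lmodType R) n := len (adic I M n.+1) (H0gr m I M n).

(** Besides the length modulo the last element, this keeps what the multiplicity of N = M/X needs: N
    is 0 or has dimension exactly 1, and the length of N / I^n N is eventually affine in n with
    slope [e]. *)
Definition general_formula (M : lmodType R) p e (a : seq R) :=
  let X := gen_sat M (take p a) in
  [/\ fin_length (X +: imul I (sfull M)) (sfull M),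
      sfull M <=: X \/ (dim_le (annq X) 1 /\ exists q, primes_chain (annq X) 1 q),
      exists n0, forall n, (n0 <= n)%N -> fin_length (X +: adic I M n) (sfull M) /\
        len (X +: adic I M n) (sfull M) =
          (len (X +: adic I M n0) (sfull M) + (n - n0) * e)%N,
      fin_length (X +: amul (nth 0 a p) (sfull M)) (sfull M) &
      len (X +: amul (nth 0 a p) (sfull M)) (sfull M) = e].

(** Two indices are allowed so as to serve both passages: modulo torsion they agree, modulo the
    first element they differ by one. *)
Lemma general_formula_spre (M M' : lmodType R) (f : {linear M -> M'}) p p' e a a' :
  (forall y, exists x, f x = y) ->
  spre f (gen_sat M' (take p' a')) = gen_sat M (take p a) ->
  nth 0 a' p' = nth 0 a p -> general_formula M' p' e a' -> general_formula M p e a.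
Proof.
move=> f_surj EX En [H1 H2 [n0 H3] H4 H5].
set X := gen_sat M _ in EX *; set X' := gen_sat M' _ in EX H1 H2 H3 H4 H5.
have kX : sker f <=: X by rewrite -EX; apply: sker_le.
have E (A : submod M) (B : submod M') : spre f B = A +: sker f ->
    (fin_length (X' +: B) (sfull M') <-> fin_length (X +: A) (sfull M)) /\
    len (X' +: B) (sfull M') = len (X +: A) (sfull M).
  move=> EB; have [H ->] := len_spre f_surj (@sle_full _ _ (X' +: B)).
  rewrite H spre_full spre_add // EB EX (saddC A) saddA.
  by rewrite (sadd_idr kX).
have Ea n := E _ _ (spre_adic I f_surj n).
rewrite /general_formula -/X; split.
- apply: (E _ _ _).1.1 H1.
  by rewrite spre_imul // spre_full.
- case: H2 => [H2|[H2 H2']].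
    by left; rewrite -EX => x _; apply: H2.
  by right; rewrite -EX annq_spre.
- exists n0 => n nn; have [G1 G2] := H3 n nn; split; first by apply/(Ea n).1.
  by rewrite -!(Ea _).2.
- apply: (E _ _ _).1.1 H4.
  by rewrite spre_amul // spre_full En.
- have [|_ <-] := E (amul (nth 0 a p) (sfull M)) (amul (nth 0 a' p') (sfull M')).
    by rewrite spre_amul // spre_full En.
  exact: H5.
Qed.

Lemma cvg_len_shift (u v : nat -> nat) d (l : K) n0 :
  (forall n, (n0 <= n)%N -> u n = v n) ->
  (d`!%:R * (v n)%:R / n%:R ^+ d : K) @[n --> \oo] --> l ->
  (d`!%:R * (u n)%:R / n%:R ^+ d : K) @[n --> \oo] --> l.
Proof.
move=> uv vl; apply: cvg_trans vl; apply: near_eq_cvg.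
by exists n0 => // n /= /uv ->.
Qed.

(** The value [e] precedes the choice of the general elements, so it is common to all of them. *)
Definition jmult_formula (M : lmodType R) d := exists e : nat,
  (d`!%:R * (len_H0gr M n)%:R / n%:R ^+ d : K) @[n --> \oo] --> (e%:R : K) /\
  general mm II d.+1 (general_formula M d e).

Lemma jmult_formula_torsion (M M' : lmodType R) (f : {linear M -> M'}) d :
  noetherian_mod M -> (forall y, exists x, f x = y) -> sker f = sat I (szero M) ->
  jmult_formula M' d -> jmult_formula M d.
Proof.
move=> accM f_surj Ef [e [lim gen]]; exists e; split.
  have [n0 Hn0] := adic_cap_torsion I accR accM.
  apply: (cvg_len_shift (n0 := n0)) lim => n nn.
  rewrite /len_H0gr (len_H0gr_quotient m _ f_surj) Ef Hn0 //.
  rewrite (sadd_idr (szero_le _)); congr len.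
  apply: submod_ext; first by apply: scap_mono => //; apply: sat_mono; apply: saddl.
  move=> x [Fx [k /cpow_mem Hk]]; split=> //; exists k; apply/cpow_mem.
  (* This intersection is I^(n+1)M, because the torsion does not meet I^n M. *)
  have : ipow m k (cyc x) <=: (adic I M n.+1 +: sat I (szero M)) &: adic I M n.
    apply: scap_le => //; apply: sle_trans (@ipow_le _ _ _ _ _) _; exact: cyc_le.
  rewrite smodular; last exact: adicS.
  by rewrite (scapC (sat _ _)) Hn0 // (sadd_idr (szero_le _)).
apply: general_mono gen => a; apply: general_formula_spre => //.
rewrite spre_sat // spre_imul // spre_full Ef; apply: submod_ext; last first.
  by apply: sat_mono; apply: saddl.
apply: sle_trans (@sat_idem _ _ _ _ accM); apply: sat_mono; apply: sadd_le.
  exact: sat_ge.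
by apply: sat_mono; apply: szero_le.
Qed.

Lemma jmult_formula_dim1 (M : lmodType R) : noetherian_mod M -> torsion_free I M ->
  dim_le (annq (szero M)) 1 -> jmult_formula M 0.
Proof.
move=> accM tf dM.
pose P (a : R) := (forall x : M, a *: x = 0 -> x = 0) /\
  exists n0, forall n, (n0 <= n)%N -> forall x,
    adic I M n x -> adic I M n.+2 (a *: x) -> adic I M n.+1 x.
have avP : avoidable I P := avoidable_and (avoidable_regular accR accM tf)
  (avoidable_filter_regular accR accM (graded_adicS I M)).
have HP a : I a -> P a -> fin_length (amul a (sfull M)) (sfull M) /\
  exists n0, forall n, (n0 <= n)%N -> let e := len (amul a (sfull M)) (sfull M) in
    [/\ len_H0gr M n = e, fin_length (adic I M n) (sfull M) &
        len (adic I M n) (sfull M) = (len (adic I M n0) (sfull M) + (n - n0) * e)%N].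
  move=> Ia [reg sup].
  have dA : dim_le (annq (amul a (sfull M))) 0.
    apply: (dim_le_drop accR (A := annq (szero M)) (x := a)) dM.
    - by move=> r Hr x; rewrite Hr; apply: submod0.
    - by move=> x; apply: mem_amul.
    - exact: annq_regular.
  have [k Hk] := dim0_mod accR locR t_distinct dA.
  exact: (len_regular_step locR Im accR accM Ia reg Hk sup).
have [a0 Ia0 Pa0] := avoidable_exists locR t_distinct avP.
pose e := len (amul a0 (sfull M)) (sfull M).
have [_ [n0 H0]] := HP _ Ia0 Pa0.
have X0 s : gen_sat M (take 0 s) = szero M.
  rewrite take0; apply: submod_ext => //; apply: sle_trans tf; apply: sat_mono.
  by apply/imul_leP.
exists e; split.
  apply: (cvg_len_shift (v := fun=> e) (n0 := n0)); first by move=> n /H0 [].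
  under eq_fun => n do rewrite fact0 mul1r expr0 divr1.
  exact: cvg_cst.
have [U [oU nU HU]] := general_step locR accR t_distinct avP.
exists U; split=> // a /HU Pa; set b : R := val a in Pa *.
have Ib : I b by exact: (valP a).
have [fb [n1 H1]] := HP b Ib Pa.
(* Both lengths are the eventual value of [len_H0gr M], which involves neither element. *)
have eb : len (amul b (sfull M)) (sfull M) = e.
  have [<- _ _] := H1 (n0 + n1)%N (leq_addl _ _).
  by have [] := H0 (n0 + n1)%N (leq_addr _ _).
rewrite /= /general_formula X0 /=.
have Z (A : submod M) : szero M +: A = A by apply: sadd_idl.
rewrite !Z; split=> //.
- have [_ f _] := H1 n1.+1 (leqnSn _).
  by apply: fin_length_sub f => //; apply: (adic_anti (i := 1)).
- have [|nM] := EM (sfull M <=: szero M); first by left.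
  (* A nonzero M has a prime over its annihilator that misses the regular element [b] of m; followed
     by m it gives a chain of length 1. *)
  right; split=> //.
  have [||Q [pQ AQ nQb]] := @regular_prime _ accR (annq (szero M)) b.
  - by move=> H; apply: nM => x _; rewrite -[x]scale1r; apply: H.
  - by apply: annq_regular; case: Pa.
  by apply: (chain1 locR AQ pQ) => /(_ b (Im Ib)).
- by exists n1 => n nn; have [_ f E] := H1 n nn; rewrite !Z -eb.
Qed.

Lemma jmult_formula_step (M : lmodType R) d : noetherian_mod M -> torsion_free I M ->
  dim_le (annq (szero M)) d.+2 ->
  (forall M' : lmodType R, noetherian_mod M' -> dim_le (annq (szero M')) d.+1 ->
     jmult_formula M' d) ->
  jmult_formula M d.+1.
Proof.
move=> accM tf dM IH.
(* In order: regular on M, then injective in large degrees on G, on C and on C / mC. *)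
pose P (a : R) := [/\ forall x : M, a *: x = 0 -> x = 0,
  exists n0, forall n, (n0 <= n)%N -> forall x,
    adic I M n x -> adic I M n.+2 (a *: x) -> adic I M n.+1 x,
  exists n0, forall n, (n0 <= n)%N -> forall x,
    adic I M n x -> H0gr m I M n.+1 (a *: x) -> H0gr m I M n x &
  exists n0, forall n, (n0 <= n)%N -> forall x, adic I M n x ->
    (H0gr m I M n.+1 +: imul m (adic I M n.+1)) (a *: x) ->
    (H0gr m I M n +: imul m (adic I M n)) x].
have avP : avoidable I P.
  have := avoidable_and
    (avoidable_and (avoidable_regular accR accM tf)
       (avoidable_filter_regular accR accM (graded_adicS I M)))
    (avoidable_and (avoidable_filter_regular accR accM (graded_H0gr m I M))
       (avoidable_filter_regular accR accM (graded_fiber m I M))).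
  by apply: avoidable_imp => a _ [[? ?] [? ?]].
have HP a : I a -> P a -> exists (M' : lmodType R) (f : {linear M -> M'}) (e : nat),
  [/\ forall y, exists x, f x = y, sker f = amul a (sfull M),
      (d.+1`!%:R * (len_H0gr M n)%:R / n%:R ^+ d.+1 : K) @[n --> \oo] --> (e%:R : K) &
      general mm II d.+1 (general_formula M' d e)].
  move=> Ia [reg sup regQ regf].
  have [M' [f [f_surj Ef]]] := quotient_exists (amul a (sfull M)).
  have [e [lim gen]] := IH M' (noetherian_surj f_surj accM)
    (dim_le_regular_quotient accR f_surj Ef reg dM).
  exists M', f, e; split=> //.
  have [C [n0 H0]] := H0gr_recursion locR accR accM Ia sup regQ regf f_surj Ef.
  have [c [n1 H1]] := fiber_growth locR Im accR t_distinct accM dM.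
  apply: (cvg_recursion (C := C) (n0 := (n0 + n1)%N) _ _ lim).
    by move=> n nn; apply: H0; apply: leq_trans nn; apply: leq_addr.
  by move=> n nn; apply: H1; apply: leq_trans nn; apply: leq_addl.
have [a0 Ia0 Pa0] := avoidable_exists locR t_distinct avP.
have [M0 [f0 [e [_ _ lim0 _]]]] := HP _ Ia0 Pa0.
exists e; split=> //.
have [U [oU nU HU]] := general_step locR accR t_distinct avP.
exists U; split=> // a /HU Pa; set b : R := val a in Pa *.
have [M' [f [e' [f_surj Ef lim gen]]]] := HP b (valP a) Pa.
have {}gen : general mm II d.+1 (general_formula M' d e).
  (* The value [e'] from M/bM is also the limit of the sequence of M, already identified as [e]
     through [a0]. *)
  have -> : e = e'; last by [].
  apply/eqP; rewrite -(eqr_nat K); apply/eqP.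
  exact: cvg_unique lim0 lim.
apply: general_mono gen => s; apply: general_formula_spre => //.
rewrite /gen_sat /= spre_sat // spre_imul // spre_full Ef; congr sat.
apply: submod_ext.
  apply: sadd_le; last by apply: amul_imul_le; apply: mem_head.
  by apply: imul_monol => r; rewrite in_cons orbC => ->.
apply/imul_leP => r x; rewrite in_cons => /orP[/eqP->|rs] _.
  by apply: saddr; apply: mem_amul.
by apply: saddl; apply: mem_imul.
Qed.

Lemma jmult_formulaP d (M : lmodType R) : noetherian_mod M ->
  dim_le (annq (szero M)) d.+1 -> jmult_formula M d.
Proof.
elim: d M => [|d IH] M accM dM;
  have [M' [f [f_surj Ef]]] := quotient_exists (sat I (szero M));
  apply: (jmult_formula_torsion accM f_surj Ef);
  have accM' := noetherian_surj f_surj accM;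
  have tf := torsion_free_quotient accM f_surj Ef;
  have dM' := dim_le_quotient f_surj dM.
- exact: jmult_formula_dim1.
- exact: jmult_formula_step.
Qed.

End Main.

(** * Comparison with the definitions of the statement *)

Section Idealr.
Variable R : comNzRingType.

Section OfProper.
Variables (B : ideal R) (nB : ~ B 1).

(** The [let] makes the predicate carry the proof [nB], from which its structure of proper ideal is
    inferred. *)
Definition proper_pred : {pred R} := let _ := nB in fun x => `[< B x >].

Lemma proper_pred_closed : idealr_closed proper_pred.
Proof.
split; first by apply/asboolP; apply: (submod0 B).
  by apply/asboolP.
by move=> a x y /asboolP Bx /asboolP By; apply/asboolP; apply: (submod_lin a Bx By).
Qed.
HB.instance Definition _ := isIdealr.Build R proper_pred proper_pred_closed.

End OfProper.

Section OfPrime.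
Variables (P : ideal R) (pP : prime_ideal P).

Definition prime_pred : {pred R} := let _ := pP in fun x => `[< P x >].

Lemma prime_pred_closed : idealr_closed prime_pred.
Proof. exact: (proper_pred_closed pP.1). Qed.
HB.instance Definition _ := isIdealr.Build R prime_pred prime_pred_closed.

Lemma prime_pred_prime : prime_idealr_closed prime_pred.
Proof.
by move=> u v /asboolP /pP.2 [H|H]; apply/orP; [left|right]; apply/asboolP.
Qed.
HB.instance Definition _ := isPrimeIdealrClosed.Build R prime_pred prime_pred_prime.

End OfPrime.

Lemma prime_ideal_of (p : prime_idealr R) : prime_ideal (submod_of (idl p)).
Proof.
split; first by change (1 \in p -> False); rewrite idealr1.
move=> a b; change (a * b \in p -> a \in p \/ b \in p).
by rewrite prime_idealrM => /orP.
Qed.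

Lemma prime_chainP (A : ideal R) (J : {pred R}) n : (forall r, r \in J <-> A r) ->
  prime_chain J n <-> exists p, primes_chain A n p.
Proof.
move=> JA; split=> [[p [H1 H2]]|[p [H1 H2]]].
  exists (fun i => submod_of (idl (p i))); split=> i ilt.
    by split; [apply: prime_ideal_of|move=> r /JA; apply: H1].
  by have [? ?] := H2 i ilt.
(* Only indices up to [n] are known to carry primes, while [prime_chain] wants one at every index:
   beyond [n] the last prime is repeated. *)
have pr i : exists q : prime_idealr R, forall r, r \in q <-> p (minn i n) r.
  have [pP _] := H1 (minn i n) (geq_minr _ _).
  by exists (prime_pred pP) => r; split=> /asboolP.
pose q i := sval (cid (pr i)).
have qP i : (i <= n)%N -> forall r, r \in q i <-> p i r.
  by move=> ile r; rewrite /q; case: cid => /= q' ->; rewrite (minn_idPl ile).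
exists q; split=> i ilt.
  by move=> r /JA Ar; apply/qP => //; apply: (H1 i ilt).2.
have [pp npp] := H2 i ilt; have ile := ltnW ilt.
split; first by move=> r /(qP _ ile) /pp; apply: (qP _ ilt _).2.
by move=> qq; apply: npp => r /(qP _ ilt) /qq /(qP _ ile).
Qed.

Variables (K : realType).

Lemma krull_dim_le (A : ideal R) (J : {pred R}) d : (forall r, r \in J <-> A r) ->
  (krull_dim K J <= d%:R%:E)%E <-> dim_le A d.
Proof.
move=> JA; split=> [H n p ch|H].
  rewrite -(ler_nat K) -lee_fin; apply: le_trans H; apply: ereal_sup_ubound.
  by exists n => //; apply/(prime_chainP _ JA); exists p.
apply: ge_ereal_sup => _ [n /(prime_chainP _ JA) [p /H nd] <-].
by rewrite lee_fin ler_nat.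
Qed.

Lemma krull_dim1 (A : ideal R) (J : {pred R}) p : (forall r, r \in J <-> A r) ->
  dim_le A 1 -> primes_chain A 1 p -> krull_dim K J = 1%:E.
Proof.
move=> JA dA ch; apply/eqP; rewrite eq_le; apply/andP; split.
  exact/(krull_dim_le 1 JA).
by apply: ereal_sup_ubound; exists 1%N => //; apply/(prime_chainP _ JA); exists p.
Qed.

End Idealr.

Section Local.
Variables (R : comNzRingType) (mm : idealr R).
Local Notation m := (submod_of (idl mm) : ideal R).

Lemma noetherian_noetherian_mod : noetherian R -> noetherian_mod (R^o : lmodType R).
Proof.
move=> noethR; apply: noetherian_of_fg => A.
have [s Es] := noethR (submod_pred A); exists s; apply: submod_ext => x.
  move=> Ax; have : x \in submod_pred A by apply/submod_predP.
  by rewrite Es => /asboolP /(_ (submod_pred (span s))) H; apply/submod_predP;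
    apply: H => y ys; apply/submod_predP; apply: mem_span.
apply: (_ : span s <=: A) => //; apply/span_le => y ys; apply/submod_predP.
by rewrite Es; apply/asboolP => N; apply.
Qed.

(** A nonunit generates a proper ideal, which lies in a maximal one by the chain condition, hence in
    [mm] by uniqueness. *)
Lemma local_ring_local_at : noetherian R -> local_ring_with mm -> local_at m.
Proof.
move=> /noetherian_noetherian_mod accR [max_mm uniq_mm]; split.
  by change (1 \in mm -> False); rewrite idealr1.
move=> r nmr; apply: contrapT => no_inv.
have Cr : ~ (cyc (r : R^o)) 1.
  by move=> [s Es]; apply: no_inv; exists s.
have [B [_ [rB nB] mx]] := acc_maximal accR (P := fun B : ideal R => cyc (r : R^o) <=: B /\ ~ B 1)
   Logic.I (conj (@sle_refl _ _ _) Cr).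
apply: nmr; change (r \in mm).
rewrite -(uniq_mm (proper_pred nB : idealr R)).
  by apply/asboolP; apply: rB; apply: mem_cyc.
move=> J BJ x; apply/idP/asboolP; last by move=> Bx; apply: BJ; apply/asboolP.
move=> xJ; have BJ' : B <=: submod_of (idl J).
  by move=> y By; apply: BJ; apply/asboolP.
apply: (mx (submod_of (idl J))) => //; split; first exact: sle_trans BJ'.
by change (1 \in J -> False); rewrite idealr1.
Qed.

Lemma distinct_residues : infinite_set [set: {ideal_quot mm}] ->
  exists t : nat -> R, forall i j : nat, i != j -> ~ m (t i - t j).
Proof.
move=> /infiniteP /card_leP [g].
pose e (i : nat) : set_type [set: nat] := SigSub (mem_set (Logic.I : [set: nat]%classic i)).
exists (fun i => repr (val (g (e i)))) => i j ij mij.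
move/negP: ij; apply; apply/eqP; apply: (congr1 val (_ : e i = e j)).
apply: (@inj _ _ _ g); rewrite ?inE //; apply: val_inj.
rewrite -[LHS]reprK -[RHS]reprK; apply/eqP; rewrite -Quotient.idealrBE.
exact: mij.
Qed.

End Local.

(** * Submodule operations of the statement *)

Section Submodules.
Variables (R : comNzRingType) (M : lmodType R).
Implicit Types (N L : submodClosed M) (J : submodClosed R^o).

Lemma submod_of_pred (A : submod M) : submod_of (submod_pred A) = A.
Proof. by apply: submod_ext => x /submod_predP. Qed.

Lemma submod_of_genm (S : set M) (A : submod M) :
  (forall B : submod M, A <=: B <-> (forall x, S x -> B x)) -> submod_of (genm S) = A.
Proof.
move=> HA; apply: submod_ext; last first.
  by apply/HA => x Sx; apply/asboolP => N; apply.
move=> x /asboolP Hx; apply/submod_predP; apply: Hx => y Sy; apply/submod_predP.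
by move: y Sy; apply/HA.
Qed.

Lemma submod_of_mulm J N :
  submod_of (mulm J N) = imul (submod_of J : ideal R) (submod_of N).
Proof.
apply: submod_of_genm => B; split=> [/imul_leP H _ [a [x [aJ xN ->]]]|H].
  exact: H.
by apply/imul_leP => a y aJ yN; apply: H; exists a, y.
Qed.

Lemma submod_of_addm N L : submod_of (addm N L) = submod_of N +: submod_of L.
Proof.
apply: submod_of_genm => B; split=> [H x [Nx|Lx]|H].
- by apply: H; apply: saddl.
- by apply: H; apply: saddr.
- by apply: sadd_le => x Hx; apply: H; [left|right].
Qed.

Lemma submod_of_fullm : submod_of (fullm M) = sfull M.
Proof. exact: submod_ext. Qed.

Lemma submod_of_zerom : submod_of (zerom M) = szero M.
Proof. by apply: submod_ext => [x /eqP|x ->] //; apply: eqxx. Qed.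

End Submodules.

Section Powers.
Variables (R : comNzRingType) (M : lmodType R).
Implicit Types (N L : submodClosed M) (J : submodClosed R^o).

Lemma submod_of_idealX J n :
  submod_of (idealX J n) = ipow (submod_of J : ideal R) n (sfull R^o).
Proof.
elim: n => [|n IH] /=; first exact: submod_of_fullm.
by rewrite submod_of_mulm IH.
Qed.

Lemma submod_of_adic (II : idealr R) n :
  submod_of (mulm (idealX (idl II) n) (fullm M)) = adic (submod_of (idl II)) M n.
Proof. by rewrite submod_of_mulm submod_of_idealX submod_of_fullm imul_ipow_full. Qed.

Lemma submod_of_satm N J :
  submod_of (satm N J) = sat (submod_of J : ideal R) (submod_of N).
Proof.
have E n x : (forall a, a \in idealX J n -> (a : R) *: x \in N) <->
    cpow (submod_of J : ideal R) n (submod_of N) x.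
  rewrite cpow_mem -imul_ipow_full -submod_of_idealX imul_leP.
  split=> [H a _ aJ [r ->]|H a aJ]; last by apply: H => //; apply: mem_cyc.
  rewrite scalerA mulrC -scalerA; apply: submodZ; exact: H.
by apply: submod_ext => x; [move=> /asboolP [n /E]|move=> [n /E Hn]; apply/asboolP]; exists n.
Qed.

Lemma submod_of_idgen (s : seq R) N :
  submod_of (mulm (idgen s) N) = imul (fun r => r \in s) (submod_of N).
Proof.
rewrite submod_of_mulm -imul_span; congr imul.
have -> : submod_of (idgen s) = span (s : seq R^o) => //.
apply: submod_of_genm => B; split=> [/span_le|H]; first by [].
exact/span_le.
Qed.

End Powers.

Lemma imul_seq1 (R : comNzRingType) (M : lmodType R) (a : R) (A : submod M) :
  imul (fun r => r \in [:: a]) A = amul a A.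
Proof.
apply: submod_ext; last by apply: amul_imul_le; apply: mem_head.
by apply/imul_leP => r x; rewrite inE => /eqP -> Ax; apply: mem_amul.
Qed.

Section Injection.
Variables (R : comNzRingType) (M M' : lmodType R) (f : {linear M -> M'}).
Hypothesis f_inj : injective f.
Implicit Types (A B : submod M).

Lemma simg_sle A B : A <=: B <-> simg f A <=: simg f B.
Proof.
split=> [AB _ [x Ax ->]|AB x Ax]; first by exists x => //; apply: AB.
by have [|y By /f_inj ->] := AB (f x); first by exists x.
Qed.

Lemma length_ge_simg A B n : length_ge A B n <-> length_ge (simg f A) (simg f B) n.
Proof.
split; first by apply: (length_ge_map (phi := simg f)) => P Q _ PQ _;
  split=> [|/simg_sle //]; apply/simg_sle.
have E C : spre f (simg f C) = C.
  by apply: submod_ext => [x [y Cy /f_inj ->] //|x Cx]; exists x.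
move=> H; rewrite -(E A) -(E B).
apply: (length_ge_map (phi := spre f)) H => P Q AP PQ QB.
split=> [x|H y Qy]; first exact: PQ.
have [x _ Ey] := QB y Qy; rewrite Ey; apply: (H x).
by change (Q (f x)); rewrite -Ey.
Qed.

Lemma len_simg A B : A <=: B -> len A B = len (simg f A) (simg f B) /\
  (fin_length A B <-> fin_length (simg f A) (simg f B)).
Proof.
move=> AB; have [] // := len_iso AB ((simg_sle A B).1 AB).
by move=> n; apply: length_ge_simg.
Qed.

End Injection.

(** * Lengths and j-multiplicity of the statement *)

Section LengthE.
Variables (K : realType) (R : comNzRingType).

(** [submod_chain] fixes neither end, so its top term is first enlarged to M. Conversely the
    recursive chain becomes a function of the index, built by induction with prescribed top term. *)
Lemma submod_chainP (M : lmodType R) n :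
  submod_chain M n <-> length_ge (szero M) (sfull M) n.
Proof.
split=> [[N HN]|].
  apply: (length_ge_monor (N := submod_of (N n))) => //.
  elim: n HN => [|n IH] HN; first exact: szero_le.
  have [NN nNN] := HN n (ltnSn n).
  exists (submod_of (N n)); split=> //; apply: IH => i /ltnW; exact: HN.
move: (sfull M) => L; elim: n L => [|n IH] L; first by exists (fun=> zerom M : submodClosed M).
move=> [P [PL nLP LP]].
suff [N [HN EN]] : exists N : nat -> submodClosed M, (forall i, (i < n)%N ->
    {subset N i <= N i.+1} /\ ~ {subset N i.+1 <= N i}) /\ submod_of (N n) = P.
  exists (fun i => if (i <= n)%N then N i else (submod_pred L : submodClosed M)) => i i_n.
  have [->|ilt] : i = n \/ (i < n)%N by lia.
    rewrite leqnn ltnn; split=> [x Nx|H].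
      by apply/submod_predP; apply: PL; rewrite -EN.
    by apply: nLP => x Lx; rewrite -EN; apply: H; apply/submod_predP.
  by rewrite ilt (ltnW ilt); apply: HN.
elim: n P LP {IH PL nLP} => [|n IH] P /=.
  by exists (fun=> submod_pred P : submodClosed M); split=> //; apply: submod_of_pred.
move=> [Q [QP nPQ /IH [N [HN EN]]]].
exists (fun i => if (i <= n)%N then N i else (submod_pred P : submodClosed M)).
rewrite ltnn; split; last exact: submod_of_pred.
move=> i i_n; have [->|ilt] : i = n \/ (i < n)%N by lia.
  rewrite leqnn ltnn; split=> [x Nx|H].
    by apply/submod_predP; apply: QP; rewrite -EN.
  by apply: nPQ => x Px; rewrite -EN; apply: H; apply/submod_predP.
by rewrite ilt (ltnW ilt); apply: HN.
Qed.

Lemma lengthE (M : lmodType R) : fin_length (szero M) (sfull M) ->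
  length K M = (len (szero M) (sfull M))%:R%:E.
Proof.
move=> f; have [H1 H2] := lenP (@szero_le _ _ _) f.
apply/eqP; rewrite eq_le; apply/andP; split.
  by apply: ge_ereal_sup => _ [n /submod_chainP /H2 nl <-]; rewrite lee_fin ler_nat.
by apply: ereal_sup_ubound; exists (len (szero M) (sfull M)) => //; apply/submod_chainP.
Qed.

Lemma length_quom (M : lmodType R) (L : submodClosed M) (A : submod M) :
  submod_of L = A -> fin_length A (sfull M) -> length K (quom L) = (len A (sfull M))%:R%:E.
Proof.
move=> EA f.
have [H1 H2] := len_spre (@quo_proj_surj _ _ L) (@szero_le _ _ (sfull (quom L))).
have E : spre (quo_proj L) (szero (quom L)) = A by rewrite -EA; apply: quo_proj_ker.
by rewrite E spre_full in H1 H2; rewrite lengthE ?H2 //; apply/H1.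
Qed.

Lemma length_subm (M : lmodType R) (S : submodClosed M) :
  fin_length (szero M) (submod_of S) ->
  length K (subm S) = (len (szero M) (submod_of S))%:R%:E.
Proof.
move=> f; have inj := @val_inj _ _ (subm S).
have [H1 H2] := len_simg (f := (val : {linear subm S -> M})) inj (@szero_le _ _ (sfull (subm S))).
have E0 : simg (val : {linear subm S -> M}) (szero (subm S)) = szero M.
  by apply: submod_ext => [_ [x -> ->]|_ ->]; [|exists 0]; rewrite ?raddf0.
have E1 : simg (val : {linear subm S -> M}) (sfull (subm S)) = submod_of S.
  apply: submod_ext => [_ [x _ ->]|x Sx]; first exact: valP.
  by exists (Sub x Sx); rewrite ?SubK.
by rewrite E0 E1 in H1 H2; rewrite lengthE ?H1 //; apply/H2.
Qed.

End LengthE.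

Import numFieldNormedType.Exports.
Local Open Scope classical_set_scope.

Section Jmult.
Variables (K : realType) (R : comNzRingType) (mm II : idealr R).
Local Notation m := (submod_of (idl mm) : ideal R).
Local Notation I := (submod_of (idl II) : ideal R).
Hypothesis locR : local_at m.
Variables (M : lmodType R) (accM : noetherian_mod M).

(** The local cohomology is a submodule of a quotient of a submodule of M: it is pulled back along
    the projection, then pushed into M along the inclusion. *)
Lemma length_H0_grm n :
  length K (subm (H0 (idl mm) (grm (idl II) M n))) = (len_H0gr mm II M n)%:R%:E.
Proof.
rewrite /grm; set N := mulm (idealX (idl II) n) _; set L := mulm (idealX (idl II) n.+1) _.
have EN : submod_of N = adic I M n by apply: submod_of_adic.
have EL : submod_of L = adic I M n.+1 by apply: submod_of_adic.
pose v : {linear subm N -> M} := val.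
have v_inj : injective v by apply: val_inj.
have simg_v A : simg v (spre v A) = adic I M n &: A.
  rewrite -EN; apply: submod_ext => [_ [x Ax ->]|x [Nx Ax]].
    by split=> //; apply: valP.
  by exists (exist _ x Nx : subm N).
have EB : submod_of (restrm N L) = spre v (adic I M n.+1).
  by rewrite -EL; apply: submod_ext.
have ES : submod_of (H0 (idl mm) (quom (restrm N L))) = sat m (szero _).
  by rewrite submod_of_satm submod_of_zerom.
have le0 : szero (quom (restrm N L)) <=: sat m (szero _) by apply: szero_le.
have [H1 H2] := len_spre (@quo_proj_surj _ _ (restrm N L)) le0.
have Ek : spre (quo_proj (restrm N L)) (szero _) = spre v (adic I M n.+1).
  by rewrite -EB; apply: quo_proj_ker.
rewrite spre_sat Ek -spre_sat in H1 H2.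
have leB : spre v (adic I M n.+1) <=: spre v (sat m (adic I M n.+1)).
  by move=> x Ax; exists 0%N.
have [H3 H4] := len_simg v_inj leB.
have EF : adic I M n &: adic I M n.+1 = adic I M n.+1.
  by rewrite scapC; apply: scap_idl; apply: adicS.
rewrite !simg_v EF in H3 H4.
rewrite length_subm ES ?H2 ?H3 //.
by apply/H1/H4; apply: fin_H0gr.
Qed.

Lemma jmult_seqE d n : jmult_seq K (idl mm) d.+1 (idl II) M n =
  (d`!%:R * (len_H0gr mm II M n)%:R / n%:R ^+ d)%:E.
Proof. by rewrite /jmult_seq length_H0_grm /= -EFinM mulrAC. Qed.

End Jmult.

Lemma cvg_affine (K : realType) (u : nat -> nat) (e n0 : nat) :
  (forall n, (n0 <= n)%N -> u n = (u n0 + (n - n0) * e)%N) ->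
  ((u n)%:R / n%:R : K) @[n --> \oo] --> (e%:R : K).
Proof.
move=> Hu; have -> : (e%:R : K) = e%:R + ((u n0)%:R - n0%:R * e%:R) * 0 by rewrite mulr0 addr0.
apply: cvg_trans (_ : e%:R + ((u n0)%:R - n0%:R * e%:R) * (n%:R)^-1 @[n --> \oo] --> _); last first.
  apply: cvgD; first exact: cvg_cst.
  apply: cvgM; first exact: cvg_cst.
  apply/gtr0_cvgV0; last exact: cvgr_idn.
  by exists 1%N => // n /=; rewrite ltr0n.
apply: near_eq_cvg; exists (n0 + 1)%N => // n /= nn.
have n_neq0 : n%:R != 0 :> K by rewrite pnatr_eq0; lia.
rewrite (Hu n) ?(leq_trans (leq_addr _ _) nn) // natrD natrM natrB ?(leq_trans (leq_addr _ _) nn) //.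
by field.
Qed.

Theorem theorem3p6 (K : realType) (R : comNzRingType) (m : idealr R)
    (noethR : noetherian R) (locR : local_ring_with m)
    (dimR : (0 < krull_dim K (pred1 (0%R : R)))%E)
    (infk : infinite_set [set: {ideal_quot m}])
    (I : idealr R) (d : nat) (d_gt0 : (0 < d)%N)
    (M : lmodType R) (fgM : finitely_generated (fullm M))
    (dimM : (dimm K M <= d%:R%:E)%E) :
  cvgn (jmult_seq K (idl m) d (idl I) M) /\
  general m I d (fun a =>
    let X := satm (mulm (idgen (take d.-1 a)) (fullm M)) (idl I) in
    let aM := mulm (idgen [:: nth 0 a d.-1]) (fullm M) in
    let N := quom X : lmodType R in
    [/\ (length K (quom (mulm (idl I) (fullm N))) < +oo)%E,
        cvgn (hs_seq K (idl I) N),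
        jmult K (idl m) d (idl I) M = hs_mult K (idl I) N,
        hs_mult K (idl I) N = length K (quom (addm X aM)) &
        (length K (quom (addm X aM)) < +oo)%E]).
Proof.
case: d d_gt0 dimM => // d _ dimM.
have accR := noetherian_noetherian_mod noethR.
have loc := local_ring_local_at noethR locR.
have [t t_distinct] := distinct_residues infk.
have Im : submod_of (idl I) <=: submod_of (idl m).
  apply: (proper_le_max loc); change (1 \in I -> False).
  by rewrite idealr1.
have accM : noetherian_mod M.
  have [s Es] := fgM; apply: (noetherian_fg_mod (s := s)) accR _ => x _.
  have /asboolP : x \in genm [set` s] by rewrite -Es.
  move=> /(_ (submod_pred (span s))) H; apply/submod_predP; apply: H => y ys.
  by apply/submod_predP; apply: mem_span.
have dM : dim_le (annq (szero M)) d.+1.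
  have annM (r : R) : r \in annm M <-> annq (szero M) r by split=> /asboolP.
  exact/(@krull_dim_le R K _ _ d.+1 annM).
have [e [lim gen]] := jmult_formulaP K loc Im accR t_distinct accM dM.
have jlim : jmult_seq K (idl m) d.+1 (idl I) M @ \oo --> (e%:R)%:E.
  apply: cvg_EFin; first by near=> n; rewrite jmult_seqE.
  apply: cvg_trans lim; apply: near_eq_cvg; near=> n.
  by rewrite /= jmult_seqE.
have jE : jmult K (idl m) d.+1 (idl I) M = (e%:R)%:E by apply: cvg_lim.
split; first by apply/cvg_ex; exists (e%:R)%:E.
apply: general_mono gen => a.
move=> [fI dimX [n0 HX] fa la] X aM N.
set X' := gen_sat _ _ _ in fI dimX HX fa la.
have EX : submod_of X = X'.
  by rewrite submod_of_satm submod_of_idgen submod_of_fullm.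
have EaM : submod_of aM = amul (nth 0 a d) (sfull M).
  by rewrite submod_of_idgen submod_of_fullm imul_seq1.
have kX : sker (quo_proj X) = X' by rewrite quo_proj_ker.
have surj := @quo_proj_surj _ _ X.
have lenN (B : submod N) (A : submod M) : spre (quo_proj X) B = A +: X' ->
    (fin_length B (sfull N) <-> fin_length (X' +: A) (sfull M)) /\
    len B (sfull N) = len (X' +: A) (sfull M).
  move=> EB; have [H ->] := len_spre surj (@sle_full _ _ B).
  by rewrite H spre_full EB (saddC A).
have lenI : length K (quom (mulm (idl I) (fullm N))) =
    (len (X' +: imul (submod_of (idl I) : ideal R) (sfull M)) (sfull M))%:R%:E.
  have [|H1 H2] := lenN (imul (submod_of (idl I) : ideal R) (sfull N))
    (imul (submod_of (idl I) : ideal R) (sfull M)).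
    by rewrite spre_imul // spre_full kX.
  rewrite -H2; apply: length_quom; last exact/H1.
  by rewrite submod_of_mulm submod_of_fullm.
have lenA n : (n0 <= n)%N -> length K (quom (mulm (idealX (idl I) n) (fullm N))) =
    (len (X' +: adic (submod_of (idl I)) M n) (sfull M))%:R%:E.
  move=> nn; have [|H1 H2] := lenN (adic (submod_of (idl I)) N n) (adic (submod_of (idl I)) M n).
    by rewrite (spre_adic _ surj) kX.
  rewrite -H2; apply: length_quom; last by apply/H1; case: (HX n nn).
  exact: submod_of_adic.
have lenaM : length K (quom (addm X aM)) = (e%:R)%:E.
  by rewrite -la; apply: length_quom => //; rewrite submod_of_addm EX EaM.
have hlim : hs_seq K (idl I) N @ \oo --> (e%:R)%:E.
  (* If N = 0 the sequence is eventually 0, in agreement with [e]. Otherwise dim N = 1, so [hs_seq]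
     divides by n and the affine lengths give their slope [e]. *)
  have [XM|[dX [q chq]]] := dimX.
    have EXM (A : submod M) : len (X' +: A) (sfull M) = 0%N.
      rewrite (_ : X' +: A = sfull M) ?len_refl //.
      by apply: submod_ext => //; apply: sle_trans XM _; apply: saddl.
    have -> : e = 0%N by rewrite -la EXM.
    apply: cvg_near_cst; exists n0 => // n /= nn.
    by rewrite /hs_seq lenA // EXM mule0.
  have annN (r : R) : r \in annm N <-> annq X' r.
    rewrite -kX -[sker _]/(spre _ _) annq_spre //.
    by split=> /asboolP.
  have D : dimm K N = 1%:E by apply: (@krull_dim1 R K _ _ _ annN dX chq).
  have hsE n : (n0 <= n)%N -> hs_seq K (idl I) N n =
      ((len (X' +: adic (submod_of (idl I)) M n) (sfull M))%:R / n%:R)%:E.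
    move=> nn; rewrite /hs_seq D /= truncn1 lenA // factS fact0 muln1 expr1 -EFinM.
    by rewrite mul1r mulrC.
  apply: cvg_EFin; first by exists n0 => // n /= /hsE ->.
  apply: cvg_trans (cvg_affine (K := K) (fun n nn => (HX n nn).2)).
  apply: near_eq_cvg; exists n0 => // n /= /hsE ->.
  by [].
have hE : hs_mult K (idl I) N = (e%:R)%:E by apply: cvg_lim.
by split; rewrite ?lenI ?ltry ?jE ?hE ?lenaM ?ltry //; apply/cvg_ex; exists (e%:R)%:E.
Unshelve. all: by end_near.
Qed.
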